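(* Let $\alpha\neq0$ be a real constant, $u_0\in L^\infty(\mathbb{R})$ and $v_0\in L^1(\mathbb{R})$. Consider the Cauchy problem $$u_t+\left(\tfrac{u^2}{2}\right)_x+\alpha u=0,\qquad v_t+(uv)_x=0,\qquad u(x,0)=u_0(x),\quad v(x,0)=v_0(x). \qquad ( * )$$ For $\epsilon>0$ let $u^\epsilon,V^\epsilon$ be the explicit functions defined in the context from the data $(u_0,v_0)$, and let $v^\epsilon=\partial_xV^\epsilon$. 1. Let $u_0^\epsilon=u_0*\eta^\epsilon$, $v_0^\epsilon=v_0*\eta^\epsilon$, where $\eta^\epsilon$ is the standard Friedrichs mollifier, and let $(\tilde u^\epsilon,\tilde V^\epsilon)$ be defined by the same formulas as $(u^\epsilon,V^\epsilon)$ with $(u_0,v_0)$ replaced by $(u_0^\epsilon,v_0^\epsilon)$. Then, with $\tilde v^\epsilon=\partial_x\tilde V^\epsilon$, $(\tilde u^\epsilon,\tilde v^\epsilon)_{\epsilon>0}$ is a weak asymptotic solution to $( * )$. 2. For each fixed $t>0$, with $\tau=\tau(t)>0$, except for a countable number of points $x\in\mathbb{R}$, there exists a unique minimizer, denoted $y(x,\tau)=y(x,\tau(t))$, of the minimization problem $$\min_{-\infty<y<\infty}\theta(x,y,\tau).$$ At such points $(x,t)$ the limits $V^\epsilon(x,t)\to V(x,t)$ and $u^\epsilon(x,t)\to u(x,t)$ as $\epsilon\to0$ exist and are given by $$u(x,t)=e^{-\alpha t}\,\frac{x-y(x,\tau(t))}{\tau(t)},\qquad V(x,t)=\int_0^{y(x,\tau(t))}v_0(s)\,ds.$$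 Moreover $V$ is a function of bounded variation, $$v^\epsilon\to v:=\partial_xV=v_0(y(x,\tau(t)))\,\partial_x y(x,\tau(t))$$ in the sense of distributions as $\epsilon\to0$, and $(u,v)$ is a generalized solution of $( * )$.
   Context: Notation: $\tau(t)=\frac{1-e^{-\alpha t}}{\alpha}$, $\theta(x,y,\tau)=\frac{(x-y)^2}{2\tau}+\int_0^y u_0(s)\,ds$. For $x\in\mathbb{R}$, $t>0$, $\epsilon>0$: $$u^\epsilon(x,t)=e^{-\alpha t}\,\frac{\int_{\mathbb{R}}\frac{x-y}{\tau(t)}\,e^{-\theta(x,y,\tau(t))/(2\epsilon)}\,dy}{\int_{\mathbb{R}}e^{-\theta(x,y,\tau(t))/(2\epsilon)}\,dy},\qquad V^\epsilon(x,t)=\frac{\int_{\mathbb{R}}\left(\int_0^y v_0(s)\,ds\right)e^{-\theta(x,y,\tau(t))/(2\epsilon)}\,dy}{\int_{\mathbb{R}}e^{-\theta(x,y,\tau(t))/(2\epsilon)}\,dy}.$$ In the formulas for $(\tilde u^\epsilon,\tilde V^\epsilon)$, $u_0$ is also replaced by $u_0^\epsilon$ inside $\theta$. Weak asymptotic solution: a family $(u^\epsilon,v^\epsilon)_{\epsilon>0}$ of smooth functions on $\mathbb{R}\times[0,\infty)$ is a weak asymptotic solution to $( * )$ if (i) for all $\phi\in C_c^\infty(\mathbb{R})$ and each $T>0$, as $\epsilon\to0$, $$\int_{\mathbb{R}}\left(u^\epsilon_t+u^\epsilon u^\epsilon_x+\alpha u^\epsilon\right)(x,t)\,\phi(x)\,dx=o(1),\qquad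 \int_{\mathbb{R}}\left(v^\epsilon_t+(u^\epsilon v^\epsilon)_x\right)(x,t)\,\phi(x)\,dx=o(1),$$ uniformly with respect to $t\in[0,T]$; and (ii) for all $\phi\in C_c^\infty(\mathbb{R})$, as $\epsilon\to0$, $\int_{\mathbb{R}}(u^\epsilon(x,0)-u_0(x))\phi(x)\,dx=o(1)$ and $\int_{\mathbb{R}}(v^\epsilon(x,0)-v_0(x))\phi(x)\,dx=o(1)$. Generalized solution: a distribution $(u,v)$ is a generalized solution of $( * )$ if it is the distributional limit of a weak asymptotic solution of $( * )$ as $\epsilon\to0$. ''$V$ is a function of bounded variation'' is meant in the variable $x$ for each fixed $t>0$ (finite total variation on $\mathbb{R}$). Distributional convergence is on $\mathbb{R}\times(0,\infty)$. The product $v_0(y)\,\partial_xy$ is understood through the chain rule for functions of bounded variation: at a jump point of $y(\cdot,\tau(t))$ with one-sided limits $y_-,y_+$, the factor $v_0(y)$ is replaced by the average $\int_0^1v_0((1-s)y_-+sy_+)\,ds$, so that the product has mass $\int_{y_-}^{y_+}v_0(s)\,ds$ there. *)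

(* Defs.v *)
From HB Require Import structures.
From mathcomp Require Import all_boot all_order all_algebra.
From mathcomp Require Import all_classical all_reals all_analysis.
Set Implicit Arguments.
Unset Strict Implicit.
Unset Printing Implicit Defensive.
Import Order.TTheory GRing.Theory Num.Theory.
Import numFieldNormedType.Exports.
Local Open Scope classical_set_scope.
Local Open Scope ring_scope.

Section Defs.
Context {R : realType}.
Local Notation mu := (@lebesgue_measure R).

(* Functions of (x, t) are curried, f x t, and are only meaningful for t in
   the time interval I under consideration. *)

(* Derivative at t of a function on I: the increments h range over those with
   h + t in I, so it is one-sided at an end point of I that belongs to I, and
   it is derive1 g t when I is a neighbourhood of t. *)
Definition increments (I : set R) (t : R) : set_system R :=
  within [set h | I (h + t)] 0^'.

Definition derivable_in (I : set R) (g : R -> R) (t : R) : Prop :=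
  cvg ((fun h => h^-1 * (g (h + t) - g t)) @ increments I t).

Definition derive_in (I : set R) (g : R -> R) (t : R) : R :=
  lim ((fun h => h^-1 * (g (h + t) - g t)) @ increments I t).

Definition dx (f : R -> R -> R) (x t : R) : R := derive1 (f^~ t) x.
Definition dt (I : set R) (f : R -> R -> R) (x t : R) : R :=
  derive_in I (f x) t.

Fixpoint Cn_on (I : set R) (n : nat) (f : R -> R -> R) : Prop :=
  {within setT `*` I, continuous (fun p : R * R => f p.1 p.2)} /\
  if n is n'.+1 then
    [/\ forall x t, I t -> derivable (f^~ t) x 1 /\ derivable_in I (f x) t,
        Cn_on I n' (dx f) & Cn_on I n' (dt I f)]
  else True.

Definition smooth_on (I : set R) (f : R -> R -> R) : Prop :=
  forall n, Cn_on I n f.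

Definition test_function (phi : R -> R) : Prop :=
  (forall n x, derivable (derive1n n phi) x 1) /\
  exists2 K : set R, compact K & forall x, ~ K x -> phi x = 0.

Definition half_line : set R := [set t | 0 <= t].

Definition half_plane : set (R * R) := [set p | 0 < p.2].

Definition supported_in (K : set (R * R)) (phi : R -> R -> R) : Prop :=
  forall x t, ~ K (x, t) -> phi x t = 0.

(* Test functions on the open half plane t > 0, extended by 0. *)
Definition test_function2 (phi : R -> R -> R) : Prop :=
  smooth_on setT phi /\
  exists K, [/\ compact K, K `<=` half_plane & supported_in K phi].

(* Linear functional satisfying the usual seminorm estimate on every compact
   subset of the open half plane. *)
Definition is_distribution (S : (R -> R -> R) -> R) : Prop :=
  (forall (c : R) phi psi, test_function2 phi -> test_function2 psi ->
     S (fun x t => c * phi x t + psi x t) = c * S phi + S psi) /\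
  forall K, compact K -> K `<=` half_plane ->
    exists (C : R) (N : nat), forall phi (B : R),
      test_function2 phi -> supported_in K phi ->
      (forall i j, (i + j <= N)%N ->
         forall x t, `|iter i dx (iter j (dt setT) phi) x t| <= B) ->
      `|S phi| <= C * B.

Definition regular_distribution (f phi : R -> R -> R) : R :=
  \int[(mu \x mu)%E]_(p in half_plane) (f p.1 p.2 * phi p.1 p.2).

Definition dx_distribution (f phi : R -> R -> R) : R :=
  - regular_distribution f (dx phi).

Definition cvg_distribution (f : R -> R -> R -> R)
    (S : (R -> R -> R) -> R) : Prop :=
  forall phi, test_function2 phi ->
    regular_distribution (f e) phi @[e --> 0^'+] --> S phi.

Definition oriented_integral (f : R -> R) (y : R) : R :=
  if 0 <= y then \int[mu]_(s in `[0, y]) f s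
  else - \int[mu]_(s in `[y, 0]) f s.

Definition tau (a t : R) : R := (1 - expR (- (a * t))) / a.

Definition theta (u0 : R -> R) (x y r : R) : R :=
  (x - y) ^+ 2 / (2 * r) + oriented_integral u0 y.

Definition weight (a : R) (u0 : R -> R) (e x t y : R) : R :=
  expR (- (theta u0 x y (tau a t) / (2 * e))).

Definition u_eps (a : R) (u0 : R -> R) (e x t : R) : R :=
  expR (- (a * t)) *
  ((\int[mu]_y ((x - y) / tau a t * weight a u0 e x t y)) /
   (\int[mu]_y weight a u0 e x t y)).

Definition V_eps (a : R) (u0 v0 : R -> R) (e x t : R) : R :=
  (\int[mu]_y (oriented_integral v0 y * weight a u0 e x t y)) /
  (\int[mu]_y weight a u0 e x t y).

(* The formulas for u_eps and V_eps are singular at t = 0 (tau = 0); there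
   they are extended by continuity. *)
Definition extend0 (f : R -> R -> R) (x t : R) : R :=
  if 0 < t then f x t else lim (f x s @[s --> 0^'+]).

Definition bump (x : R) : R :=
  if `|x| < 1 then expR (- (1 - x ^+ 2)^-1) else 0.

Definition friedrichs (e x : R) : R :=
  e^-1 * (bump (x / e) / \int[mu]_z bump z).

Definition mollify (f : R -> R) (e x : R) : R :=
  \int[mu]_y (f y * friedrichs e (x - y)).

Definition u_tilde (a : R) (u0 : R -> R) (e : R) : R -> R -> R :=
  extend0 (u_eps a (mollify u0 e) e).

Definition V_tilde (a : R) (u0 v0 : R -> R) (e : R) : R -> R -> R :=
  extend0 (V_eps a (mollify u0 e) (mollify v0 e) e).

Definition weak_asymptotic_solution (a : R) (u0 v0 : R -> R)
    (u v : R -> R -> R -> R) : Prop :=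
  [/\ forall e, 0 < e ->
        smooth_on half_line (u e) /\ smooth_on half_line (v e),
      forall phi (T : R), test_function phi -> 0 < T ->
        forall d : R, 0 < d -> \forall e \near 0^'+,
        forall t, 0 <= t <= T ->
          `|\int[mu]_x ((dt half_line (u e) x t + u e x t * dx (u e) x t
                         + a * u e x t) * phi x)| < d /\
          `|\int[mu]_x ((dt half_line (v e) x t
                         + dx (fun x t => u e x t * v e x t) x t) * phi x)| < d
    & forall phi, test_function phi ->
        (\int[mu]_x ((u e x 0 - u0 x) * phi x) @[e --> 0^'+] --> (0 : R)) /\
        (\int[mu]_x ((v e x 0 - v0 x) * phi x) @[e --> 0^'+] --> (0 : R))].

Definition generalized_solution (a : R) (u0 v0 : R -> R)
    (U W : (R -> R -> R) -> R) : Prop :=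
  [/\ is_distribution U, is_distribution W
    & exists u v : R -> R -> R -> R,
        [/\ weak_asymptotic_solution a u0 v0 u v,
            cvg_distribution u U & cvg_distribution v W]].

Definition unique_minimizer (u0 : R -> R) (x r : R) : set R :=
  [set y | (forall z, theta u0 x y r <= theta u0 x z r) /\
           forall y', (forall z, theta u0 x y' r <= theta u0 x z r) -> y' = y].

(* Arbitrary (namely 0) when there is no unique minimizer. *)
Definition minimizer (u0 : R -> R) (x r : R) : R :=
  get (unique_minimizer u0 x r).

Definition regular_points (a : R) (u0 : R -> R) (t : R) : set R :=
  [set x | unique_minimizer u0 x (tau a t) !=set0].

Definition y_min (a : R) (u0 : R -> R) (x t : R) : R :=
  minimizer u0 x (tau a t).

Definition u_lim (a : R) (u0 : R -> R) (x t : R) : R :=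
  expR (- (a * t)) * ((x - y_min a u0 x t) / tau a t).

Definition V_lim (a : R) (u0 v0 : R -> R) (x t : R) : R :=
  oriented_integral v0 (y_min a u0 x t).

(* Finite total variation of a function whose domain is D: only partitions
   with all their points in D are used. *)
Definition bounded_variation_in (D : set R) (f : R -> R) : Prop :=
  has_ubound [set r | exists a b s,
    [/\ itv_partition a b s, {in a :: s, forall x, D x}
      & r = variation a b f s]].

(* The factor of the BV chain rule; it is f b when a = b. *)
Definition averaged (f : R -> R) (a b : R) : R :=
  \int[mu]_(s in `[0, 1]) f ((1 - s) * a + s * b).

End Defs.

(* Main.v *)
(** Through the change of time [tau], the formulas for [u] and [V] are the
    Hopf-Cole solution of the equations with a viscosity of size
    [e * exp (- a t)]: the residual of the first equation is this viscosity times
    [u_xx], and that of the second is this viscosity times [v_xx = V_xxx].  Once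
    the derivatives are moved to the test function, only the sup norms of [u] and
    [V] matter, and these are bounded independently of [e]; hence the residuals
    are [O(e)], uniformly in [t].

    As [e] tends to [0], Laplace's method concentrates the weights on the
    minimizers of [theta].  These increase with [x], so that non-uniqueness
    occurs only at the jumps of a monotone function.  Since [V] is bounded, the
    pointwise limits pass to distributions by dominated convergence.  The
    right-continuous version [F] of the minimizer differs from the identity by a
    bounded function, and its Stieltjes measure is the image of the Lebesgue
    measure under its generalized inverse [X].  Both the pairing of [V_x] with
    [phi] and the Stieltjes integral of [phi] times the averaged [v0] are then
    equal to the Lebesgue integral of [v0 * (phi o X)].

    Changing [u0] on a null set alters none of the objects involved, so it may be
    assumed to be bounded everywhere. *)
Require Import Defs.
From HB Require Import structures.
From mathcomp Require Import all_boot all_order all_algebra.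
From mathcomp Require Import all_classical all_reals all_analysis.
From mathcomp Require Import ess_sup_inf measurable_realfun lebesgue_integral_under ring lra.
Import Order.TTheory GRing.Theory Num.Theory.
Import numFieldNormedType.Exports.
Local Open Scope classical_set_scope.
Local Open Scope ring_scope.
Set Implicit Arguments.
Unset Strict Implicit.
Unset Printing Implicit Defensive.

(** * Real integrals and derivatives *)

(** Three obstacles shape the proof. Smoothness is required up to t = 0, where the formulas are
    singular. The substitution y = x + 2 sqrt(e tau) z removes the singularity; the square root is
    not differentiable at 0, but an integration by parts in z leaves a t-derivative without negative
    powers of t. All derivatives then fall on the data, whence their mollification. Next, for
    mollified data the exponent in Laplace's method depends itself on e. The primitive of the
    bounded function [u0] moves by O(e) only, so after the division by 2 e the weights change by a
    factor bounded above and below, and Laplace's method is set up for weights known up to such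
    factors. Finally, [v0] is merely integrable, so its averages over the jumps of the minimizer
    admit no uniform bound. Their integrability against the Stieltjes measure is itself an outcome
    of Fubini's theorem, applied to a kernel that spreads the mass of [v0] over the jump
    intervals. *)

Section sequential_criteria.
Context {R : realType} {T : pseudoMetricType R}.

(** Dominated convergence speaks of sequences; this brings it to bear on the continuity of integrals
    in their parameters. *)
Lemma cvg_within_seqP (D : set T) (f : T -> R) (p : T) (l : R) :
  (forall u : nat -> T, (forall n, D (u n)) -> u n @[n --> \oo] --> p ->
    f (u n) @[n --> \oo] --> l) ->
  f x @[x --> within D (nbhs p)] --> l.
Proof.
move=> fu; apply/cvgrPdist_lt => /= e e0; apply: contrapT => /= nfar.
have step (n : nat) : exists x, [/\ D x, ball p n.+1%:R^-1 x & e <= `|l - f x|].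
  apply: contrapT => nex; apply: nfar.
  have n0 : 0 < n.+1%:R^-1 :> R by rewrite invr_gt0 ltr0n.
  rewrite near_withinE; near=> x => Dx.
  rewrite ltNge; apply/negP => le_e; apply: nex; exists x; split => //.
  by near: x; exact: nbhsx_ballx.
have [u uP] := choice step.
have up : u n @[n --> \oo] --> p.
  apply/cvg_ballP => d d0.
  have : (n.+1%:R^-1 : R) @[n --> \oo] --> (0 : R) by exact: cvg_harmonic.
  move/cvgrPdist_lt => /(_ d d0); apply: filterS => n.
  rewrite sub0r normrN gtr0_norm ?invr_gt0 ?ltr0n// => nd.
  have [_ + _] := uP n; apply: le_ball; exact: ltW.
have Du n : D (u n) by have [] := uP n.
have /cvgrPdist_lt/(_ e e0) [N _ /(_ N (leqnn N))] := fu u Du up.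
by apply/negP; rewrite -leNgt; have [] := uP N.
Unshelve. all: end_near. Qed.

Lemma continuous_seqP (f : T -> R) :
  (forall (p : T) (u : nat -> T), u n @[n --> \oo] --> p ->
    f (u n) @[n --> \oo] --> f p) ->
  continuous f.
Proof.
move=> fu p; apply/cvgrPdist_lt => e e0.
have /cvgrPdist_lt/(_ e e0) := @cvg_within_seqP setT f p (f p) (fun u _ => fu p u).
by rewrite near_withinE; apply: filterS => x; exact.
Qed.

End sequential_criteria.

Section measurability.
Context d (T : measurableType d) (R : realType).
Implicit Types (D : set T) (f g : T -> R).

Lemma measurable_fun_expR D f : measurable_fun D f ->
  measurable_fun D (fun x => expR (f x)).
Proof. by move=> mf; exact: measurableT_comp. Qed.

Lemma measurable_fun_norm D f : measurable_fun D f ->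
  measurable_fun D (fun x => `|f x|).
Proof. by move=> mf; exact: measurableT_comp. Qed.

Lemma measurable_fun_opp D f : measurable_fun D f ->
  measurable_fun D (fun x => - f x).
Proof. by move=> mf; exact: measurableT_comp. Qed.

End measurability.

Ltac mfun := repeat first [exact: measurable_cst | exact: measurable_id | assumption
  | apply: measurable_fun_opp | apply: measurable_fun_expR
  | apply: measurable_fun_norm | apply: measurable_funD | apply: measurable_funM
  | apply: measurable_funX].

Section integrals.
Context d (T : measurableType d) (R : realType) (mu : {measure set T -> \bar R}).
Implicit Types (D : set T) (f g : T -> R).

Lemma le_integrableR D f g : measurable D -> measurable_fun D f ->
  (forall x, D x -> `|f x| <= g x) -> mu.-integrable D (EFin \o g) ->
  mu.-integrable D (EFin \o f).
Proof.
move=> mD mf fg ig; apply: (le_integrable mD _ _ ig); first exact/measurable_EFinP.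
by move=> x Dx /=; rewrite lee_fin (le_trans (fg _ Dx))// ler_norm.
Qed.

Lemma Rdominated_cvg_ae D (f_ : nat -> T -> R) f g : measurable D ->
  (forall n, measurable_fun D (f_ n)) -> measurable_fun D f ->
  {ae mu, forall x, D x -> f_ n x @[n --> \oo] --> f x} ->
  mu.-integrable D (EFin \o g) ->
  (forall n x, D x -> `|f_ n x| <= g x) ->
  mu.-integrable D (EFin \o f) /\
  \int[mu]_(x in D) f_ n x @[n --> \oo] --> \int[mu]_(x in D) f x.
Proof.
move=> mD mf_ mf cf ig fg.
have [] := @dominated_convergence _ _ _ mu D mD (fun n x => (f_ n x)%:E)
   (EFin \o f) (EFin \o g).
- by move=> n; exact/measurable_EFinP.
- exact/measurable_EFinP.
- by apply: filterS cf => x fx Dx; apply: cvg_EFin; [exact: nearW|exact: fx].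
- exact: ig.
- by apply: aeW => x n Dx /=; rewrite lee_fin fg.
move=> iF _ cF; split => //; apply: fine_cvg.
by rewrite fineK//; exact: integrable_fin_num.
Qed.

Lemma Rdominated_cvg D (f_ : nat -> T -> R) f g : measurable D ->
  (forall n, measurable_fun D (f_ n)) ->
  (forall x, D x -> f_ n x @[n --> \oo] --> f x) ->
  mu.-integrable D (EFin \o g) ->
  (forall n x, D x -> `|f_ n x| <= g x) ->
  mu.-integrable D (EFin \o f) /\
  \int[mu]_(x in D) f_ n x @[n --> \oo] --> \int[mu]_(x in D) f x.
Proof.
move=> mD mf_ cf ig fg; apply: Rdominated_cvg_ae ig fg => //; last exact: aeW.
exact: measurable_fun_cvg mf_ cf.
Qed.

Lemma Rintegral_ae_eq D f g : measurable D -> measurable_fun D f ->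
  measurable_fun D g -> {ae mu, forall x, D x -> f x = g x} ->
  \int[mu]_(x in D) f x = \int[mu]_(x in D) g x.
Proof.
move=> mD mf mg fg; congr fine; apply: ae_eq_integral => //.
- exact/measurable_EFinP.
- exact/measurable_EFinP.
- by apply: filterS fg => x fgx Dx /=; rewrite fgx.
Qed.

Lemma ler_Rintegral D f g : measurable D -> measurable_fun D f ->
  (forall x, D x -> `|f x| <= g x) -> mu.-integrable D (EFin \o g) ->
  `|\int[mu]_(x in D) f x| <= \int[mu]_(x in D) g x.
Proof.
move=> mD mf fg ig; have iff := le_integrableR mD mf fg ig.
apply: (le_trans (le_normr_Rintegral mD iff)).
apply: le_Rintegral => //.
exact: (integrable_norm iff).
Qed.

Lemma integrableR_scale D f (c : R) : measurable D ->
  mu.-integrable D (EFin \o f) -> mu.-integrable D (EFin \o (fun x => c * f x)).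
Proof. by move=> mD iff; have := integrableZl mD c iff; exact. Qed.

Lemma integrableR_add D f g : measurable D ->
  mu.-integrable D (EFin \o f) -> mu.-integrable D (EFin \o g) ->
  mu.-integrable D (EFin \o (fun x => f x + g x)).
Proof. by move=> mD iff ig; have := integrableD mD iff ig; exact. Qed.

Lemma integrableR_norm D f : measurable D ->
  mu.-integrable D (EFin \o f) -> mu.-integrable D (EFin \o (fun x => `|f x|)).
Proof. by move=> mD iff; exact: integrable_norm. Qed.

Lemma integrableR_measurable D f : mu.-integrable D (EFin \o f) -> measurable_fun D f.
Proof. by move=> iff; apply/measurable_EFinP; exact: measurable_int iff. Qed.

Lemma integrable_mulr_bounded D f g (C : R) : measurable D ->
  mu.-integrable D (EFin \o f) -> measurable_fun D g ->
  (forall x, D x -> `|g x| <= C) ->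
  mu.-integrable D (EFin \o (fun x => f x * g x)).
Proof.
move=> mD iff mg gC.
have mf : measurable_fun D f by apply/measurable_EFinP; exact: measurable_int iff.
apply: (@le_integrableR _ _ (fun x => C * `|f x|)) => //.
- exact: measurable_funM.
- by move=> x Dx; rewrite normrM mulrC ler_wpM2r// gC.
- have := integrableZl mD C (integrable_norm iff).
  exact.
Qed.

End integrals.

Section lebesgue_segment.
Context {R : realType}.
Notation mu := (@lebesgue_measure R).
Implicit Types a b x y : R.

Lemma lebesgue_measure_segment a b : a <= b -> mu `[a, b]%classic = (b - a)%:E.
Proof.
rewrite le_eqVlt => /predU1P[->|ab].
  by rewrite set_itv1 lebesgue_measure_set1 subrr.
by rewrite lebesgue_measure_itv/= lte_fin ab.
Qed.

Lemma lebesgue_measure_segment_lty a b : (mu `[a, b]%classic < +oo)%E.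
Proof.
have [ab|ba] := leP a b; first by rewrite lebesgue_measure_segment// ltry.
by rewrite set_itv_ge ?measure0// bnd_simp -ltNge.
Qed.

Lemma integrable_indic_segment a b : mu.-integrable setT (EFin \o \1_(`[a, b]%classic)).
Proof.
exact: integrable_indic_itv.
Qed.

Lemma Rintegral_indic_segment a b : a <= b ->
  \int[mu]_x \1_(`[a, b]%classic) x = b - a :> R.
Proof.
move=> ab; rewrite /Rintegral integral_indic// setIT.
by rewrite -[RHS]/(fine (b - a)%:E) -(lebesgue_measure_segment ab).
Qed.

Lemma ler_norm_dist x y : `|x| <= `|x - y| + `|y|.
Proof. by have := ler_normD (x - y) y; rewrite subrK. Qed.

End lebesgue_segment.

Section affine_change_of_variable.
Context {R : realType}.
Notation mu := (@lebesgue_measure R).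
Variables (x s : R) (s0 : 0 < s).

Let aff (z : R) : R := x + s * z.

Let measurable_aff : measurable_fun setT (aff : measurableTypeR R -> measurableTypeR R).
Proof.
apply: continuous_measurable_fun => z.
by apply: cvgD; [exact: cvg_cst|apply: cvgM; [exact: cvg_cst|exact: cvg_id]].
Qed.

(** Lebesgue measure is determined by its values on half-open intervals, where the factor [s] can be
    computed. *)
Let lebesgue_aff (A : set R) : measurable A ->
  mu A = (s%:E * pushforward mu (aff : measurableTypeR R -> measurableTypeR R) A)%E.
Proof.
pose aff' : {mfun measurableTypeR R >-> measurableTypeR R} := HB.pack (aff : measurableTypeR R -> measurableTypeR R)
  (isMeasurableFun.Build _ _ (measurableTypeR R) (measurableTypeR R) _ measurable_aff).
pose sn := NngNum (ltW s0).
apply: (@lebesgue_measure_unique R (mscale sn (pushforward mu aff'))).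
move=> _ [[a b] _ <-] /=; rewrite /mscale /pushforward.
transitivity (s%:E * mu `]((a - x) / s)%R, ((b - x) / s)%R]%classic)%E; last first.
  congr (_ * mu _)%E; apply/seteqP; split=> z /=;
    rewrite /aff !in_itv/= ltr_pdivrMr// ler_pdivlMr//.
    by move=> /andP[? ?]; apply/andP; split; lra.
  by move=> /andP[? ?]; apply/andP; split; lra.
rewrite !lebesgue_measure_itv/= !lte_fin ltr_pM2r ?invr_gt0// ltrD2r.
case: ifPn => [ab|_]; last by rewrite mule0.
by rewrite -EFinM; congr EFin; field; rewrite gt_eqF.
Qed.

Lemma ge0_integral_affine (f : R -> \bar R) : measurable_fun setT f ->
  (forall y, 0 <= f y)%E ->
  (\int[mu]_y f y = s%:E * \int[mu]_z f (x + s * z)%R)%E.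
Proof.
move=> mf f0.
pose aff' : {mfun measurableTypeR R >-> measurableTypeR R} := HB.pack (aff : measurableTypeR R -> measurableTypeR R)
  (isMeasurableFun.Build _ _ (measurableTypeR R) (measurableTypeR R) _ measurable_aff).
pose sn := NngNum (ltW s0).
rewrite (@eq_measure_integral _ _ _ _ (mscale sn (pushforward mu aff'))); last first.
  by move=> A mA _; exact: lebesgue_aff.
rewrite ge0_integral_mscale//; congr (_ * _)%E.
rewrite ge0_integral_pushforward//.
Qed.

Lemma integrable_affine (f : R -> R) : mu.-integrable setT (EFin \o f) ->
  mu.-integrable setT (EFin \o (fun z => f (x + s * z))).
Proof.
move=> /integrableP[mf fy]; apply/integrableP; split.
  exact: measurableT_comp mf measurable_aff.
move: fy; rewrite (@ge0_integral_affine (fun y => `|(f y)%:E|%E))//; last first.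
  exact: measurableT_comp mf.
apply: contraTT; rewrite -!leNgt !leye_eq => /eqP ->.
by rewrite gt0_muley// lte_fin.
Qed.

Lemma Rintegral_affine (f : R -> R) : mu.-integrable setT (EFin \o f) ->
  \int[mu]_y f y = s * \int[mu]_z f (x + s * z).
Proof.
move=> intf; have [mf _] := integrableP _ _ _ intf.
have := integrable_affine intf => intfa.
rewrite /Rintegral integralE [in RHS]integralE.
have := integrable_fin_num measurableT intfa.
have := integrable_pos_fin_num measurableT intfa.
rewrite [in X in _ -> X -> _]integralE.
rewrite (funepos_comp (EFin \o f) aff) (funeneg_comp (EFin \o f) aff) => pfin dfin.
rewrite (@ge0_integral_affine ((EFin \o f)^\+)%E)//; last exact: measurable_funepos.
rewrite (@ge0_integral_affine ((EFin \o f)^\-)%E)//; last exact: measurable_funeneg.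
by rewrite -muleBr ?fin_num_adde_defr// fineM.
Qed.

End affine_change_of_variable.

(** The inverse affine map carries integrability back to [f], so that it only has to be checked
    after rescaling, where the Gaussian is standard. *)
Lemma Rintegral_affine_comp {R : realType} (f : R -> R) (x s : R) : 0 < s ->
  (@lebesgue_measure R).-integrable setT (EFin \o (fun z => f (x + s * z))) ->
  (@lebesgue_measure R).-integrable setT (EFin \o f) /\
  \int[@lebesgue_measure R]_y f y = s * \int[@lebesgue_measure R]_z f (x + s * z).
Proof.
move=> s0 intf; have si : 0 < s^-1 by rewrite invr_gt0.
have iff : (@lebesgue_measure R).-integrable setT (EFin \o f).
  have := integrable_affine (- (s^-1 * x)) si intf; apply: eq_integrable => // y _ /=.
  by congr (f _)%:E; field; rewrite gt_eqF.
by split => //; exact: Rintegral_affine.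
Qed.

Section gaussian_integrability.
Context {R : realType}.
Notation mu := (@lebesgue_measure R).

Lemma measurable_fun_continuous (f : R -> R) : continuous f -> measurable_fun setT f.
Proof. exact: continuous_measurable_fun. Qed.

Lemma integrable_gauss_scaled (c : R) : 0 < c ->
  mu.-integrable setT (EFin \o (fun z => expR (- (c * z ^+ 2)))).
Proof.
move=> c0; have s0 : 0 < Num.sqrt c by rewrite sqrtr_gt0.
have := integrable_affine 0 s0 (@integrableT_gauss R).
apply: eq_integrable => // z _ /=.
by rewrite /gauss_fun add0r exprMn sqr_sqrtr// ltW.
Qed.

(* Completing the square: [K |z| <= K^2 / (2 c) + c z^2 / 2]. *)
Lemma integrable_exp_gauss (K c : R) : 0 < c ->
  mu.-integrable setT (EFin \o (fun z => expR (K * `|z|) * expR (- (c * z ^+ 2)))).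
Proof.
move=> c0; have c20 : 0 < c / 2 by rewrite divr_gt0.
pose g z := expR (K ^+ 2 / (2 * c)) * expR (- (c / 2 * z ^+ 2)).
apply: (@le_integrableR _ _ _ mu _ _ g) => //.
- by mfun.
- move=> z _; rewrite ger0_norm ?mulr_ge0 ?expR_ge0// /g -!expRD ler_expR.
  rewrite -[in leLHS](real_normK (num_real z)) -[in leRHS](real_normK (num_real z)).
  rewrite -subr_ge0; set w := `|z|.
  rewrite (_ : _ - _ = (c * w - K) ^+ 2 / (2 * c)); last first.
    by field; rewrite gt_eqF.
  by rewrite divr_ge0 ?sqr_ge0// mulr_ge0// ltW.
- have := integrableZl measurableT (expR (K ^+ 2 / (2 * c))) (integrable_gauss_scaled c20).
  exact.
Qed.

End gaussian_integrability.

Section derivatives.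
Context {R : realType}.
Implicit Types (f g : R -> R) (x a b c : R).

Lemma is_derive_of_cvg f x a :
  h^-1 * (f (h + x) - f x) @[h --> 0^'] --> a -> is_derive x 1 f a.
Proof.
move=> fa; have fa' : h^-1 *: (f (h *: 1 + x) - f x) @[h --> 0^'] --> a.
  by under eq_fun do rewrite /GRing.scale/= mulr1.
by apply: DeriveDef; [apply/cvg_ex; exists a|exact: cvg_lim fa'].
Qed.

Lemma is_derive_cvg f x a : is_derive x 1 f a ->
  h^-1 * (f (h + x) - f x) @[h --> 0^'] --> a.
Proof.
case=> fx <-; have : h^-1 *: (f (h *: 1 + x) - f x) @[h --> 0^'] --> 'D_1 f x.
  exact: fx.
by under eq_fun do rewrite /GRing.scale/= mulr1.
Qed.

Lemma is_derive1_continuous f x a : is_derive x 1 f a -> {for x, continuous f}.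
Proof. by case=> fx _; exact/differentiable_continuous/derivable1_diffP. Qed.

Lemma is_derive1_derive1 f x a : is_derive x 1 f a -> derive1 f x = a.
Proof. by case=> _ <-; rewrite derive1E. Qed.

Lemma is_derive1_add f g x a b : is_derive x 1 f a -> is_derive x 1 g b ->
  is_derive x 1 (fun y => f y + g y) (a + b).
Proof. by move=> fa gb; exact: is_deriveD. Qed.

Lemma is_derive1_mul f g x a b : is_derive x 1 f a -> is_derive x 1 g b ->
  is_derive x 1 (fun y => f y * g y) (a * g x + f x * b).
Proof.
move=> fa gb; have := is_deriveM fa gb.
by rewrite /GRing.scale/= addrC (mulrC (g x)).
Qed.

Lemma is_derive1_scale f x a c : is_derive x 1 f a ->
  is_derive x 1 (fun y => c * f y) (c * a).
Proof. by move=> fa; exact: is_deriveZ. Qed.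

Lemma is_derive1_chain f g x a b : is_derive (g x) 1 f a -> is_derive x 1 g b ->
  is_derive x 1 (fun y => f (g y)) (a * b).
Proof. by move=> fa gb; exact: is_derive1_comp. Qed.

Lemma is_derive1_inv f x a : f x != 0 -> is_derive x 1 f a ->
  is_derive x 1 (fun y => (f y)^-1) (- a * (f x)^-1 ^+ 2).
Proof.
move=> fx0 fa; have := is_deriveV fx0 fa.
by rewrite /GRing.scale/= exprVn mulNr mulNr mulrC.
Qed.

Lemma is_derive1_affine x a b : is_derive x 1 (fun y => b + a * y) a.
Proof.
have := is_derive1_add (is_derive_cst b x 1) (is_derive1_scale a (is_derive_id x 1)).
by rewrite add0r mulr1.
Qed.

Lemma is_derive1_ext f g x a : f =1 g -> is_derive x 1 f a -> is_derive x 1 g a.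
Proof. by move=> /funext ->. Qed.

Lemma is_derive1_near f g x a : {near x, f =1 g} -> is_derive x 1 f a ->
  is_derive x 1 g a.
Proof.
move=> fg /is_derive_cvg fa; apply: is_derive_of_cvg.
have fgx := nbhs_singleton fg.
apply: cvg_trans fa; apply: near_eq_cvg.
have fg0 : \forall h \near (0:R), f (h + x) = g (h + x).
  have : (h + x) @[h --> (0:R)] --> x.
    by rewrite -[X in _ --> X]add0r; apply: cvgD; [exact: cvg_id|exact: cvg_cst].
  by move=> /(_ _ fg).
apply: cvg_within; near=> h.
by rewrite fgx; congr (_ * (_ - _)); near: h.
Unshelve. all: end_near. Qed.

Lemma lipschitz_of_derive f (f' : R -> R) (M : R) a b :
  (forall x : R, is_derive x 1 f (f' x)) -> (forall x, `|f' x| <= M) ->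
  `|f b - f a| <= M * `|b - a|.
Proof.
move=> df fM; wlog ab : a b / a < b => [hw|].
  have [|/hw//|->] := ltgtP b a; last by rewrite !subrr normr0 mulr0.
  by move=> /hw; rewrite distrC (distrC b).
have [|c _ ->] := @MVT R f f' a b ab (fun x _ => df x).
  by apply: continuous_subspaceT => x; exact: (is_derive1_continuous (df x)).
by rewrite normrM ler_wpM2r.
Qed.

End derivatives.

Section real_integrals.
Context {R : realType}.
Notation mu := (@lebesgue_measure R).
Implicit Types (f g : R -> R) (a b : R).

Lemma integrable_compact_support f (L : R) : continuous f ->
  (forall x, L < `|x| -> f x = 0) -> mu.-integrable setT (EFin \o f).
Proof.
move=> cf f0; have : mu.-integrable `[- L, L] (EFin \o f).
  apply: continuous_compact_integrable; first exact: segment_compact.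
  exact: continuous_subspaceT.
rewrite integrable_mkcond//; apply: eq_integrable => // x _.
rewrite /patch; case: ifPn => //; rewrite notin_setE/= in_itv/= => /negP.
by rewrite -ler_norml -ltNge => /f0 /= ->.
Qed.

Lemma FTC_segment (F f : R -> R) a b : a < b -> continuous f ->
  (forall x : R, is_derive x (1 : R) F (f x)) ->
  \int[mu]_(x in `[a, b]) f x = F b - F a :> R.
Proof.
move=> ab cf dF; rewrite /Rintegral (@continuous_FTC2 _ f F)//.
- exact: continuous_subspaceT.
- have cF x : F y @[y --> x] --> F x by exact: (is_derive1_continuous (dF x)).
  split; [by move=> x _; case: (dF x)| |].
    by apply: cvg_within_filter; exact: cF.
  by apply: cvg_within_filter; exact: cF.
- by move=> x _; exact: is_derive1_derive1.
Qed.

(** The integrals over growing segments are differences of values of [F] and tend to the full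
    integral, with [|f|] as dominating function. *)
Lemma Rintegral_derive_eq0 (F f : R -> R) : continuous f ->
  (forall x : R, is_derive x (1 : R) F (f x)) -> mu.-integrable setT (EFin \o f) ->
  F n%:R @[n --> \oo] --> (0 : R) -> F (- n%:R) @[n --> \oo] --> (0 : R) ->
  \int[mu]_x f x = 0.
Proof.
move=> cf dF intf F0 F0'.
(* The successor keeps the segment nondegenerate, as [FTC_segment] demands. *)
pose I (n : nat) : set R := `[- n.+1%:R, n.+1%:R]%classic.
pose f_ n := f \_ (I n).
have mI n : measurable (I n) by exact: measurable_itv.
have mf : measurable_fun setT f by exact: measurable_fun_continuous.
have [|||||_] := @Rdominated_cvg _ _ _ mu setT f_ f (fun x => `|f x|).
- exact: measurableT.
- move=> n; apply/(measurable_restrictT f (mI n)).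
  exact: (measurable_funTS mf).
- move=> x _; apply: cvg_near_cst; near=> n.
  rewrite /f_ patchE mem_set// /I/= in_itv/= -ler_norml.
  rewrite (@le_trans _ _ n%:R)// ?ler_nat//.
  by near: n; exact: nbhs_infty_ger.
- exact: integrable_norm.
- by move=> n x _; rewrite /f_ patchE; case: ifPn; rewrite ?normr0.
have -> : (fun n => \int[mu]_x f_ n x) =
    (fun n => F n.+1%:R - F (- n.+1%:R)).
  apply/funext => n; rewrite -Rintegral_mkcond (@FTC_segment F)//.
  by apply: (@lt_trans _ _ 0); rewrite ?oppr_lt0 ltr0n.
move=> h; have : F n.+1%:R - F (- n.+1%:R) @[n --> \oo] --> (0 - 0 : R).
  by apply: cvgB; rewrite (cvg_shiftS (fun n => F _)).
rewrite subr0 => h0; exact: (cvg_unique _ h h0).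
Unshelve. all: end_near. Qed.

Lemma Rintegral_by_parts f f' g g' (L : R) :
  continuous f' -> (forall x : R, is_derive x 1 f (f' x)) ->
  continuous g' -> (forall x : R, is_derive x 1 g (g' x)) ->
  (forall x, L < `|x| -> g x = 0) -> (forall x, L < `|x| -> g' x = 0) ->
  \int[mu]_x (f' x * g x) = - \int[mu]_x (f x * g' x).
Proof.
move=> cf' df cg' dg g0 g0'.
have cf x : {for x, continuous f} by exact: (is_derive1_continuous (df x)).
have cg x : {for x, continuous g} by exact: (is_derive1_continuous (dg x)).
have c1 : continuous (fun x => f' x * g x).
  by move=> x; apply: cvgM; [exact: cf'|exact: cg].
have c2 : continuous (fun x => f x * g' x).
  by move=> x; apply: cvgM; [exact: cf|exact: cg'].
have i1 : mu.-integrable setT (EFin \o (fun x => f' x * g x)).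
  by apply: (@integrable_compact_support _ L) => // x /g0 ->; rewrite mulr0.
have i2 : mu.-integrable setT (EFin \o (fun x => f x * g' x)).
  by apply: (@integrable_compact_support _ L) => // x /g0' ->; rewrite mulr0.
apply/eqP; rewrite -addr_eq0 -RintegralD//; apply/eqP.
apply: (@Rintegral_derive_eq0 (fun x => f x * g x)).
- by move=> x; apply: cvgD; [exact: c1|exact: c2].
- by move=> x; exact: is_derive1_mul.
- have := integrableD measurableT i1 i2; exact.
- apply: cvg_near_cst; near=> n; rewrite g0 ?mulr0//.
  by rewrite ger0_norm//; near: n; exact: nbhs_infty_gtr.
- apply: cvg_near_cst; near=> n; rewrite g0 ?mulr0//.
  by rewrite normrN ger0_norm//; near: n; exact: nbhs_infty_gtr.
Unshelve. all: end_near. Qed.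

End real_integrals.

Section one_sided_derivatives.
Context {R : realType}.
Notation half_line := (@half_line R).

(** Arbitrarily small positive increments keep a nonnegative time nonnegative, so limits along
    [increments] are unique, even at t = 0. *)
Lemma increments_half_line_proper (t : R) : 0 <= t ->
  ProperFilter (increments half_line t).
Proof.
move=> t0; split; last exact: within_filter.
rewrite /increments /within /= => -[e /= e0 /(_ (e / 2))].
apply.
- by rewrite /= sub0r normrN gtr0_norm ?divr_gt0// ltr_pdivrMr// ltr_pMr// ltr1n.
- by rewrite gt_eqF// divr_gt0.
- by rewrite /half_line/= addr_ge0// divr_ge0// ltW.
Qed.

(* At the end point, the mean value theorem turns the limit of the derivative
   into the one-sided derivative. *)
Lemma cvg_increments_half_line (F G : R -> R) (t : R) : 0 <= t ->
  (forall s : R, 0 < s -> is_derive s 1 F (G s)) ->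
  F s @[s --> 0^'+] --> F 0 -> G s @[s --> 0^'+] --> G 0 ->
  h^-1 * (F (h + t) - F t) @[h --> increments half_line t] --> G t.
Proof.
move=> + dF F0 G0; rewrite le_eqVlt => /predU1P[<-|t0]; last first.
  by apply: cvg_within_filter; apply: is_derive_cvg; exact: dF.
apply/cvgrPdist_lt => e e0.
have /cvgrPdist_lt/(_ e e0)[d /= d0 Gd] := G0.
rewrite /increments near_withinE.
exists d => // h /=; rewrite sub0r normrN => hd h0 /=; rewrite addr0 => hge.
have hgt : 0 < h by rewrite lt_neqAle eq_sym h0.
have dF' x : x \in `]0, h[ -> is_derive x 1 F (G x).
  by rewrite in_itv/= => /andP[x0 _]; exact: dF.
have [|c] := @MVT R F G 0 h hgt dF'.
- apply/continuous_within_itvP => //; split => //.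
    move=> x; rewrite in_itv/= => /andP[x0 _].
    exact: (is_derive1_continuous (dF _ x0)).
  apply: cvg_within_filter; exact: (is_derive1_continuous (dF _ hgt)).
rewrite in_itv/= => /andP[c0 ch] ->; rewrite subr0 mulrCA mulVf// mulr1.
apply: Gd => //=; rewrite sub0r normrN gtr0_norm//.
by rewrite (lt_trans ch)// -[h]gtr0_norm.
Qed.

End one_sided_derivatives.

Section differentiation_under_the_integral.
Context {R : realType} d {T : measurableType d} (mu : {measure set T -> \bar R}).

Lemma is_derive_Rintegral (f f' : R -> T -> R) (G : T -> R) (a r : R) : 0 < r ->
  (forall x, `|x - a| < r -> mu.-integrable setT (EFin \o f x)) ->
  (forall (x : R) y, `|x - a| < r -> is_derive x 1 (f ^~ y) (f' x y)) ->
  mu.-integrable setT (EFin \o G) ->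
  (forall x y, `|x - a| < r -> `|f' x y| <= G y) ->
  is_derive a 1 (fun x => \int[mu]_y f x y) (\int[mu]_y f' a y).
Proof.
move=> r0 intf df intG fG.
have Ir x : `]a - r, a + r[%classic x -> `|x - a| < r.
  by rewrite /= in_itv/= => /andP[? ?]; rewrite ltr_norml; apply/andP; split; lra.
have Ia : `]a - r, a + r[%classic a.
  by rewrite /= in_itv/= ltrBlDr ltrDl r0.
have G0 y : 0 <= G y by rewrite (le_trans _ (fG a y _)) ?normr_ge0// subrr normr0.
have d1 x y : `]a - r, a + r[%classic x -> partial1of2 f x y = f' x y.
  by move=> /Ir xr; rewrite partial1of2E; case: (df x y xr).
have h := @cvg_differentiation_under_integral R _ T mu f setT measurableT a
  (a - r) (a + r) Ia (fun x Ix => intf x (Ir x Ix))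
  (fun x y Ix _ => @ex_derive _ _ _ _ _ _ _ (df x y (Ir x Ix)))
  G G0 intG.
apply: is_derive_of_cvg.
rewrite (_ : \int[mu]_y f' a y = \int[mu]_y partial1of2 f a y); last first.
  by apply: eq_Rintegral => y _; rewrite d1.
by apply: h => x y Ix _; rewrite d1//; apply: fG; exact: Ir.
Qed.

End differentiation_under_the_integral.

Section product_integrals.
Context d1 d2 (T1 : measurableType d1) (T2 : measurableType d2) (R : realType).
Variables (m1 : {sigma_finite_measure set T1 -> \bar R})
          (m2 : {sigma_finite_measure set T2 -> \bar R}).

Lemma integrable_prod_mul (g : T1 -> R) (h : T2 -> R) :
  m1.-integrable setT (EFin \o g) -> m2.-integrable setT (EFin \o h) ->
  (m1 \x m2)%E.-integrable setT (EFin \o (fun p => g p.1 * h p.2)).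
Proof.
move=> ig ih.
have mg : measurable_fun setT g by apply/measurable_EFinP; exact: measurable_int ig.
have mh : measurable_fun setT h by apply/measurable_EFinP; exact: measurable_int ih.
have mgh : measurable_fun setT (EFin \o (fun p : T1 * T2 => g p.1 * h p.2)).
  apply/measurable_EFinP; apply: measurable_funM.
    exact: (measurableT_comp mg measurable_fst).
  exact: (measurableT_comp mh measurable_snd).
apply/(integrable12ltyP m1 m2 mgh) => /=.
have e1 x : (\int[m2]_y `|(g x * h y)%:E| = `|(g x)%:E| * \int[m2]_y `|(h y)%:E|)%E.
  under eq_integral do rewrite EFinM abseM.
  rewrite ge0_integralZl//; apply/measurable_EFinP.
  exact: measurable_fun_norm.
under eq_integral do rewrite e1.
have [_ hfin] := integrableP _ _ _ ih; have [_ gfin] := integrableP _ _ _ ig.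
rewrite ge0_integralZr//.
- by rewrite lte_mul_pinfty// ?integral_ge0// ge0_fin_numE// integral_ge0.
- by apply/measurable_EFinP; exact: measurable_fun_norm.
- exact: integral_ge0.
Qed.

Lemma Rintegral_prod1 (F : T1 * T2 -> R) :
  (m1 \x m2)%E.-integrable setT (EFin \o F) ->
  (forall x, m2.-integrable setT (EFin \o (fun y => F (x, y)))) ->
  \int[m1]_x \int[m2]_y F (x, y) = \int[(m1 \x m2)%E]_p F p.
Proof.
move=> iF i1; rewrite [RHS]/Rintegral -(integral12_prod_meas1 iF) /=.
congr fine; apply: eq_integral => x _.
have fx := integrable_fin_num measurableT (i1 x).
by rewrite /Rintegral fineK.
Qed.

Lemma Rintegral_prod2 (F : T1 * T2 -> R) :
  (m1 \x m2)%E.-integrable setT (EFin \o F) ->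
  (forall y, m1.-integrable setT (EFin \o (fun x => F (x, y)))) ->
  \int[m2]_y \int[m1]_x F (x, y) = \int[(m1 \x m2)%E]_p F p.
Proof.
move=> iF i1; rewrite [RHS]/Rintegral -(integral21_prod_meas1 iF) /=.
congr fine; apply: eq_integral => x _.
have fx := integrable_fin_num measurableT (i1 x).
by rewrite /Rintegral fineK.
Qed.

End product_integrals.

(** * Mollification *)

Section flat_functions.
Context {R : realType}.
Implicit Types (p q : {poly R}) (s x : R).

(** The polynomial in 1/s makes the family closed under differentiation: the derivative replaces p
    by X^2 (p - p'). The bump is [flat 1 (1 - x ^+ 2)]. *)
Definition flat p s : R := if 0 < s then p.[s^-1] * expR (- s^-1) else 0.

(** Write x = n w; then w <= e^w gives x^n <= n^n e^x. *)
Lemma exprn_expR_le n x : 0 <= x -> x ^+ n * expR (- x) <= n%:R ^+ n.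
Proof.
move=> x0; case: n => [|n]; first by rewrite !expr0 mul1r -expR0 ler_expR oppr_le0.
rewrite expRN ler_pdivrMr ?expR_gt0//.
have n0 : 0 < n.+1%:R :> R by rewrite ltr0n.
have -> : x = n.+1%:R * (x / n.+1%:R) by field; rewrite gt_eqF.
set w := x / _; rewrite expRM_natl exprMn ler_pM2l ?exprn_gt0//.
have w0 : 0 <= w by rewrite divr_ge0// ltW.
rewrite lerXn2r ?nnegrE ?expR_ge0//.
by have := expR_ge1Dx w; apply: le_trans; rewrite lerDr.
Qed.

(** Vanishing to second order is enough for a zero derivative at 0. The monomial of degree i is
    treated by [exprn_expR_le] with exponent i + 2. *)
Lemma flat_le_sqr p : exists C, forall s, `|flat p s| <= C * s ^+ 2.
Proof.
exists (\sum_(i < size p) `|p`_i| * i.+2%:R ^+ i.+2) => s; rewrite /flat.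
case: ifPn => [s0|_]; last first.
  by rewrite normr0 mulr_ge0 ?sqr_ge0// sumr_ge0// => i _; rewrite mulr_ge0.
rewrite horner_coef !mulr_suml (le_trans (ler_norm_sum _ _ _))//.
apply: ler_sum => i _; rewrite -mulrA normrM -[leRHS]mulrA ler_wpM2l//.
rewrite -ler_pdivrMr ?exprn_gt0//.
have si : 0 <= s^-1 by rewrite invr_ge0 ltW.
rewrite ger0_norm ?mulr_ge0 ?expR_ge0 ?exprn_ge0//.
have := exprn_expR_le i.+2 si; apply: le_trans.
by rewrite -exprVn mulrAC -exprD addn2.
Qed.

Lemma is_derive_flat p s : is_derive s 1 (flat p) (flat ('X^2 * (p - p^`())) s).
Proof.
have [s0|s0|s0] := ltgtP s 0.
- rewrite /flat (lt_gtF s0); apply: (@is_derive1_near _ (cst 0)).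
    near=> z; rewrite /cst; case: ifPn => // z0; exfalso; move: z0; apply/negP.
    by rewrite -leNgt ltW//; near: z; exact: lt_nbhsl.
- apply: (@is_derive1_near _ (fun z => p.[z^-1] * expR (- z^-1))).
    near=> z; rewrite /flat ifT//.
    by near: z; exact: lt_nbhsr.
  have sn0 : s != 0 by rewrite gt_eqF.
  have dV : is_derive s 1 (fun z : R => z^-1) (- 1 * s^-1 ^+ 2).
    exact: (is_derive1_inv sn0 (is_derive_id s 1)).
  rewrite /flat s0 hornerM hornerXn hornerD hornerN.
  by apply: is_derive_eq; rewrite /GRing.scale/=; ring.
- have flat0 q : flat q 0 = 0 by rewrite /flat ltxx.
  rewrite s0 flat0; apply: is_derive_of_cvg.
  have [C hC] := flat_le_sqr p.
  have C1 : 0 < `|C| + 1 by rewrite ltr_wpDl.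
  apply/cvgrPdist_le => e e0; exists (e / (`|C| + 1)); first by rewrite /= divr_gt0.
  move=> h /=; rewrite sub0r normrN ltr_pdivlMr// => he h0.
  rewrite sub0r normrN flat0 subr0 addr0 normrM normfV ler_pdivrMl ?normr_gt0//.
  apply: (le_trans (hC h)); apply: (le_trans (ler_wpM2r (sqr_ge0 h) (ler_norm C))).
  rewrite -(real_normK (num_real h)) expr2 mulrCA ler_wpM2l// mulrC.
  by apply: le_trans (ltW he); rewrite mulrDr mulr1 lerDl.
Unshelve. all: end_near. Qed.

End flat_functions.

Section kernels.
Context {R : realType}.
Notation mu := (@lebesgue_measure R).
Variable e : R.
Hypothesis e0 : 0 < e.

(* A class of smooth functions supported in [[-e, e]] that contains the
   Friedrichs mollifier and is closed under differentiation. *)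
Inductive kernel : (R -> R) -> Prop :=
| kernel_flat (p q : {poly R}) :
    kernel (fun x => q.[x] * flat p (1 - (e^-1 * x) ^+ 2))
| kernel_add f g : kernel f -> kernel g -> kernel (fun x => f x + g x).

Lemma kernel_derive k : kernel k ->
  exists2 k', kernel k' & forall x : R, is_derive x 1 k (k' x).
Proof.
elim=> [p q|f g _ [f' kf' df] _ [g' kg' dg]]; last first.
  exists (fun x => f' x + g' x); first exact: kernel_add.
  by move=> x; exact: is_derive1_add.
exists (fun x => q^`().[x] * flat p (1 - (e^-1 * x) ^+ 2) +
   (q * (((- 2 * e^-1 ^+ 2)%:P) * 'X)).[x] *
   flat ('X^2 * (p - p^`())) (1 - (e^-1 * x) ^+ 2)).
  by apply: kernel_add; exact: kernel_flat.
move=> x; have dx : is_derive x 1 (fun y => 1 - (e^-1 * y) ^+ 2) (- 2 * e^-1 ^+ 2 * x).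
  by apply: is_derive_eq; rewrite /GRing.scale/=; ring.
have := is_derive1_mul (is_derive_poly q x) (is_derive1_chain (is_derive_flat p _) dx).
move=> h; apply: is_derive_eq h _.
by rewrite !hornerM hornerC hornerX; ring.
Qed.

Lemma kernel_support k : kernel k -> forall x, e <= `|x| -> k x = 0.
Proof.
elim=> [p q x ex|f g _ hf _ hg x ex]; last by rewrite hf// hg// addr0.
rewrite /flat ifF ?mulr0//; apply/negbTE; rewrite -leNgt subr_le0 exprMn.
rewrite -(real_normK (num_real x)) -exprMn exprn_ege1//.
by rewrite mulrC ler_pdivlMr// mul1r.
Qed.

Lemma kernel_continuous k : kernel k -> continuous k.
Proof.
by move=> /kernel_derive[k' _ dk] x; exact: (is_derive1_continuous (dk x)).
Qed.

Lemma kernel_bounded k : kernel k -> exists2 B, 0 < B & forall x, `|k x| <= B.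
Proof.
move=> kk; have ck : {within `[- e, e], continuous k}.
  by apply: continuous_subspaceT; exact: kernel_continuous.
have [M [_ /(_ (`|M| + 1))]] := compact_bounded
  (continuous_compact ck (@segment_compact R (- e) e)).
have M1 : M < `|M| + 1 by rewrite (le_lt_trans (ler_norm M))// ltrDl.
move=> /(_ M1) hM; exists (`|M| + 1); first by rewrite ltr_wpDl.
move=> x; have [ex|xe] := leP e `|x|.
  by rewrite (kernel_support kk ex) normr0 addr_ge0.
apply: hM; exists x => //=.
by rewrite in_itv/= -ler_norml ltW.
Qed.

End kernels.

Section friedrichs_mollifier.
Context {R : realType}.
Notation mu := (@lebesgue_measure R).

Lemma bumpE (x : R) : Defs.bump x = flat 1 (1 - x ^+ 2).
Proof.
rewrite /Defs.bump /flat subr_gt0 hornerC mul1r -(real_normK (num_real x)).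
by rewrite expr_lte1.
Qed.

Lemma continuous_bump : continuous (@Defs.bump R).
Proof.
have -> : @Defs.bump R = (fun x => (1 : {poly R}).[x] * flat 1 (1 - (1^-1 * x) ^+ 2)).
  by apply/funext => x; rewrite hornerC mul1r invr1 mul1r bumpE.
by apply: (@kernel_continuous _ 1); exact: kernel_flat.
Qed.

Lemma bump_ge0 (x : R) : 0 <= Defs.bump x.
Proof. by rewrite /Defs.bump; case: ifP; rewrite ?expR_ge0. Qed.

Lemma integrable_bump : mu.-integrable setT (EFin \o (@Defs.bump R)).
Proof.
apply: (@integrable_compact_support _ _ 1); first exact: continuous_bump.
by move=> x x1; rewrite /Defs.bump ltNge (ltW x1).
Qed.

Lemma integral_bump_gt0 : 0 < \int[mu]_z Defs.bump z.
Proof.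
(* The value of the bump at 1/2, which is its minimum over [-1/2, 1/2]. *)
pose c : R := expR (- (1 - 2^-1 ^+ 2)^-1).
pose I : set R := `[- 2^-1, 2^-1]%classic.
have iI := @integrable_indic_segment R (- 2^-1) 2^-1.
have : \int[mu]_x (c * \1_I x) <= \int[mu]_z Defs.bump z.
  apply: le_Rintegral => //; [exact: integrableR_scale|exact: integrable_bump|].
  move=> x _; rewrite indicE; have [|_] := boolP (x \in I); last by rewrite mulr0 bump_ge0.
  rewrite inE /I/= in_itv/= -ler_norml mulr1 => xh.
  have h1 : (2^-1 : R) < 1 by lra.
  rewrite /Defs.bump (le_lt_trans xh h1) ler_expR lerN2.
  have q : x ^+ 2 <= 2^-1 ^+ 2.
    by rewrite -(real_normK (num_real x)) lerXn2r// nnegrE.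
  by rewrite lef_pV2 ?posrE; lra.
apply: lt_le_trans; rewrite RintegralZl// Rintegral_indic_segment; last by lra.
by rewrite mulr_gt0 ?expR_gt0//; lra.
Qed.

Variable e : R.
Implicit Types x y z : R.
Hypothesis e0 : 0 < e.

Lemma kernel_friedrichs : kernel e (friedrichs e).
Proof.
have -> : friedrichs e = (fun x => (e^-1 / \int[mu]_z Defs.bump z)%:P.[x] *
    flat 1 (1 - (e^-1 * x) ^+ 2)).
  apply/funext => x; rewrite /friedrichs bumpE hornerC (mulrC x).
  by ring.
exact: kernel_flat.
Qed.

Lemma friedrichs_ge0 x : 0 <= friedrichs e x.
Proof.
apply: mulr_ge0; first by rewrite invr_ge0 ltW.
by apply: divr_ge0; [exact: bump_ge0|exact: ltW integral_bump_gt0].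
Qed.

Lemma friedrichs_even x : friedrichs e (- x) = friedrichs e x.
Proof. by rewrite /friedrichs mulNr /Defs.bump normrN sqrrN. Qed.

Lemma integrable_friedrichs x :
  mu.-integrable setT (EFin \o (fun y => friedrichs e (x - y))).
Proof.
apply: (@integrable_compact_support _ _ (`|x| + e)).
  move=> y; apply: (@continuous_comp _ _ _ (fun y => x - y) (friedrichs e)).
    by apply: cvgB; [exact: cvg_cst|exact: cvg_id].
  exact: (kernel_continuous kernel_friedrichs).
move=> y xy; rewrite (kernel_support e0 kernel_friedrichs)// distrC.
by have := ler_norm_dist y x; lra.
Qed.

Lemma integral_friedrichs x : \int[mu]_y friedrichs e (x - y) = 1.
Proof.
have h0 : \int[mu]_y friedrichs e y = 1.
  have i0 : mu.-integrable setT (EFin \o (fun y => friedrichs e y)).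
    have := integrable_friedrichs 0; apply: eq_integrable => // y _ /=.
    by rewrite sub0r friedrichs_even.
  rewrite (@Rintegral_affine _ 0 e)//.
  have -> : (fun z => friedrichs e (0 + e * z)) = (fun z =>
      (e^-1 / \int[mu]_z Defs.bump z) * Defs.bump z).
    apply/funext => z; rewrite /friedrichs add0r mulrAC mulfV ?gt_eqF// mul1r.
    by rewrite mulrAC -mulrA.
  rewrite RintegralZl//; last exact: integrable_bump.
  by field; rewrite (gt_eqF integral_bump_gt0) gt_eqF.
rewrite -{}h0 [RHS](@Rintegral_affine _ (- x) 1)//; last first.
  have := integrable_friedrichs 0; apply: eq_integrable => // y _ /=.
  by rewrite sub0r friedrichs_even.
rewrite mul1r; apply: eq_Rintegral => y _.
by rewrite mul1r -friedrichs_even; congr friedrichs; ring.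
Qed.

End friedrichs_mollifier.

Section convolution.
Context {R : realType}.
Notation mu := (@lebesgue_measure R).
Implicit Types (f k psi : R -> R) (x y z L M B C e : R).

(** [mollify f e] unfolds to [conv f (friedrichs e)]. The kernel is arbitrary because each
    derivative of a mollified function replaces its kernel by the derivative of that kernel. *)
Definition conv f k x : R := \int[mu]_y (f y * k (x - y)).

Definition loc_integrable f := measurable_fun setT f /\
  forall L : R, mu.-integrable `[- L, L] (EFin \o f).

Lemma loc_integrable_integrable f : mu.-integrable setT (EFin \o f) -> loc_integrable f.
Proof.
move=> iff; split; first by apply/measurable_EFinP; exact: measurable_int iff.
by move=> L; apply: integrableS iff => //; exact: measurable_itv.
Qed.

Lemma loc_integrable_bounded f M : measurable_fun setT f ->
  (forall x, `|f x| <= M) -> loc_integrable f.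
Proof.
move=> mf fM; split => // L; apply: measurable_bounded_integrable.
- exact: measurable_itv.
- exact: lebesgue_measure_segment_lty.
- exact: measurable_funTS.
- exists M; split; first exact: num_real.
  by move=> z zM x _ /=; rewrite (le_trans (fM x))// ltW.
Qed.

(** A kernel supported in a bounded set sees only such a truncation, which is integrable and
    therefore a dominating function. *)
Definition restr f (L : R) := f \_ `[- L, L].

Lemma restrE f L x : restr f L x = if `|x| <= L then f x else 0.
Proof.
rewrite /restr patchE; have [xL|xL] := boolP (`|x| <= L).
  by rewrite mem_set//= in_itv/= -ler_norml.
by rewrite memNset//= in_itv/= -ler_norml; exact/negP.
Qed.

Lemma integrable_restr f L : loc_integrable f ->
  mu.-integrable setT (EFin \o (restr f L)).
Proof.
move=> [_ /(_ L)]; rewrite integrable_mkcond; last exact: measurable_itv.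
by rewrite restrict_EFin.
Qed.

Lemma integrable_conv f k e B x : loc_integrable f -> measurable_fun setT k ->
  (forall z, `|k z| <= B) -> (forall z, e <= `|z| -> k z = 0) ->
  mu.-integrable setT (EFin \o (fun y => f y * k (x - y))).
Proof.
move=> lf mk kB ke; have [mf _] := lf.
have irf := integrable_restr (`|x| + e) lf.
have : mu.-integrable setT (EFin \o (fun y => restr f (`|x| + e) y * k (x - y))).
  apply: (@integrable_mulr_bounded _ _ _ mu setT _ _ B) => //.
  by apply: (measurableT_comp mk); apply: measurable_funB.
apply: eq_integrable => // y _ /=; rewrite restrE; case: ifPn => //.
rewrite -ltNge mul0r => xy; rewrite ke ?mulr0//.
by rewrite distrC; have := ler_norm_dist y x; lra.
Qed.

Lemma is_derive_conv f k k' e B x : 0 < e -> loc_integrable f ->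
  (forall z : R, is_derive z 1 k (k' z)) -> continuous k' ->
  (forall z, `|k z| <= B) -> (forall z, `|k' z| <= B) ->
  (forall z, e <= `|z| -> k z = 0) -> (forall z, e <= `|z| -> k' z = 0) ->
  is_derive x 1 (conv f k) (conv f k' x).
Proof.
move=> e0 lf dk ck' kB kB' ke ke'.
have mk : measurable_fun setT k.
  by apply: measurable_fun_continuous => z; exact: (is_derive1_continuous (dk z)).
have mk' : measurable_fun setT k' by exact: measurable_fun_continuous.
(* For z within 1 of x, [k' (z - y)] vanishes as soon as |y| exceeds |x| + 1 + e. *)
pose G y := B * `|restr f (`|x| + 1 + e) y|.
apply: (@is_derive_Rintegral R _ _ mu (fun x y => f y * k (x - y))
   (fun x y => f y * k' (x - y)) G x 1) => //.
- by move=> z _; exact: (@integrable_conv _ _ e B).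
- move=> z y _; apply: is_derive1_scale.
  rewrite -[k' _]mulr1.
  apply: (@is_derive1_chain _ k (fun w => w - y) z (k' (z - y)) 1).
  by apply: is_derive_eq; rewrite subr0.
- by apply: integrableR_scale => //; apply: integrableR_norm => //; exact: integrable_restr.
- move=> z y zx; rewrite /G restrE; case: ifPn => [_|].
    by rewrite normrM mulrC ler_wpM2r.
  rewrite -ltNge => xy; rewrite ke' ?mulr0 ?normr0 ?mulr0//.
  by have := ler_norm_dist y z; have := ler_norm_dist z x; rewrite (distrC y z); lra.
Qed.

Lemma conv_bounded_L1 f k B x : mu.-integrable setT (EFin \o f) ->
  measurable_fun setT k -> (forall z, `|k z| <= B) ->
  `|conv f k x| <= B * \int[mu]_y `|f y|.
Proof.
move=> iff mk kB; have inf := integrable_norm iff.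
have mf : measurable_fun setT f by apply/measurable_EFinP; exact: measurable_int iff.
rewrite /conv -RintegralZl//; apply: ler_Rintegral => //.
- apply: measurable_funM => //; apply: (measurableT_comp mk).
  exact: measurable_funB.
- by move=> y _; rewrite normrM mulrC ler_wpM2r.
- exact: integrableR_scale.
Qed.

(** The mollifier is nonnegative with integral 1, so the bound is preserved with no constant lost;
    hence it is uniform in [e]. *)
Lemma conv_friedrichs_bounded f e M x : 0 < e -> measurable_fun setT f ->
  (forall z, `|f z| <= M) -> `|conv f (friedrichs e) x| <= M.
Proof.
move=> e0 mf fM; rewrite -[M]mulr1 -(integral_friedrichs e0 x).
rewrite -RintegralZl//; last exact: integrable_friedrichs.
apply: ler_Rintegral => //.
- apply: measurable_funM => //.
  by apply/measurable_EFinP; exact: measurable_int (integrable_friedrichs e0 x).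
- move=> y _; rewrite normrM (ger0_norm (friedrichs_ge0 _ _))// ler_wpM2r//.
  exact: friedrichs_ge0.
- by apply: integrableR_scale => //; exact: integrable_friedrichs.
Qed.

Lemma conv_bounded_Loo f k e B M x : 0 < e -> measurable_fun setT f ->
  (forall z, `|f z| <= M) -> measurable_fun setT k ->
  (forall z, `|k z| <= B) -> (forall z, e <= `|z| -> k z = 0) ->
  `|conv f k x| <= M * B * (2 * e).
Proof.
move=> e0 mf fM mk kB ke.
have M0 : 0 <= M by rewrite (le_trans _ (fM 0)).
have B0 : 0 <= B by rewrite (le_trans _ (kB 0)).
pose I : set R := `[x - e, x + e]%classic.
have iI : mu.-integrable setT (EFin \o \1_I) by exact: integrable_indic_segment.
have -> : 2 * e = \int[mu]_y \1_I y by rewrite Rintegral_indic_segment; [ring|lra].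
rewrite -RintegralZl//; apply: ler_Rintegral => //.
- apply: measurable_funM => //; apply: (measurableT_comp mk).
  exact: measurable_funB.
- move=> y _; rewrite indicE; have [_|] := boolP (y \in I).
    by rewrite mulr1 normrM ler_pM.
  rewrite notin_setE /I/= in_itv/= => /negP yI; rewrite ke ?mulr0 ?normr0//.
  by rewrite leNgt ltr_norml; apply/negP => /andP[? ?]; apply: (negP yI); apply/andP; split; lra.
- exact: integrableR_scale.
Qed.

(** By Fubini's theorem, convolution with an even kernel is self-adjoint. This moves the mollifier
    from the rough data to step functions and test functions. *)
Lemma conv_duality f k psi e B L C : loc_integrable f ->
  continuous k -> (forall z, `|k z| <= B) -> (forall z, e <= `|z| -> k z = 0) ->
  (forall z, k (- z) = k z) ->
  measurable_fun setT psi -> (forall z, `|psi z| <= C) ->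
  (forall z, L < `|z| -> psi z = 0) ->
  \int[mu]_x (conv f k x * psi x) = \int[mu]_y (f y * conv psi k y).
Proof.
move=> lf ck kB ke keven mpsi psiC psiL.
have [mf _] := lf.
have mk : measurable_fun setT k by exact: measurable_fun_continuous.
pose F (p : R * R) := f p.2 * k (p.1 - p.2) * psi p.1.
have lpsi := loc_integrable_bounded mpsi psiC.
have i2 x : mu.-integrable setT (EFin \o (fun y => F (x, y))).
  have h := integrable_conv x lf mk kB ke.
  have := integrableZr measurableT (psi x) h; exact.
have i1 y : mu.-integrable setT (EFin \o (fun x => F (x, y))).
  have h := integrable_conv y lpsi mk kB ke.
  have := integrableZl measurableT (f y) h; apply: eq_integrable => // x _ /=.
  by rewrite -EFinM /F /= -keven opprB; congr EFin; ring.
have iF : (mu \x mu)%E.-integrable setT (EFin \o F).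
  (* Where the integrand does not vanish, |x| <= L and |x - y| < e, hence |y| <= L + e. *)
  pose G (p : R * R) := (C * \1_(`[- L, L]%classic) p.1) * (B * `|restr f (L + e) p.2|).
  apply: (@le_integrableR _ _ _ (mu \x mu)%E _ _ G) => //.
  - apply: measurable_funM; last exact: (measurableT_comp mpsi measurable_fst).
    apply: measurable_funM; first exact: (measurableT_comp mf measurable_snd).
    apply: (measurableT_comp mk).
    by apply: measurable_funB; [exact: measurable_fst|exact: measurable_snd].
  - move=> [x y] _; rewrite /F /G /= indicE restrE.
    have C0 : 0 <= C by rewrite (le_trans _ (psiC 0)).
    have B0 : 0 <= B by rewrite (le_trans _ (kB 0)).
    have [xL|Lx] := leP `|x| L; last first.
      by rewrite psiL// mulr0 normr0 !mulr_ge0.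
    rewrite mem_set/=; last by rewrite in_itv/= -ler_norml.
    case: ifPn => [_|].
      rewrite !normrM mulr1 mulrC ler_pM// ?mulr_ge0//.
      by rewrite mulrC ler_wpM2r.
    rewrite -ltNge => yL; rewrite ke ?mulr0 ?mul0r ?normr0 ?mulr0//.
    by have := ler_norm_dist y x; rewrite (distrC y x); lra.
  - apply: (@integrable_prod_mul _ _ _ _ _ mu mu (fun x => C * \1_(`[- L, L]%classic) x)
      (fun y => B * `|restr f (L + e) y|)).
      by apply: integrableR_scale => //; exact: integrable_indic_segment.
    apply: integrableR_scale => //; apply: integrableR_norm => //.
    exact: integrable_restr.
have := Rintegral_prod1 iF i2; have := Rintegral_prod2 iF i1; rewrite /F /= => <- h.
transitivity (\int[mu]_x \int[mu]_y (f y * k (x - y) * psi x)).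
  apply: eq_Rintegral => x _; rewrite RintegralZr//.
  exact: (integrable_conv x lf mk kB ke).
rewrite h; apply: eq_Rintegral => y _.
have iy : mu.-integrable setT (EFin \o (fun x => psi x * k (y - x))).
  exact: (integrable_conv y lpsi mk kB ke).
rewrite -RintegralZl//; apply: eq_Rintegral => x _.
by rewrite -keven opprB; ring.
Qed.

End convolution.

(** * Oriented integrals of mollified data *)

Section oriented_integrals.
Context {R : realType}.
Notation mu := (@lebesgue_measure R).
Implicit Types (f : R -> R) (x y z s c e M : R).

Definition step c s : R := (c < s)%R%:R.

Lemma step_bounds c s : 0 <= step c s <= 1.
Proof. by rewrite /step; case: (c < s); rewrite /= ?lexx ?ler01. Qed.

Lemma measurable_step c : measurable_fun setT (step c).
Proof.
have -> : step c = \1_(`]c, +oo[%classic).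
  apply/funext => s; rewrite indicE /step; congr (_%:R).
  by rewrite mem_setE in_itv/= andbT.
by apply: measurable_indic; exact: measurable_itv.
Qed.

Lemma step_le y z s : z <= y -> step y s <= step z s.
Proof.
move=> zy; rewrite /step; case: (ltP y s) => [ys|_]; first by rewrite (le_lt_trans zy ys).
by rewrite ler0n.
Qed.

(* Up to null sets, [step 0 - step y] is the signed indicator function of the
   interval between [0] and [y]. *)
Lemma integrable_step f y z : loc_integrable f ->
  mu.-integrable setT (EFin \o (fun s => f s * (step z s - step y s))).
Proof.
move=> lf; have irf := integrable_restr (`|y| + `|z|) lf.
have mst : measurable_fun setT (fun s => step z s - step y s).
  by apply: measurable_funB; exact: measurable_step.
have : mu.-integrable setT
    (EFin \o (fun s => restr f (`|y| + `|z|) s * (step z s - step y s))).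
  apply: (@integrable_mulr_bounded _ _ _ mu setT _ _ 1) => // s _.
  have := step_bounds y s; have := step_bounds z s.
  by move=> /andP[? ?] /andP[? ?]; rewrite ler_norml; apply/andP; split; lra.
apply: eq_integrable => // s _ /=; rewrite restrE; case: ifPn => // sL.
rewrite mul0r -ltNge in sL *; congr EFin; rewrite /step.
have hy := ler_norm y; have hz := ler_norm z.
have hy' := ler_norm (- y); have hz' := ler_norm (- z); rewrite !normrN in hy' hz'.
have hy0 := normr_ge0 y; have hz0 := normr_ge0 z.
have [s0|s0] := leP 0 s; [rewrite (ger0_norm s0) in sL|rewrite (ltr0_norm s0) in sL].
  have -> : z < s by lra.
  have -> : y < s by lra.
  by rewrite subrr mulr0.
have -> : z < s = false by apply/negbTE; rewrite -leNgt; lra.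
have -> : y < s = false by apply/negbTE; rewrite -leNgt; lra.
by rewrite subrr mulr0.
Qed.

Lemma Rintegral_step f y z : loc_integrable f -> z <= y ->
  \int[mu]_(s in `[z, y]) f s = \int[mu]_s (f s * (step z s - step y s)).
Proof.
move=> lf zy; have [mf _] := lf.
rewrite -Rintegral_itv_obnd_cbnd; last first.
  have := integrable_step y z lf => h.
  have : mu.-integrable `]z, y]%classic (EFin \o (fun s => f s * (step z s - step y s))).
    by apply: integrableS h => //; exact: measurable_itv.
  apply: eq_integrable; first exact: measurable_itv.
  move=> s; rewrite inE/= in_itv/= => /andP[zs sy] /=.
  by rewrite /step zs ltNge sy subr0 mulr1.
rewrite Rintegral_mkcond; apply: eq_Rintegral => s _.
rewrite patchE /step; case: ifPn; rewrite ?inE ?notin_setE/= in_itv/=.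
  by move=> /andP[zs sy]; rewrite zs ltNge sy subr0 mulr1.
move=> /negP; rewrite negb_and -ltNge -leNgt => /orP[sz|ys].
  by rewrite !ltNge sz (le_trans sz zy) subrr mulr0.
by rewrite ys (le_lt_trans zy ys) subrr mulr0.
Qed.

Lemma oriented_integralE f y : loc_integrable f ->
  oriented_integral f y = \int[mu]_s (f s * (step 0 s - step y s)).
Proof.
move=> lf; rewrite /oriented_integral; case: ifPn => y0; first exact: Rintegral_step.
rewrite Rintegral_step//; last by rewrite ltW// ltNge.
rewrite -mulN1r -RintegralZl//; last exact: integrable_step.
by apply: eq_Rintegral => s _; ring.
Qed.

Lemma oriented_integral0 f : oriented_integral f 0 = 0.
Proof. by rewrite /oriented_integral lexx set_itv1 Rintegral_set1. Qed.

Lemma oriented_integralB f y z : loc_integrable f ->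
  oriented_integral f y - oriented_integral f z =
  \int[mu]_s (f s * (step z s - step y s)).
Proof.
move=> lf; rewrite !oriented_integralE// -RintegralB//; [|exact: integrable_step..].
by apply: eq_Rintegral => s _; ring.
Qed.

Lemma oriented_integral_dist f y z : loc_integrable f -> z <= y ->
  `|oriented_integral f y - oriented_integral f z| <=
  oriented_integral (fun s => `|f s|) y - oriented_integral (fun s => `|f s|) z.
Proof.
move=> lf zy; have [mf lf'] := lf.
have lnf : loc_integrable (fun s => `|f s|).
  split; first exact: measurable_fun_norm.
  by move=> L; apply: integrableR_norm => //; exact: measurable_itv.
rewrite !oriented_integralB//; apply: ler_Rintegral => //; last exact: integrable_step.
- apply: measurable_funM => //; apply: measurable_funB; exact: measurable_step.
- move=> s _; rewrite normrM [X in _ * X]ger0_norm// subr_ge0; exact: step_le.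
Qed.

Lemma loc_integrable_norm f : loc_integrable f -> loc_integrable (fun s => `|f s|).
Proof.
move=> [mf lf]; split; first exact: measurable_fun_norm.
by move=> L; apply: integrableR_norm => //; exact: measurable_itv.
Qed.

Lemma oriented_integral_lip f M y z : measurable_fun setT f ->
  (forall s, `|f s| <= M) ->
  `|oriented_integral f y - oriented_integral f z| <= M * `|y - z|.
Proof.
move=> mf fM; wlog zy : y z / z <= y => [hw|].
  by have [/hw//|/ltW/hw] := leP z y; rewrite distrC (distrC z).
have lf := loc_integrable_bounded mf fM.
have M0 : 0 <= M by rewrite (le_trans _ (fM 0)).
rewrite oriented_integralB// [`|y - z|]ger0_norm ?subr_ge0//.
have iI := @integrable_indic_segment R z y.
rewrite -(Rintegral_indic_segment zy) -RintegralZl//; apply: ler_Rintegral => //.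
- apply: measurable_funM => //; apply: measurable_funB; exact: measurable_step.
- move=> s _; rewrite normrM ler_pM// indicE /step ger0_norm ?subr_ge0 ?step_le//.
  have [zs|sz] := ltP z s; last by rewrite sub0r (le_trans _ (ler0n _ _))// oppr_le0.
  have [ys|sy] := ltP y s; first by rewrite subrr.
  by rewrite mem_set ?subr0//= in_itv/= (ltW zs).
- exact: integrableR_scale.
Qed.

Lemma oriented_integral_L1 f y : mu.-integrable setT (EFin \o f) ->
  `|oriented_integral f y| <= \int[mu]_s `|f s|.
Proof.
move=> iff; have lf := loc_integrable_integrable iff; have [mf _] := lf.
rewrite oriented_integralE//; apply: ler_Rintegral => //; last exact: integrableR_norm.
- apply: measurable_funM => //; apply: measurable_funB; exact: measurable_step.
- move=> s _; rewrite normrM ler_piMr//.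
  have /andP[? ?] := step_bounds y s; have /andP[? ?] := step_bounds 0 s.
  by rewrite ler_norml; apply/andP; split; lra.
Qed.

Lemma continuous_oriented_integral f : loc_integrable f -> continuous (oriented_integral f).
Proof.
move=> lf; have [mf _] := lf.
apply: continuous_seqP => y u uy.
have -> : oriented_integral f = (fun z => \int[mu]_s (f s * (step 0 s - step z s))).
  by apply/funext => z; rewrite oriented_integralE.
have [K K0 uK] : exists2 K, 0 <= K & forall n, `|u n| <= K.
  have [K [_ hK]] := cvg_seq_bounded (cvgP _ uy).
  exists (`|K| + 1); first by rewrite addr_ge0.
  by move=> n; apply: (hK (`|K| + 1)) => //; rewrite (le_lt_trans (ler_norm K))// ltrDl.
have mst z : measurable_fun setT (fun s => f s * (step 0 s - step z s)).
  by apply: measurable_funM => //; apply: measurable_funB; exact: measurable_step.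
have [||||||_] := @Rdominated_cvg_ae _ _ _ mu setT
  (fun n s => f s * (step 0 s - step (u n) s))
  (fun s => f s * (step 0 s - step y s)) (fun s => `|restr f K s|).
- exact: measurableT.
- by move=> n; exact: mst.
- exact: mst.
(* Pointwise convergence may fail only at [s = y], where the limiting step jumps. *)
- have h : mu.-negligible [set y].
    exists [set y]; split => //; exact: lebesgue_measure_set1.
  apply: negligibleS h => s /= hs; apply: contrapT => sy; apply: hs => _.
  apply: cvg_near_cst; have [ys|{}sy|ys] := ltgtP y s; last by exfalso; apply: sy.
  - near=> n; rewrite /step ys; have -> // : u n < s.
    by near: n; exact: (cvgr_lt y).
  - near=> n; rewrite /step (lt_gtF sy); have -> // : u n < s = false.
    by apply/negbTE; rewrite -leNgt ltW//; near: n; exact: (cvgr_gt y).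
- by apply: integrableR_norm => //; exact: integrable_restr.
- move=> n s _; rewrite restrE; case: ifPn => [_|].
    rewrite normrM ler_piMr//.
    have /andP[? ?] := step_bounds (u n) s; have /andP[? ?] := step_bounds 0 s.
    by rewrite ler_norml; apply/andP; split; lra.
  rewrite -ltNge => Ks; have := uK n; rewrite ler_norml => /andP[? ?].
  rewrite /step; have [s0|s0] := leP 0 s; [rewrite (ger0_norm s0) in Ks|rewrite (ltr0_norm s0) in Ks].
    have -> : 0 < s by lra.
    have -> : u n < s by lra.
    by rewrite subrr mulr0 normr0.
  have -> : u n < s = false by apply/negbTE; rewrite -leNgt; lra.
  by rewrite lt_gtF// subrr mulr0 normr0.
by [].
Unshelve. all: end_near. Qed.

(** Near [y] the oriented integral differs by a constant from the integral based at [y - 1], to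
    which the fundamental theorem applies whatever the sign of [y]. *)
Lemma is_derive_oriented_integral f y : continuous f ->
  is_derive y 1 (oriented_integral f) (f y).
Proof.
move=> cf; have mf := measurable_fun_continuous cf.
have lf : loc_integrable f.
  split => // L; apply: continuous_compact_integrable; first exact: segment_compact.
  exact: continuous_subspaceT.
have iab a b : mu.-integrable `[a, b]%classic (EFin \o f).
  apply: continuous_compact_integrable; first exact: segment_compact.
  exact: continuous_subspaceT.
pose P x := \int[mu]_(s in `[y - 1, x]) f s.
have [||||dP Pf] := @continuous_FTC1_closed R f (y - 1) y (y + 1).
- by rewrite ltrDl.
- exact: iab.
- by rewrite ltrBlDr ltrDl.
- exact: cf.
apply: (@is_derive1_near _ (fun x => oriented_integral f (y - 1) + P x)).
  near=> x; have yx : y - 1 <= x.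
    by apply: ltW; near: x; apply: lt_nbhsr; rewrite ltrBlDr ltrDl.
  by rewrite /P Rintegral_step// -oriented_integralB// addrC subrK.
rewrite -[f y]add0r; apply: is_derive1_add.
by apply: DeriveDef => //; rewrite -derive1E Pf.
Unshelve. all: end_near. Qed.

End oriented_integrals.

Section mollified_data.
Context {R : realType}.
Notation mu := (@lebesgue_measure R).
Variables (f : R -> R) (lf : loc_integrable f).
Implicit Types (x y z s c e M : R).

Let Q := oriented_integral (fun s => `|f s|).

(** The convolution at [s] is an average over points within [e] of [s], so its error is at most the
    oscillation there. *)
Lemma conv_friedrichs_dist e (psi : R -> R) (C D : R) s : 0 < e -> measurable_fun setT psi ->
  (forall x, `|psi x| <= C) -> (forall x, `|s - x| < e -> `|psi x - psi s| <= D) ->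
  `|conv psi (friedrichs e) s - psi s| <= D.
Proof.
move=> e0 mpsi psiC psiD.
have ief := integrable_friedrichs e0 s; have mef := integrableR_measurable ief.
have ipsi : mu.-integrable setT (EFin \o (fun x => psi x * friedrichs e (s - x))).
  have [B B0 eB] := kernel_bounded e0 (kernel_friedrichs e).
  apply: (@integrable_conv _ _ _ e B) => //.
  - exact: loc_integrable_bounded psiC.
  - exact: measurable_fun_continuous (kernel_continuous (kernel_friedrichs e)).
  - exact: kernel_support (kernel_friedrichs e).
have -> : psi s = \int[mu]_x (psi s * friedrichs e (s - x)).
  by rewrite RintegralZl// integral_friedrichs// mulr1.
have -> : D = \int[mu]_x (D * friedrichs e (s - x)).
  by rewrite RintegralZl// integral_friedrichs// mulr1.
rewrite /conv -RintegralB//; last exact: integrableR_scale.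
apply: ler_Rintegral => //; last exact: integrableR_scale.
- by apply: measurable_funB; apply: measurable_funM.
- move=> x _; rewrite -mulrBl normrM (ger0_norm (friedrichs_ge0 e0 _)).
  have [se|es] := ltP `|s - x| e; first by rewrite ler_wpM2r ?friedrichs_ge0// psiD.
  by rewrite (kernel_support e0 (kernel_friedrichs e))// !mulr0.
Qed.

(** By duality the mollifier acts on the signed indicator function of the segment between 0 and y,
    which is bounded, and [f] remains untouched. *)
Lemma oriented_integral_mollify e y : 0 < e ->
  oriented_integral (mollify f e) y =
  \int[mu]_s (f s * conv (fun x => step 0 x - step y x) (friedrichs e) s).
Proof.
move=> e0; have kf := kernel_friedrichs e.
have [B B0 eB] := kernel_bounded e0 kf.
have [k' kk' dk'] := kernel_derive kf.
have [B' B'0 eB'] := kernel_bounded e0 kk'.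
have cm : continuous (mollify f e).
  move=> x; apply: is_derive1_continuous.
  apply: (@is_derive_conv R f _ k' e (Num.max B B') x e0 lf dk').
  - exact: kernel_continuous kk'.
  - by move=> z; rewrite le_max eB.
  - by move=> z; rewrite le_max eB' orbT.
  - exact: kernel_support e0 _ kf.
  - exact: kernel_support e0 _ kk'.
have lm : loc_integrable (mollify f e).
  split; first exact: measurable_fun_continuous.
  move=> L; apply: continuous_compact_integrable; first exact: segment_compact.
  exact: continuous_subspaceT.
rewrite oriented_integralE//.
apply: (@conv_duality _ _ _ _ e B `|y| 1) => //.
- exact: kernel_continuous kf.
- exact: kernel_support e0 _ kf.
- exact: friedrichs_even.
- by apply: measurable_funB; exact: measurable_step.
- move=> s; have /andP[? ?] := step_bounds y s; have /andP[? ?] := step_bounds 0 s.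
  by rewrite ler_norml; apply/andP; split; lra.
- move=> s ys; have := ler_norm y; have := ler_norm (- y); rewrite normrN => ? ?.
  rewrite /step; have [s0|s0] := leP 0 s; [rewrite (ger0_norm s0) in ys|rewrite (ltr0_norm s0) in ys].
    have y0 := normr_ge0 y; have -> : 0 < s by lra.
    have -> : y < s by lra.
    by rewrite subrr.
  have -> : y < s = false by apply/negbTE; rewrite -leNgt; lra.
  by rewrite lt_gtF// subrr.
Qed.

(** Moving the argument by less than [e] matters only within [e] of the jump; the right-hand side is
    the indicator function of that window. *)
Lemma step_dist e c x s : `|s - x| < e ->
  `|step c x - step c s| <= step (c - e) s - step (c + e) s.
Proof.
rewrite ltr_norml => /andP[h1 h2]; rewrite /step.
have [cx|xc] := ltP c x; have [cs|sc] := ltP c s.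
- by rewrite subrr normr0 subr_ge0; apply: step_le; lra.
- have -> : c - e < s by lra.
  have -> : c + e < s = false by apply/negbTE; rewrite -leNgt; lra.
  by rewrite !subr0 normr1.
- have -> : c - e < s by lra.
  have -> : c + e < s = false by apply/negbTE; rewrite -leNgt; lra.
  by rewrite sub0r subr0 normrN normr1.
- by rewrite subrr normr0 subr_ge0; apply: step_le; lra.
Qed.

(** Mollification alters the signed indicator function only within [e] of the ends 0 and y, so the
    error is at most the mass of |f| in two windows of width 2 e. This is O(e) for bounded [f], and
    tends to 0 for integrable [f]. *)
Lemma oriented_integral_mollify_dist e y : 0 < e ->
  `|oriented_integral (mollify f e) y - oriented_integral f y| <=
  Q e - Q (- e) + (Q (y + e) - Q (y - e)).
Proof.
move=> e0; have lnf := loc_integrable_norm lf; have [mf _] := lf.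
pose chi x := step 0 x - step y x.
have mchi : measurable_fun setT chi by apply: measurable_funB; exact: measurable_step.
have chi1 x : `|chi x| <= 1.
  have /andP[? ?] := step_bounds y x; have /andP[? ?] := step_bounds 0 x.
  by rewrite ler_norml; apply/andP; split; rewrite /chi; lra.
have kf := kernel_friedrichs e.
have [B B0 eB] := kernel_bounded e0 kf.
have cchi : continuous (conv chi (friedrichs e)).
  have [k' kk' dk'] := kernel_derive kf.
  have [B' B'0 eB'] := kernel_bounded e0 kk'.
  move=> x; apply: is_derive1_continuous.
  apply: (@is_derive_conv R chi _ k' e (Num.max B B') x e0 _ dk').
  - exact: loc_integrable_bounded chi1.
  - exact: kernel_continuous kk'.
  - by move=> z; rewrite le_max eB.
  - by move=> z; rewrite le_max eB' orbT.
  - exact: kernel_support e0 _ kf.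
  - exact: kernel_support e0 _ kk'.
have dchi s : `|conv chi (friedrichs e) s - chi s| <=
    (step (- e) s - step e s) + (step (y - e) s - step (y + e) s).
  apply: (@conv_friedrichs_dist _ _ 1) => // x sx.
  have h0 := step_dist 0 sx; have hy := step_dist y sx.
  rewrite sub0r add0r in h0; rewrite /chi.
  have -> : step 0 x - step y x - (step 0 s - step y s) =
     (step 0 x - step 0 s) - (step y x - step y s) by ring.
  by rewrite (le_trans (ler_normB _ _))// lerD.
have i1 := integrable_step e (- e) lnf; have i2 := integrable_step (y + e) (y - e) lnf.
rewrite oriented_integral_mollify// oriented_integralE// !oriented_integralB//.
have ichi := integrable_step y 0 lf.
pose g s := `|f s| * (step (- e) s - step e s) + `|f s| * (step (y - e) s - step (y + e) s).
have ig : mu.-integrable setT (EFin \o g) by exact: integrableR_add.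
have mconv : measurable_fun setT (conv chi (friedrichs e)) by exact: measurable_fun_continuous.
have id : mu.-integrable setT (EFin \o (fun s => f s * (conv chi (friedrichs e) s - chi s))).
  apply: (@le_integrableR _ _ _ mu _ _ g) => //.
  - by apply: measurable_funM => //; apply: measurable_funB.
  - by move=> s _; rewrite normrM /g -mulrDr ler_wpM2l.
have iconv : mu.-integrable setT (EFin \o (fun s => f s * conv chi (friedrichs e) s)).
  have := integrableR_add measurableT id ichi; apply: eq_integrable => // s _ /=.
  by congr EFin; rewrite /chi; ring.
rewrite -RintegralD// -RintegralB//; apply: ler_Rintegral => //.
- by apply: measurable_funB; apply: measurable_funM.
- by move=> s _; rewrite -mulrBr normrM -mulrDr ler_wpM2l.
Qed.

Lemma oriented_integral_mollify_L1 e y : 0 < e -> mu.-integrable setT (EFin \o f) ->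
  `|oriented_integral (mollify f e) y| <= \int[mu]_s `|f s|.
Proof.
move=> e0 iff; have [mf _] := lf; rewrite oriented_integral_mollify//.
pose chi x := step 0 x - step y x.
have mchi : measurable_fun setT chi by apply: measurable_funB; exact: measurable_step.
have chi1 x : `|chi x| <= 1.
  have /andP[? ?] := step_bounds y x; have /andP[? ?] := step_bounds 0 x.
  by rewrite ler_norml; apply/andP; split; rewrite /chi; lra.
have [B B0 eB] := kernel_bounded e0 (kernel_friedrichs e).
have [k' kk' dk'] := kernel_derive (kernel_friedrichs e).
have [B' B'0 eB'] := kernel_bounded e0 kk'.
have cchi : continuous (conv chi (friedrichs e)).
  move=> x; apply: is_derive1_continuous.
  apply: (@is_derive_conv R chi _ k' e (Num.max B B') x e0 _ dk').
  - exact: loc_integrable_bounded chi1.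
  - exact: kernel_continuous kk'.
  - by move=> z; rewrite le_max eB.
  - by move=> z; rewrite le_max eB' orbT.
  - exact: kernel_support e0 _ (kernel_friedrichs e).
  - exact: kernel_support e0 _ kk'.
apply: ler_Rintegral => //; last exact: integrableR_norm.
- by apply: measurable_funM => //; exact: measurable_fun_continuous.
- move=> s _; rewrite normrM ler_piMr//.
  exact: (conv_friedrichs_bounded s e0 mchi chi1).
Qed.

(** After duality the mollifier acts on the Lipschitz function [phi], where its error is at most K e
    everywhere. *)
Lemma cvg_mollify (phi : R -> R) (K L : R) : 0 <= K -> continuous phi ->
  (forall x y, `|phi x - phi y| <= K * `|x - y|) ->
  (forall x, L < `|x| -> phi x = 0) ->
  \int[mu]_x (mollify f e x * phi x) @[e --> 0^'+] --> \int[mu]_x (f x * phi x).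
Proof.
move=> K0 cphi lip phiL; have [mf _] := lf.
have mphi := measurable_fun_continuous cphi.
have [C phiC] : exists C : R, forall x, `|phi x| <= C.
  exists (`|phi 0| + K * `|L|) => x; have [xL|Lx] := leP `|x| L; last first.
    by rewrite phiL// normr0 addr_ge0// mulr_ge0.
  have := ler_norm_dist (phi x) (phi 0).
  have := lip x 0; rewrite subr0 => h1 h2.
  have h3 : K * `|x| <= K * `|L| by rewrite ler_wpM2l// (le_trans xL)// ler_norm.
  by lra.
(* For e <= 1 both [phi] and its mollification vanish outside [-(L + 1), L + 1]. *)
pose A := \int[mu]_s `|restr f (L + 1) s|.
have A0 : 0 <= A by apply: Rintegral_ge0.
have irf := integrable_restr (L + 1) lf.
have iphi : mu.-integrable setT (EFin \o (fun s => f s * phi s)).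
  have : mu.-integrable setT (EFin \o (fun s => restr f (L + 1) s * phi s)).
    by apply: (@integrable_mulr_bounded _ _ _ mu setT _ _ C).
  apply: eq_integrable => // s _ /=; rewrite restrE; case: ifPn => // sL.
  by rewrite phiL ?mulr0// ltNge; apply: contra sL => sL; lra.
apply/cvgrPdist_le => d d0.
have KA : 0 < K * A + 1 by rewrite ltr_wpDl// mulr_ge0.
have r0 : 0 < d / (K * A + 1) by rewrite divr_gt0.
have hr : \forall e \near (0 : R)^'+, e <= d / (K * A + 1) := nbhs_right_le r0.
near=> e.
have e0 : 0 < e by near: e; exact: nbhs_right_gt.
have e1 : e <= 1 by near: e; exact: nbhs_right_le.
have eA : e * (K * A) <= d.
  have : e <= d / (K * A + 1) by near: e; exact: hr.
  rewrite ler_pdivlMr// => h; apply: le_trans h.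
  by rewrite mulrDr mulr1 lerDl ltW.
have kf := kernel_friedrichs e.
have [B B0 eB] := kernel_bounded e0 kf.
have -> : \int[mu]_x (mollify f e x * phi x) = \int[mu]_s (f s * conv phi (friedrichs e) s).
  apply: (@conv_duality _ _ _ _ e B L C) => //.
  - exact: kernel_continuous kf.
  - exact: kernel_support e0 _ kf.
  - exact: friedrichs_even.
have cconv : continuous (conv phi (friedrichs e)).
  have [k' kk' dk'] := kernel_derive kf.
  have [B' B'0 eB'] := kernel_bounded e0 kk'.
  move=> x; apply: is_derive1_continuous.
  apply: (@is_derive_conv R phi _ k' e (Num.max B B') x e0 _ dk').
  - exact: loc_integrable_bounded phiC.
  - exact: kernel_continuous kk'.
  - by move=> z; rewrite le_max eB.
  - by move=> z; rewrite le_max eB' orbT.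
  - exact: kernel_support e0 _ kf.
  - exact: kernel_support e0 _ kk'.
have mconv := measurable_fun_continuous cconv.
have dconv s : `|f s * (conv phi (friedrichs e) s - phi s)| <= K * e * `|restr f (L + 1) s|.
  rewrite normrM restrE; case: ifPn => [_|].
    rewrite mulrC ler_wpM2r//; apply: (@conv_friedrichs_dist _ _ C) => // x sx.
    by rewrite (le_trans (lip _ _))// ler_wpM2l// distrC ltW.
  rewrite -ltNge => Ls; rewrite normr0 mulr0.
  have : `|conv phi (friedrichs e) s - phi s| <= 0.
    apply: (@conv_friedrichs_dist _ _ C) => // x sx.
    rewrite (phiL s) ?phiL ?subrr ?normr0//; last by lra.
    by have := ler_norm_dist s x; lra.
  by rewrite normr_le0 => /eqP ->; rewrite normr0 mulr0.
have id : mu.-integrable setT (EFin \o (fun s => f s * (conv phi (friedrichs e) s - phi s))).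
  apply: (@le_integrableR _ _ _ mu _ _ (fun s => K * e * `|restr f (L + 1) s|)) => //.
  - by apply: measurable_funM => //; apply: measurable_funB.
  - by apply: integrableR_scale => //; exact: integrableR_norm.
have iconv : mu.-integrable setT (EFin \o (fun s => f s * conv phi (friedrichs e) s)).
  have := integrableR_add measurableT id iphi; apply: eq_integrable => // s _ /=.
  by congr EFin; ring.
rewrite distrC -RintegralB//.
apply: le_trans eA; rewrite mulrA (mulrC e) /A -RintegralZl//; last exact: integrableR_norm.
apply: ler_Rintegral => //.
- by apply: measurable_funB; apply: measurable_funM.
- by move=> s _; rewrite -mulrBr.
- by apply: integrableR_scale => //; exact: integrableR_norm.
Unshelve. all: end_near. Qed.

End mollified_data.

Section positive_integrals.
Context {R : realType}.
Notation mu := (@lebesgue_measure R).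

Lemma Rintegral_gt0 (f : R -> R) : continuous f -> (forall x, 0 < f x) ->
  mu.-integrable setT (EFin \o f) -> 0 < \int[mu]_x f x.
Proof.
move=> cf f0 intf.
have [c _ fc] := @EVT_min R f 0 1 ler01 (continuous_subspaceT cf).
have iI := @integrable_indic_segment R 0 1.
have : \int[mu]_x (f c * \1_(`[0, 1]%classic) x) <= \int[mu]_x f x.
  apply: le_Rintegral => //; first exact: integrableR_scale.
  move=> x _; rewrite indicE; have [|_] := boolP (x \in `[0, 1]%classic).
    by rewrite inE/= => /fc; rewrite mulr1.
  by rewrite mulr0 ltW.
apply: lt_le_trans; rewrite RintegralZl// Rintegral_indic_segment//.
by rewrite subr0 mulr1.
Qed.

End positive_integrals.

(** * Gaussian averages *)

Section heat_operator.
Context {R : realType}.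
Notation mu := (@lebesgue_measure R).
Implicit Types (g h : R -> R) (x s z C K : R).

(** Up to the factor sqrt(pi), the solution at time s^2 / 4 of the heat equation with initial datum
    [g]. In the variable s the integral makes sense at s = 0 as well. *)
Definition heat g x s := \int[mu]_z (g (x + s * z) * expR (- z ^+ 2)).

(** Weak enough to contain the Hopf-Cole weight, whose logarithm grows linearly, stable under
    products, and still integrable against a Gaussian. *)
Definition exp_growth g := exists C K : R, [/\ 0 <= C, 0 <= K &
  forall y, `|g y| <= C * expR (K * `|y|)].

Lemma exp_growth_add g h : exp_growth g -> exp_growth h ->
  exp_growth (fun y => g y + h y).
Proof.
move=> [C [K [C0 K0 gC]]] [D [L [D0 L0 hD]]].
exists (C + D), (K + L); split; [exact: addr_ge0|exact: addr_ge0|move=> y].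
rewrite (le_trans (ler_normD _ _))// mulrDl lerD//.
  by rewrite (le_trans (gC y))// ler_wpM2l// ler_expR ler_wpM2r// lerDl.
by rewrite (le_trans (hD y))// ler_wpM2l// ler_expR ler_wpM2r// lerDr.
Qed.

Lemma exp_growth_mul g h : exp_growth g -> exp_growth h ->
  exp_growth (fun y => g y * h y).
Proof.
move=> [C [K [C0 K0 gC]]] [D [L [D0 L0 hD]]].
exists (C * D), (K + L); split; [exact: mulr_ge0|exact: addr_ge0|move=> y].
by rewrite normrM mulrDl expRD mulrACA ler_pM.
Qed.

Lemma exp_growth_bounded g C : (forall y, `|g y| <= C) -> exp_growth g.
Proof.
move=> gC; have C0 : 0 <= C by rewrite (le_trans _ (gC 0)).
by exists C, 0; split => // y; rewrite mul0r expR0 mulr1.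
Qed.

Lemma le_expR_id (w : R) : 0 <= w -> w <= expR w.
Proof. by move=> w0; apply: le_trans (expR_ge1Dx w); rewrite lerDr. Qed.

Lemma exp_growth_linear g C : 0 <= C -> (forall y, `|g y| <= C * `|y|) -> exp_growth g.
Proof.
move=> C0 gC; exists C, 1; split => // y; apply: (le_trans (gC y)).
by rewrite ler_wpM2l// mul1r le_expR_id.
Qed.

Definition gauss_dom C K (z : R) := C * (expR (K * `|z|) * expR (- (1 * z ^+ 2))).

Lemma integrable_gauss_dom C K : mu.-integrable setT (EFin \o gauss_dom C K).
Proof. by apply: integrableR_scale => //; exact: integrable_exp_gauss. Qed.

(* One dominating function serves the heat integrals and their [s]-derivatives,
   locally uniformly in [x] and [s]. *)
Lemma heat_dominated g C K X S x s z : 0 <= C -> 0 <= K ->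
  (forall y, `|g y| <= C * expR (K * `|y|)) -> `|x| <= X -> `|s| <= S ->
  `|g (x + s * z) * expR (- z ^+ 2)| <= gauss_dom (C * expR (K * X)) (K * S + 1) z /\
  `|z * g (x + s * z) * expR (- z ^+ 2)| <= gauss_dom (C * expR (K * X)) (K * S + 1) z.
Proof.
move=> C0 K0 gC xX sS.
have h : `|g (x + s * z)| <= C * expR (K * X) * expR (K * S * `|z|).
  apply: (le_trans (gC _)); rewrite -[leRHS]mulrA ler_wpM2l// -expRD ler_expR.
  rewrite -mulrA -mulrDr ler_wpM2l// (le_trans (ler_normD _ _))// lerD//.
  by rewrite normrM ler_wpM2r.
rewrite /gauss_dom mul1r mulrDl mul1r expRD.
have e1 : 1 <= expR `|z| by rewrite -expR0 ler_expR.
have CX0 : 0 <= C * expR (K * X) by rewrite mulr_ge0// expR_ge0.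
have E0 := expR_ge0 (K * S * `|z|); have G0 := expR_ge0 (- z ^+ 2).
split.
  rewrite normrM (ger0_norm G0) !mulrA ler_wpM2r// (le_trans h)//.
  by rewrite ler_peMr// mulr_ge0.
rewrite !normrM (ger0_norm G0) !mulrA ler_wpM2r// mulrC ler_pM//.
exact: le_expR_id.
Qed.

Lemma measurable_heat_integrand g x s : continuous g ->
  measurable_fun setT (fun z => g (x + s * z) * expR (- z ^+ 2)) /\
  measurable_fun setT (fun z => z * g (x + s * z) * expR (- z ^+ 2)).
Proof.
move=> cg; have mg := measurable_fun_continuous cg.
have ma : measurable_fun setT (fun z => g (x + s * z)).
  by apply: (measurableT_comp mg); mfun.
have mx : measurable_fun setT (fun z : R => expR (- z ^+ 2)) by mfun.
by split; mfun.
Qed.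

Lemma integrable_heat g x s : continuous g -> exp_growth g ->
  mu.-integrable setT (EFin \o (fun z => g (x + s * z) * expR (- z ^+ 2))) /\
  mu.-integrable setT (EFin \o (fun z => z * g (x + s * z) * expR (- z ^+ 2))).
Proof.
move=> cg [C [K [C0 K0 gC]]].
have [m1 m2] := measurable_heat_integrand x s cg.
split; apply: (@le_integrableR _ _ _ mu _ _
    (gauss_dom (C * expR (K * `|x|)) (K * `|s| + 1))) => //.
- by move=> z _; have [] := heat_dominated z C0 K0 gC (lexx `|x|) (lexx `|s|).
- exact: integrable_gauss_dom.
- by move=> z _; have [] := heat_dominated z C0 K0 gC (lexx `|x|) (lexx `|s|).
- exact: integrable_gauss_dom.
Qed.

Lemma seq_bounded (u : nat -> R) (p : R) : u n @[n --> \oo] --> p ->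
  exists2 K, 0 <= K & forall n, `|u n| <= K.
Proof.
move=> up; have [K [_ hK]] := cvg_seq_bounded (cvgP _ up).
exists (`|K| + 1); first by rewrite addr_ge0.
by move=> n; apply: (hK (`|K| + 1)) => //; rewrite (le_lt_trans (ler_norm K))// ltrDl.
Qed.

Lemma continuous_heat g : continuous g -> exp_growth g ->
  continuous (fun p : R * R => heat g p.1 p.2).
Proof.
move=> cg [C [K [C0 K0 gC]]].
apply: continuous_seqP => -[x s] u uxs.
have ux : (u n).1 @[n --> \oo] --> x by apply: (cvg_comp u (fun p => p.1) uxs); exact: cvg_fst.
have us : (u n).2 @[n --> \oo] --> s by apply: (cvg_comp u (fun p => p.2) uxs); exact: cvg_snd.
have [X _ uX] := seq_bounded ux; have [S _ uS] := seq_bounded us.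
have [||||_] := @Rdominated_cvg _ _ _ mu setT
  (fun n z => g ((u n).1 + (u n).2 * z) * expR (- z ^+ 2))
  (fun z => g (x + s * z) * expR (- z ^+ 2))
  (gauss_dom (C * expR (K * X)) (K * S + 1)) measurableT.
- by move=> n; have [] := measurable_heat_integrand (u n).1 (u n).2 cg.
- move=> z _; apply: cvgM; last exact: cvg_cst.
  apply: continuous_cvg; first exact: cg.
  by apply: cvgD => //; apply: cvgM => //; exact: cvg_cst.
- exact: integrable_gauss_dom.
- by move=> n z _; have [] := heat_dominated z C0 K0 gC (uX n) (uS n).
by [].
Qed.

Lemma is_derive_heat_x g g' x s : continuous g -> exp_growth g ->
  (forall y : R, is_derive y 1 g (g' y)) -> continuous g' -> exp_growth g' ->
  is_derive x 1 (heat g ^~ s) (heat g' x s).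
Proof.
move=> cg eg dg cg' eg'; have [C [K [C0 K0 gC]]] := eg'.
apply: (@is_derive_Rintegral R _ _ mu (fun x z => g (x + s * z) * expR (- z ^+ 2))
   (fun x z => g' (x + s * z) * expR (- z ^+ 2))
   (gauss_dom (C * expR (K * (`|x| + 1))) (K * `|s| + 1)) x 1) => //.
- by move=> y _; have [] := integrable_heat y s cg eg.
- move=> y z _; have d1 : is_derive y 1 (fun y => y + s * z) 1.
    by apply: is_derive_eq; rewrite addr0.
  have := is_derive1_mul (is_derive1_chain (g := fun y => y + s * z) (dg _) d1)
    (is_derive_cst (expR (- z ^+ 2)) y 1).
  by rewrite mulr0 addr0 mulr1.
- exact: integrable_gauss_dom.
- move=> y z yx; have xX : `|y| <= `|x| + 1 by have := ler_norm_dist y x; lra.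
  by have [] := heat_dominated z C0 K0 gC xX (lexx `|s|).
Qed.

Let is_derive_heat_s0 g g' x s : continuous g -> exp_growth g ->
  (forall y : R, is_derive y 1 g (g' y)) -> continuous g' -> exp_growth g' ->
  is_derive s 1 (heat g x) (\int[mu]_z (z * g' (x + s * z) * expR (- z ^+ 2))).
Proof.
move=> cg eg dg cg' eg'; have [C [K [C0 K0 gC]]] := eg'.
apply: (@is_derive_Rintegral R _ _ mu (fun s z => g (x + s * z) * expR (- z ^+ 2))
   (fun s z => z * g' (x + s * z) * expR (- z ^+ 2))
   (gauss_dom (C * expR (K * `|x|)) (K * (`|s| + 1) + 1)) s 1) => //.
- by move=> r _; have [] := integrable_heat x r cg eg.
- move=> r z _; have d1 : is_derive r 1 (fun r => x + r * z) z.
    by apply: is_derive_eq; rewrite /GRing.scale/=; ring.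
  have := is_derive1_mul (is_derive1_chain (g := fun r => x + r * z) (dg _) d1)
    (is_derive_cst (expR (- z ^+ 2)) r 1).
  by rewrite mulr0 addr0 (mulrC (g' _)).
- exact: integrable_gauss_dom.
- move=> r z rs; have sS : `|r| <= `|s| + 1 by have := ler_norm_dist r s; lra.
  by have [] := heat_dominated z C0 K0 gC (lexx `|x|) sS.
Qed.

Lemma cvg_gauss_dom C K : gauss_dom C K n%:R @[n --> \oo] --> (0 : R).
Proof.
have -> : (0 : R) = C * expR ((K + 1) ^+ 2 / 4) * 0 by rewrite mulr0.
apply: (@squeeze_cvgr _ _ _ _ (fun n => - (`|C| * expR ((K + 1) ^+ 2 / 4) * n.+1%:R^-1))
  (fun n => `|C| * expR ((K + 1) ^+ 2 / 4) * n.+1%:R^-1)).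
- apply: nearW => n; rewrite -ler_norml /gauss_dom normrM -mulrA ler_wpM2l//.
  rewrite ger0_norm ?mulr_ge0 ?expR_ge0// -expRD ger0_norm// mul1r.
  (* Completing the square leaves a factor e^(-n), which is at most 1 / (n + 1). *)
  have h : expR (K * n%:R - n%:R ^+ 2) <= expR ((K + 1) ^+ 2 / 4) * expR (- n%:R).
    rewrite -expRD ler_expR -subr_ge0.
    have -> : (K + 1) ^+ 2 / 4 - n%:R - (K * n%:R - n%:R ^+ 2) =
      (n%:R - (K + 1) / 2) ^+ 2 by field.
    exact: sqr_ge0.
  apply: (le_trans h); rewrite ler_wpM2l ?expR_ge0// expRN.
  by rewrite lef_pV2 ?posrE ?expR_gt0// -natr1 addrC expR_ge1Dx.
- rewrite mulr0 -[X in _ --> X]oppr0 -[in X in _ --> X](mulr0 (`|C| * expR ((K + 1) ^+ 2 / 4))).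
  by apply: cvgN; apply: cvgM; [exact: cvg_cst|exact: cvg_harmonic].
- rewrite mulr0 -[in X in _ --> X](mulr0 (`|C| * expR ((K + 1) ^+ 2 / 4))).
  by apply: cvgM; [exact: cvg_cst|exact: cvg_harmonic].
Qed.

(* Integration by parts against the Gaussian: [z e^(-z^2) = - (e^(-z^2))' / 2]. *)
Lemma heat_by_parts g g' x s : continuous g -> exp_growth g ->
  (forall y : R, is_derive y 1 g (g' y)) -> continuous g' -> exp_growth g' ->
  \int[mu]_z (z * g (x + s * z) * expR (- z ^+ 2)) = s / 2 * heat g' x s.
Proof.
move=> cg eg dg cg' eg'; have [C [K [C0 K0 gC]]] := eg.
have [i1 i2] := integrable_heat x s cg eg; have [i3 _] := integrable_heat x s cg' eg'.
pose F z := g (x + s * z) * expR (- z ^+ 2).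
pose f z := s * (g' (x + s * z) * expR (- z ^+ 2)) +
  (- 2) * (z * g (x + s * z) * expR (- z ^+ 2)).
have dF z : is_derive z 1 F (f z).
  have d1 : is_derive z 1 (fun z => x + s * z) s by exact: is_derive1_affine.
  have d2 : is_derive z 1 (fun z : R => - z ^+ 2) (- 2 * z).
    by apply: is_derive_eq; rewrite /GRing.scale/=; ring.
  have := is_derive1_mul (is_derive1_chain (g := fun z => x + s * z) (dg _) d1)
    (is_derive1_chain (g := fun z => - z ^+ 2) (is_derive_expR _) d2).
  by move=> h; apply: is_derive_eq h _; rewrite /f; ring.
have ca : continuous (fun z => x + s * z).
  by move=> z; exact: (is_derive1_continuous (is_derive1_affine z s x)).
have ce : continuous (fun z : R => expR (- z ^+ 2)).
  exact: continuous_gauss_fun.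
have cf : continuous f.
  move=> z; apply: cvgD; (apply: cvgM; first exact: cvg_cst).
    apply: cvgM; last exact: ce.
    exact: (continuous_comp (ca z) (cg' _)).
  apply: cvgM; last exact: ce.
  apply: cvgM; first exact: cvg_id.
  exact: (continuous_comp (ca z) (cg _)).
have intf : mu.-integrable setT (EFin \o f).
  by apply: integrableR_add => //; exact: integrableR_scale.
have Fdom z : `|F z| <= gauss_dom (C * expR (K * `|x|)) (K * `|s| + 1) z.
  by have [] := heat_dominated z C0 K0 gC (lexx `|x|) (lexx `|s|).
have := cvg_gauss_dom (C * expR (K * `|x|)) (K * `|s| + 1) => D0.
have F0 : F n%:R @[n --> \oo] --> (0 : R).
  apply/norm_cvg0P; apply: (squeeze_cvgr _ (cvg_cst (0 : R)) D0).
  by apply: nearW => n; rewrite normr_ge0/=.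
have F0' : F (- n%:R) @[n --> \oo] --> (0 : R).
  apply/norm_cvg0P; apply: (squeeze_cvgr _ (cvg_cst (0 : R)) D0).
  apply: nearW => n; rewrite normr_ge0/= (le_trans (Fdom _))//.
  by rewrite /gauss_dom normrN sqrrN.
have := Rintegral_derive_eq0 cf dF intf F0 F0'.
rewrite RintegralD//; [|exact: integrableR_scale..].
rewrite !RintegralZl// -/(heat g' x s) => h.
lra.
Qed.

(** The heat equation, in terms of the square root of time. The factor s gained from the integration
    by parts later cancels the singular derivative of [sigma]. *)
Lemma is_derive_heat_s g g' g'' x s : continuous g -> exp_growth g ->
  (forall y : R, is_derive y 1 g (g' y)) -> continuous g' -> exp_growth g' ->
  (forall y : R, is_derive y 1 g' (g'' y)) -> continuous g'' -> exp_growth g'' ->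
  is_derive s 1 (heat g x) (s / 2 * heat g'' x s).
Proof.
move=> cg eg dg cg' eg' dg' cg'' eg''.
rewrite -(heat_by_parts x s cg' eg' dg' cg'' eg'').
exact: is_derive_heat_s0.
Qed.

Lemma heat0 g x : heat g x 0 = g x * Num.sqrt pi.
Proof.
rewrite /heat; under eq_Rintegral do rewrite mul0r addr0.
rewrite RintegralZl//; last exact: integrableT_gauss.
by congr (_ * _); rewrite /Rintegral (_ : (fun _ => _) = (fun z : R => (gauss_fun z)%:E))// integralT_gauss.
Qed.

Lemma heat_gt0 g x s : continuous g -> exp_growth g -> (forall y, 0 < g y) ->
  0 < heat g x s.
Proof.
move=> cg eg g0; apply: Rintegral_gt0.
- move=> z; apply: cvgM.
    apply: (continuous_comp (is_derive1_continuous (is_derive1_affine z s x))); exact: cg.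
  exact: continuous_gauss_fun.
- by move=> z; rewrite mulr_gt0// expR_gt0.
- by have [] := integrable_heat x s cg eg.
Qed.

Lemma heat_le g h M x s : continuous g -> exp_growth g -> continuous h -> exp_growth h ->
  (forall y, `|g y| <= M * h y) -> `|heat g x s| <= M * heat h x s.
Proof.
move=> cg eg ch eh gh; have [ig _] := integrable_heat x s cg eg.
have [ih _] := integrable_heat x s ch eh.
rewrite /heat -RintegralZl//; apply: ler_Rintegral => //.
- exact: integrableR_measurable ig.
- move=> z _; rewrite normrM (ger0_norm (expR_ge0 _)) mulrA.
  by rewrite ler_wpM2r// expR_ge0.
- exact: integrableR_scale.
Qed.

End heat_operator.

(** * Change of time, and smoothness up to the initial time *)

Section time_change.
Context {R : realType}.
Variables (a : R) (a0 : a != 0).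
Implicit Types t : R.

Lemma tau0 : tau a 0 = 0 :> R.
Proof. by rewrite /tau mulr0 oppr0 expR0 subrr mul0r. Qed.

Lemma tau_gt0 t : 0 < t -> 0 < tau a t.
Proof.
move=> t0; rewrite /tau; have [an|ap|ae] := ltgtP a 0.
- rewrite -mulrNN -invrN mulr_gt0 ?invr_gt0 ?oppr_gt0//.
  rewrite subr_lt0 -[X in X < _]expR0 ltr_expR oppr_gt0.
  by rewrite nmulr_rlt0.
- by rewrite divr_gt0// subr_gt0 -[X in _ < X]expR0 ltr_expR oppr_lt0 mulr_gt0.
- by move: a0; rewrite ae eqxx.
Qed.

Lemma tau_ge0 t : 0 <= t -> 0 <= tau a t.
Proof. by rewrite le_eqVlt => /predU1P[<-|/tau_gt0/ltW//]; rewrite tau0. Qed.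

Lemma is_derive_tau t : is_derive t 1 (tau a) (expR (- (a * t))).
Proof.
have d : is_derive t 1 (fun s => - (a * s)) (- a).
  by apply: is_derive_eq; rewrite /GRing.scale/=; ring.
have := is_derive1_mul (is_derive1_add (is_derive_cst (1 : R) t 1)
  (is_derive1_scale (-1) (is_derive1_chain (g := fun s => - (a * s)) (is_derive_expR _) d)))
  (is_derive_cst a^-1 t 1).
move=> h; apply: is_derive1_ext (is_derive_eq h _).
  by move=> s; rewrite /tau /cst mulN1r.
by rewrite /cst; field.
Qed.

Lemma continuous_tau : continuous (tau a).
Proof. by move=> t; exact: (is_derive1_continuous (is_derive_tau t)). Qed.

End time_change.

Section smooth_classes.
Context {R : realType}.

Lemma continuous_section (F : R -> R -> R) : continuous (fun p : R * R => F p.1 p.2) ->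
  (forall x, continuous (F x)) /\ (forall t, continuous (F ^~ t)).
Proof.
have hc (c y : R) : (fun _ : R => c) s @[s --> y] --> c by exact: cvg_cst.
have hi (y : R) : s @[s --> y] --> y by exact: cvg_id.
move=> cF; split=> [x t|t x].
  exact: (cvg_comp (fun s => (x, s)) (fun p => F p.1 p.2) (cvg_pair (hc x t) (hi t)) (cF (x, t))).
exact: (cvg_comp (fun s => (s, t)) (fun p => F p.1 p.2) (cvg_pair (hi x) (hc t x)) (cF (x, t))).
Qed.

Inductive fun_ring (B : set (R -> R)) : (R -> R) -> Prop :=
| fun_ring_base g : B g -> fun_ring B g
| fun_ring_cst c : fun_ring B (fun=> c)
| fun_ring_add g h : fun_ring B g -> fun_ring B h -> fun_ring B (fun y => g y + h y)
| fun_ring_mul g h : fun_ring B g -> fun_ring B h -> fun_ring B (fun y => g y * h y).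

(** By Leibniz' rule, closure under differentiation has to be checked on the generators only, whose
    derivatives may be any elements of the ring. *)
Lemma fun_ring_derive (B : set (R -> R)) :
  (forall g, B g -> exp_growth g /\
     exists2 g', fun_ring B g' & forall y : R, is_derive y 1 g (g' y)) ->
  forall g, fun_ring B g -> exp_growth g /\
     exists2 g', fun_ring B g' & forall y : R, is_derive y 1 g (g' y).
Proof.
move=> HB g; elim=> {g}[g /HB//|c|g h rg [eg [g' rg' dg]] rh [eh [h' rh' dh]]|
    g h rg [eg [g' rg' dg]] rh [eh [h' rh' dh]]].
- split; first by apply: (@exp_growth_bounded _ _ `|c|).
  by exists (fun=> 0); [exact: fun_ring_cst|move=> y; exact: is_derive_cst].
- split; first exact: exp_growth_add.
  exists (fun y => g' y + h' y); first exact: fun_ring_add.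
  by move=> y; exact: is_derive1_add.
- split; first exact: exp_growth_mul.
  exists (fun y => g' y * h y + g y * h' y).
    by apply: fun_ring_add; exact: fun_ring_mul.
  by move=> y; exact: is_derive1_mul.
Qed.

(** Difference quotients along [increments] see nonnegative times only, so it does not matter how a
    function is continued to t < 0. *)
Lemma eq_cvg_increments (f g : R -> R) (t l : R) : 0 <= t ->
  (forall s, 0 <= s -> g s = f s) ->
  h^-1 * (f (h + t) - f t) @[h --> increments (@half_line R) t] --> l ->
  h^-1 * (g (h + t) - g t) @[h --> increments (@half_line R) t] --> l.
Proof.
move=> t0 gf; apply: cvg_trans; apply: near_eq_cvg.
rewrite /increments near_withinE; near=> h => /= ht.
by rewrite !gf.
Unshelve. all: end_near. Qed.

Lemma derive_in_half_line (f : R -> R) (t l : R) : 0 <= t ->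
  h^-1 * (f (h + t) - f t) @[h --> increments (@half_line R) t] --> l ->
  derivable_in (@half_line R) f t /\ derive_in (@half_line R) f t = l.
Proof.
move=> t0 fl; have PF := increments_half_line_proper t0.
by split; [exact: (cvgP _ fl)|exact: cvg_lim fl].
Qed.

(* A class of jointly continuous functions that is closed under [x]-derivatives
   and under [t]-derivatives for [t > 0] consists of functions that are smooth
   up to [t = 0]. *)
Lemma smooth_on_half_line (A : (R -> R -> R) -> Prop) :
  (forall F, A F -> [/\ continuous (fun p : R * R => F p.1 p.2),
    exists2 F1, A F1 & forall x t : R, is_derive x 1 (F ^~ t) (F1 x t) &
    exists2 F2, A F2 & forall x t : R, 0 < t -> is_derive t 1 (F x) (F2 x t)]) ->
  forall F G, A F -> (forall x t, 0 <= t -> G x t = F x t) ->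
  smooth_on (@half_line R) G.
Proof.
move=> HA.
have c0 F G : A F -> (forall x t, 0 <= t -> G x t = F x t) -> Cn_on (@half_line R) 0 G.
  move=> AF GF; split => //; have [cF _ _] := HA _ AF.
  apply/subspace_continuousP => -[x t] /= [_ t0].
  rewrite /from_subspace /= GF//.
  have h : (fun p : R * R => F p.1 p.2) p @[p --> within (setT `*` @half_line R) (nbhs (x, t))]
      --> F x t by apply: cvg_within_filter; exact: (cF (x, t)).
  apply: cvg_trans h; apply: near_eq_cvg; rewrite near_withinE; near=> p => -[_ p0].
  by rewrite GF.
move=> + + + + n; elim: n => [|n IHn] F G AF GF; first exact: c0 AF GF.
have [cF [F1 AF1 dF1] [F2 AF2 dF2]] := HA _ AF.
have [cG _] := c0 _ _ AF GF.
have Gt t : 0 <= t -> G ^~ t = F ^~ t by move=> t0; apply/funext => x; rewrite GF.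
have cx K x : A K -> K x s @[s --> (0 : R)^'+] --> K x 0.
  by move=> /HA[/continuous_section[cK _] _ _]; apply: cvg_within_filter; exact: cK.
have dG x t : 0 <= t -> derivable_in (@half_line R) (G x) t /\
    derive_in (@half_line R) (G x) t = F2 x t.
  move=> t0; apply: derive_in_half_line => //.
  apply: (@eq_cvg_increments (F x)) => //; first by move=> s s0; rewrite GF.
  by apply: cvg_increments_half_line => //; exact: cx.
split => //; split.
- move=> x t t0; split; last by have [] := dG x t t0.
  by rewrite Gt//; case: (dF1 x t).
- apply: (IHn F1) => // x t t0; rewrite /dx Gt//.
  exact: is_derive1_derive1.
- by apply: (IHn F2) => // x t t0; have [] := dG x t t0.
Unshelve. all: end_near. Qed.

End smooth_classes.

Section test_functions.
Context {R : realType}.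
Variable phi : R -> R.
Hypothesis tphi : test_function phi.

Lemma test_function_derive n (x : R) :
  is_derive x 1 (derive1n n phi) (derive1n n.+1 phi x).
Proof.
have [dphi _] := tphi; apply: DeriveDef; first exact: dphi.
by rewrite derive1nS derive1E.
Qed.

Lemma test_function_continuous n : continuous (derive1n n phi).
Proof. by move=> x; exact: (is_derive1_continuous (test_function_derive n x)). Qed.

(** One [L] serves all derivatives: L < |x| is an open condition, so vanishing there passes to the
    derivative. *)
Lemma test_function_support : exists2 L : R, 0 < L &
  forall n x, L < `|x| -> derive1n n phi x = 0.
Proof.
have [_ [K cK phiK]] := tphi.
have [M [_ /(_ (`|M| + 1))]] := compact_bounded cK.
rewrite (le_lt_trans (ler_norm M)) ?ltrDl// => /(_ isT) hM.
exists (`|M| + 1); first by rewrite ltr_wpDl.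
elim=> [|n IHn] x Mx.
  by apply: phiK => /hM /=; rewrite leNgt Mx.
rewrite derive1nS; apply: is_derive1_derive1.
apply: (@is_derive1_near _ (cst 0)); near=> y.
rewrite /cst IHn//; near: y.
have := @norm_continuous _ R x => /cvgr_gt; exact.
Unshelve. all: end_near. Qed.

End test_functions.

(** * Weak asymptotics of the mollified solutions *)

Section hopf_cole_algebra.
Context {R : realType}.
Implicit Types (a e c E W S Q x t : R).

(* With [u = c W1 Q], where [W_k] is the [k]-th derivative of the Hopf-Cole
   weight [W] and [Q = 1 / W], these are [u_x], [u_xx] and [u_t]. *)
Definition burgers_x c W1 W2 Q := c * (W2 * Q + W1 * (- W1 * Q ^+ 2)).

Definition burgers_xx c W1 W2 W3 Q :=
  c * (W3 * Q - 3 * W1 * W2 * Q ^+ 2 + 2 * W1 ^+ 3 * Q ^+ 3).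

Definition burgers_t a e E W1 W2 W3 Q := - 2 * e * (- a * E) * (W1 * Q) +
  - 2 * e * E * (e * E * W3 * Q + W1 * (- (e * E * W2) * Q ^+ 2)).

Lemma is_derive_burgers (W1 Q : R -> R) x c W2 :
  is_derive x 1 W1 W2 -> is_derive x 1 Q (- W1 x * Q x ^+ 2) ->
  is_derive x 1 (fun y => c * (W1 y * Q y)) (burgers_x c (W1 x) W2 (Q x)).
Proof. by move=> d1 dQ; exact: (is_derive1_scale _ (is_derive1_mul d1 dQ)). Qed.

Lemma is_derive_burgers_x (W1 W2 Q : R -> R) x c W3 :
  is_derive x 1 W1 (W2 x) -> is_derive x 1 W2 W3 ->
  is_derive x 1 Q (- W1 x * Q x ^+ 2) ->
  is_derive x 1 (fun y => burgers_x c (W1 y) (W2 y) (Q y)) (burgers_xx c (W1 x) (W2 x) W3 (Q x)).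
Proof.
move=> d1 d2 dQ.
have := is_derive1_scale c (is_derive1_add (is_derive1_mul d2 dQ)
  (is_derive1_mul d1 (is_derive1_mul (is_derive1_scale (-1) d1) (is_derive1_mul dQ dQ)))).
move=> h; have hE : burgers_xx c (W1 x) (W2 x) W3 (Q x) = c *
  (W3 * Q x + W2 x * (- W1 x * Q x ^+ 2) +
   (W2 x * (-1 * W1 x * (Q x * Q x)) +
    W1 x * (-1 * W2 x * (Q x * Q x) +
            -1 * W1 x * (- W1 x * Q x ^+ 2 * Q x + Q x * (- W1 x * Q x ^+ 2))))).
  by rewrite /burgers_xx; ring.
rewrite hE; apply: is_derive1_ext h => y.
by rewrite /burgers_x mulN1r expr2.
Qed.

Lemma is_derive_burgers_t (W1 Q E : R -> R) t a e W2 W3 :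
  is_derive t 1 E (- a * E t) -> is_derive t 1 W1 (e * E t * W3) ->
  is_derive t 1 Q (- (e * E t * W2) * Q t ^+ 2) ->
  is_derive t 1 (fun s => - 2 * e * E s * (W1 s * Q s)) (burgers_t a e (E t) (W1 t) W2 W3 (Q t)).
Proof.
by move=> dE d1 dQ; exact: (is_derive1_mul (is_derive1_scale _ dE) (is_derive1_mul d1 dQ)).
Qed.

(** The heat equation replaces time derivatives of the weight by second space derivatives; what
    remains is a polynomial identity. *)
Lemma burgers_identity a e E W1 W2 W3 Q :
  burgers_t a e E W1 W2 W3 Q +
  - 2 * e * E * (W1 * Q) * burgers_x (- 2 * e * E) W1 W2 Q + a * (- 2 * e * E * (W1 * Q)) =
  e * E * burgers_xx (- 2 * e * E) W1 W2 W3 Q.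
Proof. by rewrite /burgers_t /burgers_x /burgers_xx; ring. Qed.

Lemma continuous_burgers_t (E W1 W2 W3 Q : R -> R) t a e :
  {for t, continuous E} -> {for t, continuous W1} -> {for t, continuous W2} ->
  {for t, continuous W3} -> {for t, continuous Q} ->
  {for t, continuous (fun t => burgers_t a e (E t) (W1 t) (W2 t) (W3 t) (Q t))}.
Proof.
move=> cE c1 c2 c3 cQ; rewrite /burgers_t.
have k c : {for t, continuous (fun _ : R => c)} by exact: cvg_cst.
have m (f g : R -> R) : {for t, continuous f} -> {for t, continuous g} ->
  {for t, continuous (fun s => f s * g s)} by move=> ? ?; exact: cvgM.
have p (f g : R -> R) : {for t, continuous f} -> {for t, continuous g} ->
  {for t, continuous (fun s => f s + g s)} by move=> ? ?; exact: cvgD.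
have n (f : R -> R) : {for t, continuous f} ->
  {for t, continuous (fun s => - f s)} by move=> ?; exact: cvgN.
have q : {for t, continuous (fun s => Q s ^+ 2)}.
  exact (m Q Q cQ cQ).
apply/p; apply/m.
- by apply/m; [exact/k|apply/m => //; exact/k].
- exact/m.
- by apply/m => //; exact/k.
- apply/p; first by apply/m => //; apply/m => //; apply/m => //; exact/k.
  apply/m => //; apply/m => //; apply/n; apply/m => //; apply/m => //; exact/k.
Qed.

(* [v = (S0 / W)_x] and its derivatives. *)
Definition transport S0 S1 W1 Q := S1 * Q + S0 * (- W1 * Q ^+ 2).

Definition transport_x S0 S1 S2 W1 W2 Q := S2 * Q - 2 * S1 * W1 * Q ^+ 2
  - S0 * W2 * Q ^+ 2 + 2 * S0 * W1 ^+ 2 * Q ^+ 3.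

Definition transport_xx S0 S1 S2 S3 W1 W2 W3 Q :=
  S3 * Q - 3 * S2 * W1 * Q ^+ 2 - 3 * S1 * W2 * Q ^+ 2 - S0 * W3 * Q ^+ 2
  + 6 * S1 * W1 ^+ 2 * Q ^+ 3 + 6 * S0 * W1 * W2 * Q ^+ 3 - 6 * S0 * W1 ^+ 3 * Q ^+ 4.

Definition transport_t e E S0 S1 S2 S3 W1 W2 W3 Q := e * E *
  (S3 * Q - S1 * W2 * Q ^+ 2 - S2 * W1 * Q ^+ 2 - S0 * W3 * Q ^+ 2 + 2 * S0 * W1 * W2 * Q ^+ 3).

Lemma is_derive_transport (S0 S1 W1 Q : R -> R) x S2 W2 :
  is_derive x 1 S0 (S1 x) -> is_derive x 1 S1 S2 -> is_derive x 1 W1 W2 ->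
  is_derive x 1 Q (- W1 x * Q x ^+ 2) ->
  is_derive x 1 (fun y => transport (S0 y) (S1 y) (W1 y) (Q y))
    (transport_x (S0 x) (S1 x) S2 (W1 x) W2 (Q x)).
Proof.
move=> d0 d1 dW dQ.
have := is_derive1_add (is_derive1_mul d1 dQ)
  (is_derive1_mul d0 (is_derive1_mul (is_derive1_scale (-1) dW) (is_derive1_mul dQ dQ))).
move=> h; have hE : transport_x (S0 x) (S1 x) S2 (W1 x) W2 (Q x) =
  S2 * Q x + S1 x * (- W1 x * Q x ^+ 2) +
   (S1 x * (-1 * W1 x * (Q x * Q x)) +
    S0 x * (-1 * W2 * (Q x * Q x) +
            -1 * W1 x * (- W1 x * Q x ^+ 2 * Q x + Q x * (- W1 x * Q x ^+ 2)))).
  by rewrite /transport_x; ring.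
rewrite hE; apply: is_derive1_ext h => y.
by rewrite /transport mulN1r expr2.
Qed.

Lemma is_derive_transport_x (S0 S1 S2 W1 W2 Q : R -> R) x S3 W3 :
  is_derive x 1 S0 (S1 x) -> is_derive x 1 S1 (S2 x) -> is_derive x 1 S2 S3 ->
  is_derive x 1 W1 (W2 x) -> is_derive x 1 W2 W3 ->
  is_derive x 1 Q (- W1 x * Q x ^+ 2) ->
  is_derive x 1 (fun y => transport_x (S0 y) (S1 y) (S2 y) (W1 y) (W2 y) (Q y))
    (transport_xx (S0 x) (S1 x) (S2 x) S3 (W1 x) (W2 x) W3 (Q x)).
Proof.
move=> d0 d1 d2 dW1 dW2 dQ; have dQ2 := is_derive1_mul dQ dQ; have dW11 := is_derive1_mul dW1 dW1.
have h := is_derive1_add (is_derive1_add (is_derive1_add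
  (is_derive1_mul d2 dQ)
  (is_derive1_scale (-2) (is_derive1_mul (is_derive1_mul d1 dW1) dQ2)))
  (is_derive1_scale (-1) (is_derive1_mul (is_derive1_mul d0 dW2) dQ2)))
  (is_derive1_scale 2 (is_derive1_mul (is_derive1_mul d0 dW11) (is_derive1_mul dQ2 dQ))).
apply: is_derive1_ext; last first.
  apply: is_derive_eq h _; set s0 := S0 x; set s1 := S1 x; set s2 := S2 x.
  by set w1 := W1 x; set w2 := W2 x; set q := Q x; rewrite /transport_xx; ring.
move=> y /=; set s0 := S0 y; set s1 := S1 y; set s2 := S2 y.
by set w1 := W1 y; set w2 := W2 y; set q := Q y; rewrite /transport_x; ring.
Qed.

Lemma is_derive_transport_t (S0 S1 W1 Q : R -> R) t e E S2 S3 W2 W3 :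
  is_derive t 1 S0 (e * E * S2) -> is_derive t 1 S1 (e * E * S3) ->
  is_derive t 1 W1 (e * E * W3) -> is_derive t 1 Q (- (e * E * W2) * Q t ^+ 2) ->
  is_derive t 1 (fun s => transport (S0 s) (S1 s) (W1 s) (Q s))
    (transport_t e E (S0 t) (S1 t) S2 S3 (W1 t) W2 W3 (Q t)).
Proof.
move=> d0 d1 dW dQ.
have h := is_derive1_add (is_derive1_mul d1 dQ)
  (is_derive1_mul d0 (is_derive1_mul (is_derive1_scale (-1) dW) (is_derive1_mul dQ dQ))).
apply: is_derive1_ext; last first.
  apply: is_derive_eq h _; set s0 := S0 t; set s1 := S1 t.
  by set w1 := W1 t; set q := Q t; rewrite /transport_t; ring.
by move=> y /=; rewrite /transport mulN1r expr2.
Qed.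

(** The term in parentheses is (u v)_x expanded by Leibniz' rule, with u the Hopf-Cole velocity. *)
Lemma transport_identity e E S0 S1 S2 S3 W1 W2 W3 Q :
  transport_t e E S0 S1 S2 S3 W1 W2 W3 Q +
  (burgers_x (- 2 * e * E) W1 W2 Q * transport S0 S1 W1 Q +
   - 2 * e * E * (W1 * Q) * transport_x S0 S1 S2 W1 W2 Q) =
  e * E * transport_xx S0 S1 S2 S3 W1 W2 W3 Q.
Proof. by rewrite /transport_t /burgers_x /transport /transport_x /transport_xx; ring. Qed.

Lemma continuous_transport_t (E S0 S1 S2 S3 W1 W2 W3 Q : R -> R) t e :
  {for t, continuous E} -> {for t, continuous S0} -> {for t, continuous S1} ->
  {for t, continuous S2} -> {for t, continuous S3} -> {for t, continuous W1} ->
  {for t, continuous W2} -> {for t, continuous W3} -> {for t, continuous Q} ->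
  {for t, continuous (fun t => transport_t e (E t) (S0 t) (S1 t) (S2 t) (S3 t)
    (W1 t) (W2 t) (W3 t) (Q t))}.
Proof.
move=> cE c0 c1 c2 c3 k1 k2 k3 cQ; rewrite /transport_t.
have k c : {for t, continuous (fun _ : R => c)} by exact: cvg_cst.
have m (f g : R -> R) : {for t, continuous f} -> {for t, continuous g} ->
  {for t, continuous (fun s => f s * g s)} by move=> ? ?; exact: cvgM.
have p (f g : R -> R) : {for t, continuous f} -> {for t, continuous g} ->
  {for t, continuous (fun s => f s + g s)} by move=> ? ?; exact: cvgD.
have b (f g : R -> R) : {for t, continuous f} -> {for t, continuous g} ->
  {for t, continuous (fun s => f s - g s)} by move=> ? ?; exact: cvgB.
have q2 : {for t, continuous (fun s => Q s ^+ 2)}.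
  exact (m Q Q cQ cQ).
have q3 : {for t, continuous (fun s => Q s ^+ 3)}.
  exact (m Q (fun s => Q s ^+ 2) cQ q2).
apply/m; first by apply/m => //; exact/k.
apply/p; last by (do 4 (apply/m => //)); exact/k.
by do 3 (apply/b; last by do 2 (apply/m => //)); exact/m.
Qed.

End hopf_cole_algebra.

(** * The solution for mollified data at a fixed [e] *)

Section mollified_solution.
Context {R : realType}.
Notation mu := (@lebesgue_measure R).
Variables (a : R) (a0 : a != 0) (u0 v0 : R -> R) (e : R) (e0 : 0 < e).
Hypotheses (lu : loc_integrable u0) (lv : loc_integrable v0).
Hypothesis bu : forall k, kernel e k -> exists C : R, forall x, `|conv u0 k x| <= C.
Hypothesis bv : forall k, kernel e k -> exists C : R, forall x, `|conv v0 k x| <= C.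
Implicit Types (x y z t s : R) (g h : R -> R).

Let ue := mollify u0 e.
Let ve := mollify v0 e.
Let Pe := oriented_integral ve.
Let w0 y := expR (- ((2 * e)^-1 * oriented_integral ue y)).

(** The functions met on differentiating the Hopf-Cole weight [w0] and the primitive [Pe]: beyond
    these two, only convolutions of the data with derivatives of the mollifier arise. *)
Inductive data_class : (R -> R) -> Prop :=
| data_u k : kernel e k -> data_class (conv u0 k)
| data_v k : kernel e k -> data_class (conv v0 k)
| data_primitive : data_class Pe
| data_weight : data_class w0.

Lemma is_derive_conv_kernel f k k' x : loc_integrable f -> kernel e k -> kernel e k' ->
  (forall y : R, is_derive y 1 k (k' y)) -> is_derive x 1 (conv f k) (conv f k' x).
Proof.
move=> lf kk kk' dk.
have [B B0 eB] := kernel_bounded e0 kk; have [B' B'0 eB'] := kernel_bounded e0 kk'.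
apply: (@is_derive_conv R f k k' e (Num.max B B') x e0 lf dk).
- exact: kernel_continuous kk'.
- by move=> z; rewrite le_max eB.
- by move=> z; rewrite le_max eB' orbT.
- exact: kernel_support e0 _ kk.
- exact: kernel_support e0 _ kk'.
Qed.

Let cmoll f : loc_integrable f -> continuous (mollify f e).
Proof.
move=> lf x; have kf := kernel_friedrichs e; have [k' kk' dk] := kernel_derive kf.
exact: (is_derive1_continuous (is_derive_conv_kernel x lf kf kk' dk)).
Qed.

Let lip_primitive f : loc_integrable f ->
  (forall k, kernel e k -> exists C : R, forall x, `|conv f k x| <= C) ->
  exists2 C, 0 <= C & forall y, `|oriented_integral (mollify f e) y| <= C * `|y|.
Proof.
move=> lf bf; have [C fC] := bf _ (kernel_friedrichs e).
exists C; first by rewrite (le_trans _ (fC 0)).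
move=> y; have := @oriented_integral_lip R (mollify f e) C y 0.
rewrite oriented_integral0 !subr0; apply => //.
exact: measurable_fun_continuous (cmoll lf).
Qed.

Lemma data_class_derive g : data_class g -> exp_growth g /\
  exists2 g', fun_ring data_class g' & forall y : R, is_derive y 1 g (g' y).
Proof.
case=> {g}[k kk|k kk||].
- split; first by have [C uC] := bu kk; exact: exp_growth_bounded uC.
  have [k' kk' dk] := kernel_derive kk.
  exists (conv u0 k'); first by apply: fun_ring_base; exact: data_u.
  by move=> y; exact: is_derive_conv_kernel.
- split; first by have [C vC] := bv kk; exact: exp_growth_bounded vC.
  have [k' kk' dk] := kernel_derive kk.
  exists (conv v0 k'); first by apply: fun_ring_base; exact: data_v.
  by move=> y; exact: is_derive_conv_kernel.
- split; first by have [C C0 vC] := lip_primitive lv bv; exact: exp_growth_linear vC.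
  exists ve; first by apply: fun_ring_base; apply: data_v; exact: kernel_friedrichs.
  by move=> y; apply: is_derive_oriented_integral; exact: cmoll.
- split.
    have [C C0 uC] := lip_primitive lu bu.
    have i0 : 0 <= (2 * e)^-1 by rewrite invr_ge0 mulr_ge0// ltW.
    exists 1, ((2 * e)^-1 * C); split => //; first exact: mulr_ge0.
    move=> y; rewrite mul1r ger0_norm ?expR_ge0// ler_expR -mulrN -mulrA ler_wpM2l//.
    by rewrite (le_trans _ (uC y))// -normrN ler_norm.
  exists (fun y => - (2 * e)^-1 * (ue y * w0 y)).
    apply: fun_ring_mul; first exact: fun_ring_cst.
    apply: fun_ring_mul; apply: fun_ring_base; last exact: data_weight.
    by apply: data_u; exact: kernel_friedrichs.
  move=> y; have dU : is_derive y 1 (fun y => - ((2 * e)^-1 * oriented_integral ue y))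
      (- (2 * e)^-1 * ue y).
    have := is_derive1_scale (- (2 * e)^-1) (is_derive_oriented_integral y (cmoll lu)).
    by apply: is_derive1_ext => z; rewrite mulNr.
  have := is_derive1_chain (g := fun y => - ((2 * e)^-1 * oriented_integral ue y))
    (is_derive_expR _) dU.
  by move=> h; apply: is_derive_eq h _; rewrite /w0; ring.
Qed.

Notation data := (fun_ring data_class).

Lemma data_derive g : data g -> exp_growth g /\
  exists2 g', data g' & forall y : R, is_derive y 1 g (g' y).
Proof. by apply: fun_ring_derive; exact: data_class_derive. Qed.

Lemma data_growth g : data g -> exp_growth g.
Proof. by case/data_derive. Qed.

Lemma data_continuous g : data g -> continuous g.
Proof. by case/data_derive => _ [g' _ dg] y; exact: (is_derive1_continuous (dg y)). Qed.

(** Chosen with sigma^2 = 4 e tau, so that y = x + sigma z turns the quadratic part of theta / (2 e)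
    into z^2. *)
Let sigma t := 2 * Num.sqrt (e * tau a t).

Let sigma_gt0 t : 0 < t -> 0 < sigma t.
Proof. by move=> t0; rewrite /sigma mulr_gt0// sqrtr_gt0 mulr_gt0// tau_gt0. Qed.

Let sigma_sqr t : 0 <= t -> sigma t ^+ 2 = 4 * e * tau a t.
Proof.
move=> t0; rewrite /sigma exprMn sqr_sqrtr; first by ring.
by rewrite mulr_ge0 ?tau_ge0// ltW.
Qed.

Let continuous_sigma : continuous sigma.
Proof.
move=> t; apply: cvgM; first exact: cvg_cst.
apply: (continuous_comp (f := fun t => e * tau a t)); last exact: sqrt_continuous.
by apply: cvgM; [exact: cvg_cst|exact: continuous_tau].
Qed.

Let is_derive_sigma t : 0 < t -> is_derive t 1 sigma (2 * e * expR (- (a * t)) / sigma t).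
Proof.
move=> t0; have s0 := sigma_gt0 t0.
have et : 0 < e * tau a t by rewrite mulr_gt0// tau_gt0.
have d := is_derive1_scale 2 (is_derive1_chain (g := fun t => e * tau a t)
  (is_derive1_sqrt et) (is_derive1_scale e (is_derive_tau a0 t))).
apply: is_derive_eq d _; rewrite /sigma; field.
by rewrite gt_eqF// sqrtr_gt0.
Qed.

Definition heat_t g x t := heat g x (sigma t).

Let continuous_heat_t g : data g -> continuous (fun p : R * R => heat_t g p.1 p.2).
Proof.
move=> dg [x t].
have h1 : q.1 @[q --> (x, t)] --> x by exact: cvg_fst.
have h2 : sigma q.2 @[q --> (x, t)] --> sigma t.
  by apply: (cvg_comp snd sigma); [exact: cvg_snd|exact: continuous_sigma].
have h3 : continuous (fun p : R * R => heat g p.1 p.2).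
  by apply: continuous_heat; [exact: data_continuous|exact: data_growth].
exact: (cvg_comp (fun q : R * R => (q.1, sigma q.2)) (fun q : R * R => heat g q.1 q.2)
  (cvg_pair h1 h2) (h3 (x, sigma t))).
Qed.

Let is_derive_heat_tx g g' x t : data g -> data g' ->
  (forall y : R, is_derive y 1 g (g' y)) ->
  is_derive x 1 (heat_t g ^~ t) (heat_t g' x t).
Proof.
move=> dg dg' gg'; apply: is_derive_heat_x => //;
  by [exact: data_continuous|exact: data_growth].
Qed.

(** The derivative 2 e e^(-a t) / sigma of [sigma] blows up at t = 0, but [is_derive_heat_s]
    supplies the factor sigma / 2. The result has no singularity left and stays in the class
    below. *)
Let is_derive_heat_tt g g' g'' x t : data g -> data g' -> data g'' ->
  (forall y : R, is_derive y 1 g (g' y)) -> (forall y : R, is_derive y 1 g' (g'' y)) ->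
  0 < t -> is_derive t 1 (heat_t g x) (e * expR (- (a * t)) * heat_t g'' x t).
Proof.
move=> dg dg' dg'' gg' gg'' t0; have s0 := sigma_gt0 t0.
have := is_derive1_chain (f := heat g x)
  (is_derive_heat_s x (sigma t) (data_continuous dg) (data_growth dg) gg'
    (data_continuous dg') (data_growth dg') gg'' (data_continuous dg'') (data_growth dg''))
  (is_derive_sigma t0).
move=> h; apply: is_derive_eq h _; rewrite /heat_t; field.
by rewrite gt_eqF.
Qed.

Let dw0 : data w0. Proof. by apply: fun_ring_base; exact: data_weight. Qed.

Let heat_w0_gt0 x t : 0 < heat_t w0 x t.
Proof.
apply: heat_gt0; [exact: data_continuous|exact: data_growth|].
by move=> y; exact: expR_gt0.
Qed.

(** Made to contain u and V and to be closed under both derivatives. The reciprocal of the weight is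
    a generator, its derivative being a product of members of the class. *)
Inductive solution_class : (R -> R -> R) -> Prop :=
| solution_heat g : data g -> solution_class (heat_t g)
| solution_exp : solution_class (fun x t => expR (- (a * t)))
| solution_inv : solution_class (fun x t => (heat_t w0 x t)^-1)
| solution_cst c : solution_class (fun x t => c)
| solution_add F G : solution_class F -> solution_class G ->
    solution_class (fun x t => F x t + G x t)
| solution_mul F G : solution_class F -> solution_class G ->
    solution_class (fun x t => F x t * G x t).

Lemma is_derive_exp_at t : is_derive t 1 (fun t => expR (- (a * t))) (- a * expR (- (a * t))).
Proof.
have d : is_derive t 1 (fun s => - (a * s)) (- a).
  by apply: is_derive_eq; rewrite /GRing.scale/=; ring.
have := is_derive1_chain (g := fun s => - (a * s)) (is_derive_expR _) d.
by move=> h; apply: is_derive_eq h _; rewrite mulrC.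
Qed.

Lemma solution_class_closed F : solution_class F ->
  [/\ continuous (fun p : R * R => F p.1 p.2),
    exists2 F1, solution_class F1 & forall x t : R, is_derive x 1 (F ^~ t) (F1 x t) &
    exists2 F2, solution_class F2 & forall x t : R, 0 < t -> is_derive t 1 (F x) (F2 x t)].
Proof.
elim=> {F}[g dg| | |c|F G sF [cF [F1 sF1 dF1] [F2 sF2 dF2]] sG [cG [G1 sG1 dG1] [G2 sG2 dG2]]
  |F G sF [cF [F1 sF1 dF1] [F2 sF2 dF2]] sG [cG [G1 sG1 dG1] [G2 sG2 dG2]]].
- have [_ [g' dg' gg']] := data_derive dg; have [_ [g'' dg'' gg'']] := data_derive dg'.
  split; first exact: continuous_heat_t.
    exists (heat_t g'); first exact: solution_heat.
    by move=> x t; exact: is_derive_heat_tx.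
  exists (fun x t => e * expR (- (a * t)) * heat_t g'' x t).
    by apply: solution_mul; [apply: solution_mul; [exact: solution_cst|exact: solution_exp]
      |exact: solution_heat].
  by move=> x t; exact: is_derive_heat_tt.
- split.
  + move=> p; apply: (cvg_comp snd (fun t => expR (- (a * t)))); first exact: cvg_snd.
    exact: (is_derive1_continuous (is_derive_exp_at _)).
  + by exists (fun=> fun=> 0); [exact: solution_cst|move=> x t; exact: is_derive_cst].
  + exists (fun x t => - a * expR (- (a * t))).
      by apply: solution_mul; [exact: solution_cst|exact: solution_exp].
    by move=> x t _; exact: is_derive_exp_at.
- have [_ [g' dg' gg']] := data_derive dw0; have [_ [g'' dg'' gg'']] := data_derive dg'.
  have sI : solution_class (fun x t => (heat_t w0 x t)^-1) by exact: solution_inv.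
  have neq x t : heat_t w0 x t != 0 by rewrite gt_eqF.
  split.
  + by move=> p; apply: cvgV; [exact: neq|exact: continuous_heat_t].
  + exists (fun x t => (-1 * heat_t g' x t) *
        ((heat_t w0 x t)^-1 * (heat_t w0 x t)^-1)).
      apply: solution_mul; last exact: solution_mul.
      by apply: solution_mul; [exact: solution_cst|exact: solution_heat].
    move=> x t; have := is_derive1_inv (f := heat_t w0 ^~ t) (neq x t) (is_derive_heat_tx x t dw0 dg' gg').
    by move=> h; apply: is_derive_eq h _; rewrite expr2 mulN1r.
  + exists (fun x t => (-1 * (e * expR (- (a * t)) * heat_t g'' x t)) *
        ((heat_t w0 x t)^-1 * (heat_t w0 x t)^-1)).
      apply: solution_mul; last exact: solution_mul.
      apply: solution_mul; first exact: solution_cst.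
      by apply: solution_mul; [apply: solution_mul; [exact: solution_cst|exact: solution_exp]
        |exact: solution_heat].
    move=> x t t0; have := is_derive1_inv (f := heat_t w0 x) (neq x t) (is_derive_heat_tt x dw0 dg' dg'' gg' gg'' t0).
    by move=> h; apply: is_derive_eq h _; rewrite expr2 mulN1r.
- split; first by move=> p; exact: cvg_cst.
    by exists (fun=> fun=> 0); [exact: solution_cst|move=> x t; exact: is_derive_cst].
  by exists (fun=> fun=> 0); [exact: solution_cst|move=> x t _; exact: is_derive_cst].
- split; first by move=> p; apply: cvgD; [exact: cF|exact: cG].
    exists (fun x t => F1 x t + G1 x t); first exact: solution_add.
    by move=> x t; exact: is_derive1_add.
  exists (fun x t => F2 x t + G2 x t); first exact: solution_add.
  by move=> x t t0; apply: is_derive1_add; [exact: dF2|exact: dG2].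
- split; first by move=> p; apply: cvgM; [exact: cF|exact: cG].
    exists (fun x t => F1 x t * G x t + F x t * G1 x t).
      by apply: solution_add; exact: solution_mul.
    by move=> x t; exact: (is_derive1_mul (dF1 x t) (dG1 x t)).
  exists (fun x t => F2 x t * G x t + F x t * G2 x t).
    by apply: solution_add; exact: solution_mul.
  by move=> x t t0; exact: (is_derive1_mul (dF2 x t t0) (dG2 x t t0)).
Qed.

Lemma weight_affine x z t : 0 < t ->
  weight a ue e x t (x + sigma t * z) = w0 (x + sigma t * z) * expR (- z ^+ 2).
Proof.
move=> t0; rewrite /weight /theta /w0 -expRD; congr expR.
have := sigma_sqr (ltW t0) => s2; have T0 := tau_gt0 a0 t0.
have -> : (x - (x + sigma t * z)) ^+ 2 = 4 * e * tau a t * z ^+ 2.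
  by rewrite -s2; ring.
by field; rewrite !gt_eqF.
Qed.

Lemma integral_weight g x t : data g -> 0 < t ->
  \int[mu]_y (g y * weight a ue e x t y) = sigma t * heat_t (fun y => g y * w0 y) x t.
Proof.
move=> dg t0; have s0 := sigma_gt0 t0.
have dgw : data (fun y => g y * w0 y) by exact: fun_ring_mul.
have [ih _] := integrable_heat x (sigma t) (data_continuous dgw) (data_growth dgw).
have eqz z : g (x + sigma t * z) * weight a ue e x t (x + sigma t * z) =
   g (x + sigma t * z) * w0 (x + sigma t * z) * expR (- z ^+ 2).
  by rewrite weight_affine// mulrA.
have [|_ ->] := @Rintegral_affine_comp R (fun y => g y * weight a ue e x t y) x (sigma t) s0.
  by apply: eq_integrable ih => // z _ /=; rewrite eqz.
by congr (_ * _); apply: eq_Rintegral => z _; rewrite eqz.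
Qed.

Lemma integral_weight1 x t : 0 < t ->
  \int[mu]_y weight a ue e x t y = sigma t * heat_t w0 x t.
Proof.
move=> t0; have := integral_weight x (fun_ring_cst data_class 1) t0.
have -> : (fun y => 1 * w0 y) = w0 by apply/funext => y; rewrite mul1r.
by move=> <-; apply: eq_Rintegral => y _; rewrite mul1r.
Qed.

Let w1 y := - (2 * e)^-1 * (ue y * w0 y).

Let ddue : data ue.
Proof. by apply: fun_ring_base; apply: data_u; exact: kernel_friedrichs. Qed.

Let ddPe : data Pe.
Proof. by apply: fun_ring_base; exact: data_primitive. Qed.

Let dw1 : data w1.
Proof. by apply: fun_ring_mul; [exact: fun_ring_cst|exact: fun_ring_mul]. Qed.

Let w01 y : is_derive y 1 w0 (w1 y).
Proof.
have dU : is_derive y 1 (fun y => - ((2 * e)^-1 * oriented_integral ue y))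
    (- (2 * e)^-1 * ue y).
  have := is_derive1_scale (- (2 * e)^-1) (is_derive_oriented_integral y (cmoll lu)).
  by apply: is_derive1_ext => z; rewrite mulNr.
have := is_derive1_chain (g := fun y => - ((2 * e)^-1 * oriented_integral ue y))
  (is_derive_expR _) dU.
by move=> h; apply: is_derive_eq h _; rewrite /w1 /w0; ring.
Qed.

Let p0 y := Pe y * w0 y.

Let dp0 : data p0. Proof. exact: fun_ring_mul. Qed.

Let Q x t := (heat_t w0 x t)^-1.
Let E t := expR (- (a * t)).

(** The Hopf-Cole formula u = - 2 e e^(-a t) W_x / W, where W is [heat_t w0]. *)
Definition u_smooth x t := - 2 * e * E t * (heat_t w1 x t * Q x t).
Definition V_smooth x t := heat_t p0 x t * Q x t.

Lemma solution_u_smooth : solution_class u_smooth.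
Proof.
apply: solution_mul; last by apply: solution_mul; [exact: solution_heat|exact: solution_inv].
by apply: solution_mul; [exact: solution_cst|exact: solution_exp].
Qed.

Lemma solution_V_smooth : solution_class V_smooth.
Proof. by apply: solution_mul; [exact: solution_heat|exact: solution_inv]. Qed.

Lemma u_epsE x t : 0 < t -> u_eps a ue e x t = u_smooth x t.
Proof.
move=> t0; have s0 := sigma_gt0 t0; have T0 := tau_gt0 a0 t0.
rewrite /u_eps integral_weight1//.
have H0 := heat_w0_gt0 x t.
have [_ iz] := integrable_heat x (sigma t) (data_continuous dw0) (data_growth dw0).
have eqz z : (x - (x + sigma t * z)) / tau a t * weight a ue e x t (x + sigma t * z) =
   - (sigma t / tau a t) * (z * w0 (x + sigma t * z) * expR (- z ^+ 2)).
  by rewrite weight_affine//; ring.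
have [|_ ->] := @Rintegral_affine_comp R (fun y => (x - y) / tau a t * weight a ue e x t y)
    x (sigma t) s0.
  have := integrableR_scale (- (sigma t / tau a t)) measurableT iz.
  by apply: eq_integrable => // z _ /=; rewrite eqz.
under eq_Rintegral do rewrite eqz.
rewrite RintegralZl//.
(* The slope (x - y) / tau has become a multiple of z, and integrating z against the Gaussian by
   parts turns [w0] into its derivative [w1]. *)
rewrite (heat_by_parts x (sigma t) (data_continuous dw0) (data_growth dw0) w01
  (data_continuous dw1) (data_growth dw1)) -/(heat_t w1 x t).
rewrite /u_smooth /Q -/(E t).
have -> : sigma t * (- (sigma t / tau a t) * (sigma t / 2 * heat_t w1 x t)) /
   (sigma t * heat_t w0 x t) = - (sigma t ^+ 2) / (2 * tau a t) * (heat_t w1 x t / heat_t w0 x t).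
  by field; rewrite !gt_eqF.
rewrite sigma_sqr ?ltW//; field.
by rewrite !gt_eqF.
Qed.

Lemma V_epsE x t : 0 < t -> V_eps a ue ve e x t = V_smooth x t.
Proof.
move=> t0; have s0 := sigma_gt0 t0; have H0 := heat_w0_gt0 x t.
rewrite /V_eps integral_weight1// (integral_weight x ddPe t0) /V_smooth /Q.
by rewrite /p0; field; rewrite !gt_eqF.
Qed.

(** At t = 0 the left-hand side is a limit, identified by the joint continuity of the members of the
    class. *)
Let extend0E (F G : R -> R -> R) x t : solution_class G ->
  (forall t, 0 < t -> F x t = G x t) -> 0 <= t -> extend0 F x t = G x t.
Proof.
move=> sG FG; rewrite le_eqVlt => /predU1P[<-|t0]; last by rewrite /extend0 t0 FG.
rewrite /extend0 ltxx; apply: cvg_lim => //.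
have [cG _ _] := solution_class_closed sG.
have h : G x s @[s --> (0 : R)^'+] --> G x 0.
  by apply: cvg_within_filter; have [cGx _] := continuous_section cG; exact: cGx.
apply: cvg_trans h; apply: near_eq_cvg; near=> s.
by rewrite FG//; near: s; exact: nbhs_right_gt.
Unshelve. all: end_near. Qed.

Lemma u_tildeE x t : 0 <= t -> u_tilde a u0 e x t = u_smooth x t.
Proof.
by move=> t0; apply: extend0E => //; [exact: solution_u_smooth|move=> s; exact: u_epsE].
Qed.

Lemma V_tildeE x t : 0 <= t -> V_tilde a u0 v0 e x t = V_smooth x t.
Proof.
by move=> t0; apply: extend0E => //; [exact: solution_V_smooth|move=> s; exact: V_epsE].
Qed.

Let is_derive_Q x t : is_derive x 1 (Q ^~ t) (- heat_t w1 x t * Q x t ^+ 2).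
Proof.
apply: (is_derive1_inv (f := heat_t w0 ^~ t)); first by rewrite gt_eqF.
exact: is_derive_heat_tx dw0 dw1 w01.
Qed.

Lemma mollified_smooth F G : solution_class F -> (forall x t, 0 <= t -> G x t = F x t) ->
  smooth_on (@half_line R) G.
Proof. by apply: smooth_on_half_line; exact: solution_class_closed. Qed.

Lemma V_smooth_derive : exists2 F, solution_class F &
  forall x t, is_derive x 1 (V_smooth ^~ t) (F x t).
Proof. by have [_ [F ? ?] _] := solution_class_closed solution_V_smooth; exists F. Qed.

Lemma smooth_u_tilde : smooth_on (@half_line R) (u_tilde a u0 e).
Proof. exact: (mollified_smooth solution_u_smooth u_tildeE). Qed.

Lemma dx_V_tildeE F x t : (forall x t, is_derive x 1 (V_smooth ^~ t) (F x t)) ->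
  0 <= t -> dx (V_tilde a u0 v0 e) x t = F x t.
Proof.
move=> dF t0; rewrite /dx.
have -> : (V_tilde a u0 v0 e) ^~ t = V_smooth ^~ t.
  by apply/funext => y; exact: V_tildeE.
exact: is_derive1_derive1.
Qed.

Lemma smooth_dx_V_tilde : smooth_on (@half_line R) (dx (V_tilde a u0 v0 e)).
Proof.
have [F sF dF] := V_smooth_derive; apply: (mollified_smooth sF) => x t t0.
exact: dx_V_tildeE.
Qed.

Let dt_tilde F F2 (G : R -> R -> R) x t : (forall x t, 0 <= t -> G x t = F x t) ->
  (forall t : R, 0 < t -> is_derive t 1 (F x) (F2 x t)) ->
  continuous (F x) -> continuous (F2 x) -> 0 <= t ->
  dt (@half_line R) G x t = F2 x t.
Proof.
move=> GF dF cF cF2 t0; rewrite /dt.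
suff [] : derivable_in (@half_line R) (G x) t /\ derive_in (@half_line R) (G x) t = F2 x t by [].
apply: derive_in_half_line => //.
apply: (@eq_cvg_increments _ (F x)) => //; first by move=> s s0; rewrite GF.
by apply: cvg_increments_half_line => //; apply: cvg_within_filter; [exact: cF|exact: cF2].
Qed.

Let continuous_Q x : continuous (Q x).
Proof.
have [cQ _ _] := solution_class_closed solution_inv.
by have [h _] := continuous_section (F := Q) cQ; exact: h.
Qed.

Let is_derive_Qt g g' x t : data g -> data g' ->
  (forall y : R, is_derive y 1 w0 (g y)) -> (forall y : R, is_derive y 1 g (g' y)) -> 0 < t ->
  is_derive t 1 (Q x) (- (e * E t * heat_t g' x t) * Q x t ^+ 2).
Proof.
move=> dg dg' h h' t0; apply: (is_derive1_inv (f := heat_t w0 x)); first by rewrite gt_eqF.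
exact: is_derive_heat_tt dw0 dg dg' h h' t0.
Qed.

(* The residual of the first equation is the viscous term [e E u_xx]. *)
Lemma u_tilde_residual : exists ux uxx : R -> R -> R,
  [/\ continuous (fun p : R * R => ux p.1 p.2), continuous (fun p : R * R => uxx p.1 p.2),
    forall x t, is_derive x 1 (u_smooth ^~ t) (ux x t),
    forall x t, is_derive x 1 (ux ^~ t) (uxx x t) &
    forall x t, 0 <= t -> dt (@half_line R) (u_tilde a u0 e) x t +
      u_tilde a u0 e x t * dx (u_tilde a u0 e) x t + a * u_tilde a u0 e x t =
      e * E t * uxx x t].
Proof.
have [_ [w2 dw2 w12]] := data_derive dw1; have [_ [w3 dw3 w23]] := data_derive dw2.
have [_ [ux sux dux] [ut sut dut]] := solution_class_closed solution_u_smooth.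
have [cux [uxx suxx duxx] _] := solution_class_closed sux.
have [cuxx _ _] := solution_class_closed suxx.
exists ux, uxx; split => //.
have uxE x t : ux x t = burgers_x (- 2 * e * E t) (heat_t w1 x t) (heat_t w2 x t) (Q x t).
  rewrite -(is_derive1_derive1 (dux x t)); apply: is_derive1_derive1.
  exact: (@is_derive_burgers R (heat_t w1 ^~ t) (Q ^~ t) x (- 2 * e * E t) (heat_t w2 x t)
    (is_derive_heat_tx x t dw1 dw2 w12) (is_derive_Q x t)).
have uxxE x t : uxx x t = burgers_xx (- 2 * e * E t) (heat_t w1 x t) (heat_t w2 x t)
    (heat_t w3 x t) (Q x t).
  rewrite -(is_derive1_derive1 (duxx x t)); apply: is_derive1_derive1.
  exact: (is_derive1_ext (f := fun y => burgers_x (- 2 * e * E t) (heat_t w1 y t)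
    (heat_t w2 y t) (Q y t)) (fun y => esym (uxE y t))
    (@is_derive_burgers_x R (heat_t w1 ^~ t) (heat_t w2 ^~ t) (Q ^~ t) x (- 2 * e * E t)
    (heat_t w3 x t) (is_derive_heat_tx x t dw1 dw2 w12)
    (is_derive_heat_tx x t dw2 dw3 w23) (is_derive_Q x t))).
pose ut' x t := burgers_t a e (E t) (heat_t w1 x t) (heat_t w2 x t) (heat_t w3 x t) (Q x t).
have dut' x t : 0 < t -> is_derive t 1 (u_smooth x) (ut' x t).
  move=> t0; exact: (@is_derive_burgers_t R (heat_t w1 x) (Q x) E t a e (heat_t w2 x t) (heat_t w3 x t)
    (is_derive_exp_at t)
    (is_derive_heat_tt x dw1 dw2 dw3 w12 w23 t0) (is_derive_Qt x dw1 dw2 w01 w12 t0)).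
have cut' x : continuous (ut' x).
  have ch g s : data g -> {for s, continuous (heat_t g x)}.
    by move=> dg; have [/continuous_section[h _] _ _] := solution_class_closed (solution_heat dg); exact: h.
  move=> s; apply: continuous_burgers_t; try exact: ch.
    exact: (is_derive1_continuous (is_derive_exp_at s)).
  exact: continuous_Q.
move=> x t t0.
have cu x' : continuous (u_smooth x').
  by have [/continuous_section[h _] _ _] := solution_class_closed solution_u_smooth; exact: h.
rewrite (dt_tilde u_tildeE (dut' x) (cu x) (cut' x) t0).
have -> : dx (u_tilde a u0 e) x t = ux x t.
  rewrite /dx; have -> : (u_tilde a u0 e) ^~ t = u_smooth ^~ t.
    by apply/funext => y; exact: u_tildeE.
  exact: is_derive1_derive1.
by rewrite u_tildeE// uxE uxxE /ut'; exact: burgers_identity.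
Qed.

(* Likewise for the second equation, with viscous term [e E v_xx]. *)
Lemma v_tilde_residual : exists vx vxx : R -> R -> R, let v := dx (V_tilde a u0 v0 e) in
  [/\ forall t, 0 <= t -> forall x, is_derive x 1 (V_smooth ^~ t) (v x t),
    forall t, 0 <= t -> forall x, is_derive x 1 (v ^~ t) (vx x t),
    forall t, 0 <= t -> forall x, is_derive x 1 (vx ^~ t) (vxx x t),
    continuous (fun p : R * R => vxx p.1 p.2) &
    forall x t, 0 <= t -> dt (@half_line R) v x t +
      dx (fun x t => u_tilde a u0 e x t * v x t) x t = e * E t * vxx x t].
Proof.
have [_ [w2 dw2 w12]] := data_derive dw1; have [_ [w3 dw3 w23]] := data_derive dw2.
have [_ [p1 dp1 p01]] := data_derive dp0.
have [_ [p2 dp2 p12]] := data_derive dp1; have [_ [p3 dp3 p23]] := data_derive dp2.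
have [_ [v sv dv] _] := solution_class_closed solution_V_smooth.
have [_ [vx svx dvx] _] := solution_class_closed sv.
have [_ [vxx svxx dvxx] _] := solution_class_closed svx.
have [cvxx _ _] := solution_class_closed svxx.
have vE x t : v x t = transport (heat_t p0 x t) (heat_t p1 x t) (heat_t w1 x t) (Q x t).
  rewrite -(is_derive1_derive1 (dv x t)); apply: is_derive1_derive1.
  exact: (is_derive1_mul (is_derive_heat_tx x t dp0 dp1 p01) (is_derive_Q x t)).
have vxE x t : vx x t = transport_x (heat_t p0 x t) (heat_t p1 x t) (heat_t p2 x t)
    (heat_t w1 x t) (heat_t w2 x t) (Q x t).
  rewrite -(is_derive1_derive1 (dvx x t)); apply: is_derive1_derive1.
  exact: (is_derive1_ext (f := fun y => transport (heat_t p0 y t) (heat_t p1 y t)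
    (heat_t w1 y t) (Q y t)) (fun y => esym (vE y t))
    (@is_derive_transport R (heat_t p0 ^~ t) (heat_t p1 ^~ t) (heat_t w1 ^~ t) (Q ^~ t) x
    (heat_t p2 x t) (heat_t w2 x t) (is_derive_heat_tx x t dp0 dp1 p01)
    (is_derive_heat_tx x t dp1 dp2 p12) (is_derive_heat_tx x t dw1 dw2 w12) (is_derive_Q x t))).
have vxxE x t : vxx x t = transport_xx (heat_t p0 x t) (heat_t p1 x t) (heat_t p2 x t)
    (heat_t p3 x t) (heat_t w1 x t) (heat_t w2 x t) (heat_t w3 x t) (Q x t).
  rewrite -(is_derive1_derive1 (dvxx x t)); apply: is_derive1_derive1.
  exact: (is_derive1_ext (f := fun y => transport_x (heat_t p0 y t) (heat_t p1 y t)
    (heat_t p2 y t) (heat_t w1 y t) (heat_t w2 y t) (Q y t)) (fun y => esym (vxE y t))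
    (@is_derive_transport_x R (heat_t p0 ^~ t) (heat_t p1 ^~ t) (heat_t p2 ^~ t)
    (heat_t w1 ^~ t) (heat_t w2 ^~ t) (Q ^~ t) x (heat_t p3 x t) (heat_t w3 x t)
    (is_derive_heat_tx x t dp0 dp1 p01)
    (is_derive_heat_tx x t dp1 dp2 p12) (is_derive_heat_tx x t dp2 dp3 p23)
    (is_derive_heat_tx x t dw1 dw2 w12) (is_derive_heat_tx x t dw2 dw3 w23) (is_derive_Q x t))).
have dVE x t : 0 <= t -> dx (V_tilde a u0 v0 e) x t = v x t by exact: dx_V_tildeE.
have dVE' t : 0 <= t -> (dx (V_tilde a u0 v0 e)) ^~ t = v ^~ t.
  by move=> t0; apply/funext => x; exact: dVE.
exists vx, vxx; split => //.
- by move=> t t0 x; rewrite dVE.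
- by move=> t t0 x; rewrite dVE'.
pose vt' x t := transport_t e (E t) (heat_t p0 x t) (heat_t p1 x t) (heat_t p2 x t)
    (heat_t p3 x t) (heat_t w1 x t) (heat_t w2 x t) (heat_t w3 x t) (Q x t).
have dvt' x t : 0 < t -> is_derive t 1 (v x) (vt' x t).
  move=> t0; exact: (is_derive1_ext (f := fun s => transport (heat_t p0 x s) (heat_t p1 x s)
    (heat_t w1 x s) (Q x s)) (fun s => esym (vE x s))
    (@is_derive_transport_t R (heat_t p0 x) (heat_t p1 x) (heat_t w1 x) (Q x) t e (E t)
    (heat_t p2 x t) (heat_t p3 x t) (heat_t w2 x t) (heat_t w3 x t) (is_derive_heat_tt x dp0 dp1 dp2 p01 p12 t0)
    (is_derive_heat_tt x dp1 dp2 dp3 p12 p23 t0)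
    (is_derive_heat_tt x dw1 dw2 dw3 w12 w23 t0) (is_derive_Qt x dw1 dw2 w01 w12 t0))).
have cvt' x : continuous (vt' x).
  have ch g s : data g -> {for s, continuous (heat_t g x)}.
    by move=> dg; have [/continuous_section[h _] _ _] := solution_class_closed (solution_heat dg); exact: h.
  move=> s; apply: continuous_transport_t; try exact: ch.
    exact: (is_derive1_continuous (is_derive_exp_at s)).
  exact: continuous_Q.
move=> x t t0.
have cv x' : continuous (v x').
  by have [/continuous_section[h _] _ _] := solution_class_closed sv; exact: h.
rewrite (dt_tilde dVE (dvt' x) (cv x) (cvt' x) t0).
have -> : dx (fun x t => u_tilde a u0 e x t * dx (V_tilde a u0 v0 e) x t) x t =
   burgers_x (- 2 * e * E t) (heat_t w1 x t) (heat_t w2 x t) (Q x t) * v x t +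
   u_smooth x t * vx x t.
  rewrite /dx -/(dx (V_tilde a u0 v0 e)).
  have -> : (fun y => u_tilde a u0 e y t * dx (V_tilde a u0 v0 e) y t) =
      (fun y => u_smooth y t * v y t).
    by apply/funext => y; rewrite u_tildeE// dVE.
  apply: is_derive1_derive1.
  exact: (@is_derive1_mul R (u_smooth ^~ t) (v ^~ t) x _ _
    (@is_derive_burgers R (heat_t w1 ^~ t) (Q ^~ t) x (- 2 * e * E t) (heat_t w2 x t)
      (is_derive_heat_tx x t dw1 dw2 w12) (is_derive_Q x t)) (dvx x t)).
by rewrite vE vxE vxxE /vt'; exact: transport_identity.
Qed.

Let sigma0 : sigma 0 = 0.
Proof. by rewrite /sigma tau0 mulr0 sqrtr0 mulr0. Qed.

(** At t = 0 the scale [sigma] vanishes and [heat] is the multiplication by sqrt(pi), which cancels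
    in the quotient. *)
Lemma u_tilde0 x : u_tilde a u0 e x 0 = ue x.
Proof.
rewrite u_tildeE// /u_smooth /Q /E /heat_t sigma0 !heat0.
have pi0 : 0 < Num.sqrt (pi : R) by rewrite sqrtr_gt0 pi_gt0.
have w0p : 0 < w0 x by exact: expR_gt0.
rewrite mulr0 oppr0 expR0 /w1; field.
by rewrite !gt_eqF.
Qed.

Lemma dx_V_tilde0 x : dx (V_tilde a u0 v0 e) x 0 = ve x.
Proof.
rewrite /dx; have -> : (V_tilde a u0 v0 e) ^~ 0 = Pe.
  apply/funext => y.
  rewrite V_tildeE// /V_smooth /Q /heat_t sigma0 !heat0 /p0.
  have pi0 : 0 < Num.sqrt (pi : R) by rewrite sqrtr_gt0 pi_gt0.
  have w0p : 0 < w0 y by exact: expR_gt0.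
  by field; rewrite !gt_eqF.
by apply: is_derive1_derive1; apply: is_derive_oriented_integral; exact: cmoll.
Qed.

(** Since w1 = - ue w0 / (2 e), the quotient W_x / W is at most M / (2 e) in absolute value, and the
    prefactor 2 e of [u_smooth] makes the bound independent of [e]. *)
Lemma u_smooth_bound (M : R) x t : (forall y, `|ue y| <= M) -> `|u_smooth x t| <= E t * M.
Proof.
move=> uM; have H0 := heat_w0_gt0 x t.
have : `|heat_t w1 x t| <= M / (2 * e) * heat_t w0 x t.
  apply: heat_le; try exact: data_continuous; try exact: data_growth.
  move=> y; have w0p : 0 < w0 y by exact: expR_gt0.
  have i0 : 0 < (2 * e)^-1 by rewrite invr_gt0 mulr_gt0.
  rewrite /w1 !normrM normrN (gtr0_norm w0p) (gtr0_norm i0) mulrA.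
  apply: ler_wpM2r; first exact: ltW.
  by rewrite mulrC; apply: ler_wpM2r; [exact: ltW|exact: uM].
rewrite -ler_pdivrMr// => h.
rewrite /u_smooth !normrM normrN (gtr0_norm e0) (gtr0_norm (expR_gt0 _)) normr_nat.
rewrite /Q normfV (gtr0_norm H0).
have -> : E t * M = 2 * e * E t * (M / (2 * e)) by field; rewrite gt_eqF.
by rewrite ler_wpM2l// !mulr_ge0 ?expR_ge0// ltW.
Qed.

Lemma V_smooth_bound (M : R) x t : (forall y, `|Pe y| <= M) -> `|V_smooth x t| <= M.
Proof.
move=> PM; have H0 := heat_w0_gt0 x t.
rewrite /V_smooth normrM /Q normfV (gtr0_norm H0) ler_pdivrMr//.
apply: heat_le; try exact: data_continuous; try exact: data_growth.
move=> y; have w0p : 0 < w0 y by exact: expR_gt0.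
by rewrite /p0 normrM (gtr0_norm w0p) ler_wpM2r// ltW.
Qed.

Lemma continuous_u_smooth : continuous (fun p : R * R => u_smooth p.1 p.2).
Proof. by have [] := solution_class_closed solution_u_smooth. Qed.

Lemma continuous_V_smooth : continuous (fun p : R * R => V_smooth p.1 p.2).
Proof. by have [] := solution_class_closed solution_V_smooth. Qed.

Lemma continuous_dx_V_smooth : exists2 F : R -> R -> R,
  continuous (fun p : R * R => F p.1 p.2) &
  forall x t, is_derive x 1 (V_smooth ^~ t) (F x t).
Proof. by have [F /solution_class_closed[? _ _] ?] := V_smooth_derive; exists F. Qed.

End mollified_solution.

Section bounded_functions.
Context {R : realType}.

Lemma bounded_compact_support (f : R -> R) (L : R) : continuous f ->
  (forall x, L < `|x| -> f x = 0) -> exists2 B : R, 0 < B & forall x : R, `|f x| <= B.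
Proof.
move=> cf fL; have cf' : {within `[- L, L], continuous f} by exact: continuous_subspaceT.
have [M [_ /(_ (`|M| + 1))]] := compact_bounded
  (continuous_compact cf' (@segment_compact R (- L) L)).
have M1 : M < `|M| + 1 by rewrite (le_lt_trans (ler_norm M))// ltrDl.
move=> /(_ M1) hM; exists (`|M| + 1); first by rewrite ltr_wpDl.
move=> x; have [xL|Lx] := leP `|x| L; last by rewrite fL// normr0 addr_ge0.
by apply: hM; exists x => //=; rewrite in_itv/= -ler_norml.
Qed.

Lemma near_right_mulr_lt (K d : R) : 0 <= K -> 0 < d -> \forall e \near 0^'+, e * K < d.
Proof.
move=> K0 d0; have K1 : 0 < K + 1 by rewrite ltr_wpDl.
have r0 : 0 < d / (K + 1) by rewrite divr_gt0.
near=> e.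
have e0 : 0 < e by near: e; exact: nbhs_right_gt.
have : e < d / (K + 1) by near: e; exact: nbhs_right_lt.
by rewrite ltr_pdivlMr//; apply: le_lt_trans; rewrite ler_wpM2l ?(ltW e0)// lerDl.
Unshelve. all: end_near. Qed.

Lemma continuous_mollify (f : R -> R) e : loc_integrable f -> 0 < e -> continuous (mollify f e).
Proof.
move=> lf e0; have kf : kernel e (friedrichs e) := kernel_friedrichs e.
have [k' kk' dk] := kernel_derive kf; move=> x.
have dc := is_derive_conv_kernel e0 x lf kf kk' dk.
by have := is_derive1_continuous dc.
Qed.

Lemma loc_integrable_mollify (f : R -> R) e : loc_integrable f -> 0 < e ->
  loc_integrable (mollify f e).
Proof.
move=> lf e0; have cm := continuous_mollify lf e0.
split; first exact: measurable_fun_continuous.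
move=> S; apply: continuous_compact_integrable; first exact: segment_compact.
exact: continuous_subspaceT.
Qed.

End bounded_functions.

(** * Residual estimates uniform in time *)

Section weak_asymptotics.
Context {R : realType}.
Notation mu := (@lebesgue_measure R).
Variables (a : R) (a0 : a != 0) (u0 v0 : R -> R) (M : R).
Hypotheses (mu0 : measurable_fun setT u0) (u0M : forall x, `|u0 x| <= M).
Hypothesis (iv0 : mu.-integrable setT (EFin \o v0)).

Let lu := loc_integrable_bounded mu0 u0M.
Let lv := loc_integrable_integrable iv0.
Let C := \int[mu]_s `|v0 s|.

Lemma bounded_conv_u0 (e : R) k : 0 < e -> kernel e k ->
  exists C : R, forall x, `|conv u0 k x| <= C.
Proof.
move=> e0 kk; have [B _ kB] := kernel_bounded e0 kk.
exists (M * B * (2 * e)) => x; apply: conv_bounded_Loo => //.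
  exact: measurable_fun_continuous (kernel_continuous kk).
exact: kernel_support e0 _ kk.
Qed.

Lemma bounded_conv_v0 (e : R) k : 0 < e -> kernel e k ->
  exists C : R, forall x, `|conv v0 k x| <= C.
Proof.
move=> e0 kk; have [B _ kB] := kernel_bounded e0 kk.
exists (B * C) => x; apply: conv_bounded_L1 => //.
exact: measurable_fun_continuous (kernel_continuous kk).
Qed.

Lemma mollify_u0_bound (e x : R) : 0 < e -> `|mollify u0 e x| <= M.
Proof. by move=> e0; exact: conv_friedrichs_bounded. Qed.

Lemma primitive_mollify_v0_bound (e y : R) : 0 < e ->
  `|oriented_integral (mollify v0 e) y| <= C.
Proof. by move=> e0; exact: oriented_integral_mollify_L1. Qed.

Let expR_le_horizon (t T : R) : 0 <= t <= T -> expR (- (a * t)) <= expR (`|a| * T).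
Proof.
move=> /andP[t0 tT]; rewrite ler_expR (le_trans (ler_norm _))// normrN normrM.
by rewrite (ger0_norm t0) ler_wpM2l.
Qed.

Lemma ler_Rintegral_test (f psi : R -> R) (B L : R) : continuous f -> continuous psi ->
  (forall x, L < `|x| -> psi x = 0) -> (forall x, `|f x| <= B) ->
  `|\int[mu]_x (f x * psi x)| <= B * \int[mu]_x `|psi x|.
Proof.
move=> cf cpsi psiL fB.
have ipsi := integrable_compact_support cpsi psiL.
rewrite -RintegralZl//; last exact: integrableR_norm.
apply: ler_Rintegral => //.
- by apply: measurable_fun_continuous => x; apply: cvgM; [exact: cf|exact: cpsi].
- by move=> x _; rewrite normrM ler_wpM2r.
- by apply: integrableR_scale => //; exact: integrableR_norm.
Qed.

Lemma u_tilde_weak (e t : R) phi : 0 < e -> 0 <= t -> test_function phi ->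
  `|\int[mu]_x ((dt (@half_line R) (u_tilde a u0 e) x t +
      u_tilde a u0 e x t * dx (u_tilde a u0 e) x t + a * u_tilde a u0 e x t) * phi x)| <=
  e * (expR (- (a * t)) * (expR (- (a * t)) * M * \int[mu]_x `|derive1n 2 phi x|)).
Proof.
move=> e0 t0 tphi; have [L L0 phiL] := test_function_support tphi.
have cphi := test_function_continuous tphi; have dphi := test_function_derive tphi.
have bu k := @bounded_conv_u0 e k e0; have bv k := @bounded_conv_v0 e k e0.
have [ux [uxx [cux cuxx dux duxx res]]] := u_tilde_residual a0 e0 lu lv bu bv.
have [_ cuxt] := continuous_section cux; have [_ cuxxt] := continuous_section cuxx.
have [_ cut] := continuous_section (continuous_u_smooth a0 e0 lu lv bu bv).
set E := expR _.
have -> : \int[mu]_x ((dt (@half_line R) (u_tilde a u0 e) x t +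
      u_tilde a u0 e x t * dx (u_tilde a u0 e) x t + a * u_tilde a u0 e x t) * phi x) =
    \int[mu]_x (e * E * (uxx x t * phi x)).
  by apply: eq_Rintegral => x _; rewrite res// mulrA.
rewrite RintegralZl//; last first.
  apply: (@integrable_compact_support _ _ L).
    by move=> x; apply: cvgM; [exact: cuxxt|exact: (cphi 0)].
  by move=> x /(phiL 0) h; rewrite [phi x]h mulr0.
rewrite (Rintegral_by_parts (cuxxt t) (fun x => duxx x t) (cphi 1) (dphi 0) (phiL 0) (phiL 1)).
rewrite (Rintegral_by_parts (cuxt t) (fun x => dux x t) (cphi 2) (dphi 1) (phiL 1) (phiL 2)).
rewrite opprK normrM normrM (gtr0_norm e0) (gtr0_norm (expR_gt0 _)) -mulrA.
rewrite ler_wpM2l ?(ltW e0)// ler_wpM2l ?expR_ge0//.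
apply: (ler_Rintegral_test (cut t) (cphi 2) (phiL 2)) => x.
by apply: (u_smooth_bound a e0 lu lv bu bv x t) => y; exact: mollify_u0_bound.
Qed.

Lemma v_tilde_weak (e t : R) phi : 0 < e -> 0 <= t -> test_function phi ->
  let v := dx (V_tilde a u0 v0 e) in
  `|\int[mu]_x ((dt (@half_line R) v x t +
      dx (fun x t => u_tilde a u0 e x t * v x t) x t) * phi x)| <=
  e * (expR (- (a * t)) * (C * \int[mu]_x `|derive1n 3 phi x|)).
Proof.
move=> e0 t0 tphi; set v := dx _; cbv zeta; have [L L0 phiL] := test_function_support tphi.
have cphi := test_function_continuous tphi; have dphi := test_function_derive tphi.
have bu k := @bounded_conv_u0 e k e0; have bv k := @bounded_conv_v0 e k e0.
have [vx [vxx [dV dv dvx cvxx res]]] := v_tilde_residual a0 e0 lu lv bu bv.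
have [_ cvxxt] := continuous_section cvxx.
have [_ cVt] := continuous_section (continuous_V_smooth a0 e0 lu lv bu bv).
have cvt : continuous (v ^~ t) by move=> x; exact: (is_derive1_continuous (dv t t0 x)).
have cvxt : continuous (vx ^~ t) by move=> x; exact: (is_derive1_continuous (dvx t t0 x)).
set E := expR _.
have -> : \int[mu]_x ((dt (@half_line R) v x t +
      dx (fun x t => u_tilde a u0 e x t * v x t) x t) * phi x) =
    \int[mu]_x (e * E * (vxx x t * phi x)).
  by apply: eq_Rintegral => x _; rewrite res// mulrA.
rewrite RintegralZl//; last first.
  apply: (@integrable_compact_support _ _ L).
    by move=> x; apply: cvgM; [exact: cvxxt|exact: (cphi 0)].
  by move=> x /(phiL 0) h; rewrite [phi x]h mulr0.
(* Three integrations by parts, one more than for u, because it is V and not v that is bounded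
   independently of [e]. *)
rewrite (Rintegral_by_parts (cvxxt t) (dvx t t0) (cphi 1) (dphi 0) (phiL 0) (phiL 1)).
rewrite (Rintegral_by_parts cvxt (dv t t0) (cphi 2) (dphi 1) (phiL 1) (phiL 2)) opprK.
rewrite (Rintegral_by_parts cvt (dV t t0) (cphi 3) (dphi 2) (phiL 2) (phiL 3)).
rewrite mulrN normrN normrM normrM (gtr0_norm e0) (gtr0_norm (expR_gt0 _)) -mulrA.
rewrite ler_wpM2l ?(ltW e0)// ler_wpM2l ?expR_ge0//.
apply: (ler_Rintegral_test (cVt t) (cphi 3) (phiL 3)) => x.
by apply: (V_smooth_bound a e0 lu lv bu bv x t) => y; exact: primitive_mollify_v0_bound.
Qed.

Lemma cvg_mollify_test (f phi : R -> R) : loc_integrable f -> test_function phi ->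
  \int[mu]_x ((mollify f e x - f x) * phi x) @[e --> 0^'+] --> (0 : R).
Proof.
move=> lf tphi; have [L L0 phiL] := test_function_support tphi.
have cphi := test_function_continuous tphi; have dphi := test_function_derive tphi.
have [K K0 dphiK] := bounded_compact_support (cphi 1) (phiL 1).
have lip x y : `|phi x - phi y| <= K * `|x - y|.
  exact: (lipschitz_of_derive y x (dphi 0) dphiK).
have := cvg_mollify lf (ltW K0) (cphi 0) lip (phiL 0) => h.
have : \int[mu]_x (mollify f e x * phi x) - \int[mu]_x (f x * phi x) @[e --> 0^'+] --> (0 : R).
  by have := cvgB h (cvg_cst (\int[mu]_x (f x * phi x))); rewrite subrr; exact.
apply: cvg_trans; apply: near_eq_cvg; near=> e.
have e0 : 0 < e by near: e; exact: nbhs_right_gt.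
have [B B0 phiB] := bounded_compact_support (cphi 0) (phiL 0).
have iphi (g : R -> R) : loc_integrable g -> mu.-integrable setT (EFin \o (fun x => g x * phi x)).
  move=> lg; have : mu.-integrable setT (EFin \o (fun s => restr g L s * phi s)).
    apply: (@integrable_mulr_bounded _ _ _ mu setT _ _ B) => //; first exact: integrable_restr.
    exact: measurable_fun_continuous (cphi 0).
  apply: eq_integrable => // s _ /=; rewrite restrE; case: ifPn => // sL.
  by have := phiL 0 s; rewrite /= => ->; rewrite ?mulr0// ltNge.
have lm := loc_integrable_mollify lf e0.
rewrite -RintegralB//; [|exact: iphi..].
by apply: eq_Rintegral => x _; rewrite mulrBl.
Unshelve. all: end_near. Qed.

Lemma weak_asymptotic_tilde :
  weak_asymptotic_solution a u0 v0 (u_tilde a u0) (fun e => dx (V_tilde a u0 v0 e)).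
Proof.
have M0 : 0 <= M by rewrite (le_trans _ (u0M 0)).
have C0 : 0 <= C by apply: Rintegral_ge0.
split.
- move=> e e0; have bu k := @bounded_conv_u0 e k e0; have bv k := @bounded_conv_v0 e k e0.
  by split; [exact: (smooth_u_tilde a0 e0 lu lv bu bv)|exact: (smooth_dx_V_tilde a0 e0 lu lv bu bv)].
- move=> phi T tphi T0 d d0.
  have I0 n : 0 <= \int[mu]_x `|derive1n n phi x| by apply: Rintegral_ge0.
  (* The constant is fixed before [e] and [t], which gives uniformity on [0, T]; e^(|a| T) bounds
     e^(-a t) for either sign of [a]. *)
  have [K2 K20 hu] : exists2 K : R, 0 <= K & forall e t, 0 < e -> 0 <= t <= T ->
    `|\int[mu]_x ((dt (@half_line R) (u_tilde a u0 e) x t +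
        u_tilde a u0 e x t * dx (u_tilde a u0 e) x t + a * u_tilde a u0 e x t) * phi x)| <=
      e * K.
    exists (expR (`|a| * T) * (expR (`|a| * T) * M * \int[mu]_x `|derive1n 2 phi x|)).
      exact: (mulr_ge0 (expR_ge0 _) (mulr_ge0 (mulr_ge0 (expR_ge0 _) M0) (I0 2))).
    move=> e t e0 tT; have t0 : 0 <= t by case/andP: tT.
    apply: (le_trans (u_tilde_weak e0 t0 tphi)); apply: (ler_wpM2l (ltW e0)).
    have EA := expR_le_horizon tT; have E0 := expR_ge0 (- (a * t)).
    exact: (ler_pM E0 (mulr_ge0 (mulr_ge0 E0 M0) (I0 2)) EA
      (ler_wpM2r (I0 2) (ler_wpM2r M0 EA))).
  have [K3 K30 hv] : exists2 K : R, 0 <= K & forall e t, 0 < e -> 0 <= t <= T ->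
    `|\int[mu]_x ((dt (@half_line R) (dx (V_tilde a u0 v0 e)) x t +
        dx (fun x t => u_tilde a u0 e x t * dx (V_tilde a u0 v0 e) x t) x t) * phi x)| <=
      e * K.
    exists (expR (`|a| * T) * (C * \int[mu]_x `|derive1n 3 phi x|)).
      exact: (mulr_ge0 (expR_ge0 _) (mulr_ge0 C0 (I0 3))).
    move=> e t e0 tT; have t0 : 0 <= t by case/andP: tT.
    apply: (le_trans (v_tilde_weak e0 t0 tphi)); apply: (ler_wpM2l (ltW e0)).
    exact: (ler_wpM2r (mulr_ge0 C0 (I0 3)) (expR_le_horizon tT)).
  near=> e => t tT; have e0 : 0 < e by near: e; exact: nbhs_right_gt.
  split.
    by apply: (le_lt_trans (hu e t e0 tT)); near: e; exact: (near_right_mulr_lt K20 d0).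
  by apply: (le_lt_trans (hv e t e0 tT)); near: e; exact: (near_right_mulr_lt K30 d0).
- move=> phi tphi; split.
    apply: cvg_trans (cvg_mollify_test lu tphi); apply: near_eq_cvg; near=> e.
    have e0 : 0 < e by near: e; exact: nbhs_right_gt.
    have bu k := @bounded_conv_u0 e k e0; have bv k := @bounded_conv_v0 e k e0.
    by apply: eq_Rintegral => x _; rewrite (@u_tilde0 R a a0 u0 v0 e e0 lu lv bu bv).
  apply: cvg_trans (cvg_mollify_test lv tphi); apply: near_eq_cvg; near=> e.
  have e0 : 0 < e by near: e; exact: nbhs_right_gt.
  have bu k := @bounded_conv_u0 e k e0; have bv k := @bounded_conv_v0 e k e0.
  by apply: eq_Rintegral => x _; rewrite dx_V_tilde0.
Unshelve. all: end_near. Qed.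

End weak_asymptotics.

(** * Minimizers *)

Section argmin.
Context {R : realType}.
Implicit Types (U : R -> R) (x y z r c M : R).

(** [theta] with the primitive of [u0] replaced by a function [U], of which only a Lipschitz bound
    will be used. *)
Definition parabola U r x y : R := (x - y) ^+ 2 / (2 * r) + U y.

Definition argmin U r x : set R := [set y | forall z, parabola U r x y <= parabola U r x z].

Definition argmin_max U r x : R := sup (argmin U r x).

(** Reflecting x and y exchanges the smallest and the largest minimizer; with this definition every
    statement on the latter yields one on the former. *)
Definition argmin_min U r x : R := - argmin_max (U \o -%R) r (- x).

Lemma parabolaN U r x y : parabola (U \o -%R) r (- x) (- y) = parabola U r x y.
Proof. by rewrite /parabola/= opprK; congr (_ / _ + _); ring. Qed.

Lemma argminN U r x y : argmin (U \o -%R) r (- x) (- y) = argmin U r x y.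
Proof.
apply/propext; split => h z; first by have := h (- z); rewrite !parabolaN.
by have := h (- z); rewrite -(parabolaN U r x (- z)) opprK -(parabolaN U r x y).
Qed.

Section lipschitz.
Variables (U : R -> R) (M r : R) (r0 : 0 < r).
Hypothesis UM : forall y z : R, `|U y - U z| <= M * `|y - z|.

Let M0 : 0 <= M.
Proof. by have := le_trans (normr_ge0 _) (UM 0 1); rewrite sub0r normrN1 mulr1. Qed.

Let UMN y z : `|(U \o -%R) y - (U \o -%R) z| <= M * `|y - z|.
Proof. by rewrite (le_trans (UM _ _))// -opprD normrN. Qed.

Lemma continuous_lipschitz : continuous U.
Proof.
move=> x; have M1 : 0 < M + 1 by rewrite ltr_wpDl.
apply/(@cvgrPdist_le _ R^o) => e e0.
have e1 : 0 < e / (M + 1) by rewrite divr_gt0.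
near=> y; apply: (le_trans (UM x y)).
have : `|x - y| <= e / (M + 1).
  by near: y; apply/nbhs_ballP; exists (e / (M + 1)) => // y; exact: ltW.
rewrite ler_pdivlMr// => h; rewrite (le_trans _ h)// mulrC ler_wpM2l// lerDl//.
Unshelve. all: end_near. Qed.

Lemma continuous_parabola x : continuous (parabola U r x).
Proof.
move=> y; apply: cvgD; last exact: continuous_lipschitz.
apply: cvgM; last exact: cvg_cst.
have h : (x - z) @[z --> y] --> x - y by apply: cvgB; [exact: cvg_cst|exact: cvg_id].
by apply: cvgM.
Qed.

Lemma parabolaB x y z : parabola U r x y - parabola U r x z =
  (y - z) * ((y - x) + (z - x)) / (2 * r) + (U y - U z).
Proof. by rewrite /parabola; field; rewrite gt_eqF. Qed.

(** Beyond x + M r the slope (y - x) / r of the quadratic part is at least M and outweighs the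
    Lipschitz function. *)
Lemma parabola_nd x y z : x + M * r <= z -> z <= y -> parabola U r x z <= parabola U r x y.
Proof.
move=> xz zy; rewrite -subr_ge0 parabolaB.
have h1 : - (M * (y - z)) <= U y - U z.
  have := UM y z; rewrite (ger0_norm (_ : 0 <= y - z)) ?subr_ge0//.
  by rewrite ler_norml => /andP[].
have h2 : M * (y - z) <= (y - z) * ((y - x) + (z - x)) / (2 * r).
  rewrite ler_pdivlMr; last by rewrite mulr_gt0.
  rewrite (mulrC M) -mulrA ler_wpM2l ?subr_ge0//; lra.
lra.
Qed.

(** Comparison with the competitor x gives (y - x)^2 / (2 r) <= M |y - x|. *)
Lemma argmin_dist x y : argmin U r x y -> `|x - y| <= 2 * (M * r).
Proof.
move=> /(_ x); rewrite -subr_le0 parabolaB addrC subrr addr0 -lerBrDl sub0r => h.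
have h1 := UM y x.
have h2 : (y - x) * (y - x) / (2 * r) <= M * `|y - x|.
  by apply: (le_trans h); rewrite (le_trans _ h1)// -normrN ler_norm.
have [->|xy] := eqVneq y x; first by rewrite subrr normr0 !mulr_ge0// ltW.
have n0 : 0 < `|y - x| by rewrite normr_gt0 subr_eq0.
move: h2; rewrite ler_pdivrMr ?mulr_gt0// -expr2 -real_normK ?num_real// expr2.
by rewrite mulrAC ler_pM2r// distrC => h2; rewrite (le_trans h2)//; lra.
Qed.

(** By [parabola_nd], minimizing over the segment from c to max(c, x + M r) is enough. *)
Lemma parabola_min_half_line x c :
  exists2 y, c <= y & forall z, c <= z -> parabola U r x y <= parabola U r x z.
Proof.
pose b := Num.max c (x + M * r).
have cb : c <= b by rewrite le_max lexx.
have [y] := EVT_min cb (continuous_subspaceT (@continuous_parabola x)).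
rewrite in_itv/= => /andP[cy yb] hy; exists y => // z cz.
have [zb|bz] := leP z b; first by apply: hy; rewrite in_itv/= cz.
apply: (le_trans (hy b _)); first by rewrite in_itv/= cb lexx.
by apply: parabola_nd (ltW bz); rewrite le_max lexx orbT.
Qed.

Lemma closed_argmin x : closed (argmin U r x).
Proof.
have -> : argmin U r x = \bigcap_z (parabola U r x @^-1` [set s | s <= parabola U r x z]).
  by apply/seteqP; split => [y h z _|y h z]; [exact: h|exact: h].
apply: closed_bigI => z _; apply: closed_comp; last exact: closed_le.
by move=> y _; exact: continuous_parabola.
Qed.

Lemma argmin_has_ubound x : has_ubound (argmin U r x).
Proof.
exists (x + 2 * (M * r)) => y /argmin_dist; rewrite ler_norml => /andP[h _]; lra.
Qed.

Lemma argmin_le_max x y : argmin U r x y -> y <= argmin_max U r x.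
Proof. by move=> h; apply: ub_le_sup => //; exact: argmin_has_ubound. Qed.

(** Adding the two minimality inequalities cancels [U] and leaves (z - x)(y - w) / r <= 0. Hence any
    minimizer at x lies below any minimizer at z. *)
Lemma argmin_nondecreasing x z y w : x < z -> argmin U r x y -> argmin U r z w -> y <= w.
Proof.
move=> xz /(_ w) hy /(_ y) hw; rewrite leNgt; apply/negP => wy.
have : (z - x) * (y - w) / r <= 0.
  have : (parabola U r x y - parabola U r x w) + (parabola U r z w - parabola U r z y) <= 0.
    by rewrite -(addr0 0) lerD// subr_le0.
  rewrite !parabolaB; apply: le_trans; rewrite le_eqVlt; apply/orP; left; apply/eqP.
  by field; rewrite gt_eqF.
by rewrite leNgt => /negP; apply; rewrite divr_gt0// mulr_gt0// subr_gt0.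
Qed.

(** The graph of [argmin] is closed: minimality is a family of large inequalities between continuous
    functions. *)
Lemma argmin_cvg (T : topologicalType) (F : set_system T) (FF : ProperFilter F) (xs ys : T -> R) x y :
  xs @ F --> x -> ys @ F --> y -> (\forall n \near F, argmin U r (xs n) (ys n)) ->
  argmin U r x y.
Proof.
move=> cx cy hF z.
have cp (w : T -> R) (l : R) : w @ F --> l ->
    parabola U r (xs n) (w n) @[n --> F] --> parabola U r x l.
  move=> cw; apply: cvgD; last by apply: (cvg_comp w U cw); exact: continuous_lipschitz.
  apply: cvgM; last exact: cvg_cst.
  have h : (xs n - w n) @[n --> F] --> x - l by exact: cvgB.
  by apply: cvgM.
have cz : (fun=> z : R) @ F --> z by exact: cvg_cst.
apply: (ler_cvg_to (cp _ _ cy) (cp _ _ cz)).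
by apply: filterS hF => n; apply.
Qed.

End lipschitz.

Section extremal_minimizers.
Variables (U : R -> R) (M r : R) (r0 : 0 < r).
Hypothesis UM : forall y z : R, `|U y - U z| <= M * `|y - z|.

Let UMN y z : `|(U \o -%R) y - (U \o -%R) z| <= M * `|y - z|.
Proof. by rewrite (le_trans (UM _ _))// -opprD normrN. Qed.

Lemma argmin_nonempty x : argmin U r x !=set0.
Proof.
have [y xy hy] := parabola_min_half_line r0 UM x x.
have [z xz hz] := parabola_min_half_line r0 UMN (- x) (- x).
have {}hz w : w <= x -> parabola U r x (- z) <= parabola U r x w.
  by move=> wx; have := hz (- w); rewrite lerN2 parabolaN -{1}(opprK z) parabolaN; apply.
have [yz|zy] := leP (parabola U r x y) (parabola U r x (- z)).
  exists y => w; have [xw|/ltW wx] := leP x w; first exact: hy.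
  by rewrite (le_trans yz)// hz.
exists (- z) => w; have [xw|/ltW wx] := leP x w; last exact: hz.
by rewrite (le_trans (ltW zy))// hy.
Qed.

Lemma argmin_argmin_max x : argmin U r x (argmin_max U r x).
Proof.
have h := closure_sup (argmin_nonempty x) (argmin_has_ubound r0 UM x).
by have /closure_id e := @closed_argmin U M r UM x; rewrite e.
Qed.

End extremal_minimizers.

Section extremal_minimizers_order.
Variables (U : R -> R) (M r : R) (r0 : 0 < r).
Hypothesis UM : forall y z : R, `|U y - U z| <= M * `|y - z|.

Let UMN y z : `|(U \o -%R) y - (U \o -%R) z| <= M * `|y - z|.
Proof. by rewrite (le_trans (UM _ _))// -opprD normrN. Qed.

Lemma argmin_argmin_min x : argmin U r x (argmin_min U r x).
Proof.
by rewrite -argminN opprK; exact: (argmin_argmin_max r0 UMN (- x)).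
Qed.

Lemma argmin_min_le x y : argmin U r x y -> argmin_min U r x <= y.
Proof. by rewrite -argminN lerNl; exact: argmin_le_max r0 UMN _ _. Qed.

Lemma argmin_min_le_max x : argmin_min U r x <= argmin_max U r x.
Proof. by apply: argmin_min_le; exact: (argmin_argmin_max r0 UM x). Qed.

Lemma argmin_max_nd : {homo argmin_max U r : x y / x <= y}.
Proof.
move=> x y; rewrite le_eqVlt => /predU1P[->//|xy].
exact: (argmin_nondecreasing r0 xy (argmin_argmin_max r0 UM x) (argmin_argmin_max r0 UM y)).
Qed.

(** The limit from the right exists by monotonicity. It is a minimizer at x because the graph is
    closed, hence it does not exceed the largest one. *)
Lemma argmin_max_right_continuous x : argmin_max U r z @[z --> x^'+] --> argmin_max U r x.
Proof.
set yp := argmin_max U r.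
have lb : has_lbound (yp @` [set` Interval (BRight x) (BInfty R false)]).
  exists (yp x) => _ [z /= xz <-]; apply: argmin_max_nd.
  by move: xz; rewrite in_itv/= andbT => /ltW.
have := @nondecreasing_at_right_cvgr R yp x (BInfty R false) isT (in2W argmin_max_nd) lb.
set l := inf _ => cl.
suff -> : yp x = l by [].
apply/eqP; rewrite eq_le; apply/andP; split.
  apply: lb_le_inf => [|_ [z /= xz <-]].
    by exists (yp (x + 1)); exists (x + 1) => //=; rewrite in_itv/= ltrDl ltr01.
  by apply: argmin_max_nd; move: xz; rewrite in_itv/= andbT => /ltW.
apply: (argmin_le_max r0 UM).
have cx : z @[z --> x^'+] --> x by apply: cvg_within_filter; exact: cvg_id.
apply: (argmin_cvg UM _ cx cl).
by near=> z; exact: (argmin_argmin_max r0 UM z).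
Unshelve. all: end_near. Qed.

End extremal_minimizers_order.

Section irregular_points.
Variables (U : R -> R) (M r : R) (r0 : 0 < r).
Hypothesis UM : forall y z : R, `|U y - U z| <= M * `|y - z|.

Let UMN y z : `|(U \o -%R) y - (U \o -%R) z| <= M * `|y - z|.
Proof. by rewrite (le_trans (UM _ _))// -opprD normrN. Qed.

Lemma argmin_min_nd : {homo argmin_min U r : x y / x <= y}.
Proof.
move=> x y xy; rewrite lerN2; apply: (argmin_max_nd r0 UMN).
by rewrite lerN2.
Qed.

Lemma argmin_min_left_continuous x : argmin_min U r z @[z --> x^'-] --> argmin_min U r x.
Proof.
apply: cvgN; have := @argmin_max_right_continuous _ M r r0 UMN (- x).
by rewrite at_rightN.
Qed.

(** The gaps between smallest and largest minimizers are disjoint by monotonicity, and each contains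
    a rational number. *)
Lemma countable_irregular :
  countable [set x | argmin_min U r x < argmin_max U r x].
Proof.
have hq x : {q : rat | argmin_min U r x < argmin_max U r x ->
    argmin_min U r x < ratr q < argmin_max U r x}.
  have [h|_] := boolP (argmin_min U r x < argmin_max U r x); last by exists 0.
  apply: cid; have [q qi] := rat_in_itvoo h; exists q => _.
  by move: qi; rewrite in_itv.
apply/countable_injP; exists (fun x => pickle (sval (hq x))) => x y /set_mem/= hx /set_mem/= hy.
move=> /(pcan_inj pickleK) e.
have /andP[x1 x2] := svalP (hq x) hx; have /andP[y1 y2] := svalP (hq y) hy.
apply/eqP; rewrite eq_le !leNgt; apply/andP; split; apply/negP => lt.
  have := argmin_nondecreasing r0 lt (argmin_argmin_max r0 UM y) (argmin_argmin_min r0 UM x).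
  by rewrite leNgt (lt_trans x1)// e.
have := argmin_nondecreasing r0 lt (argmin_argmin_max r0 UM x) (argmin_argmin_min r0 UM y).
by rewrite leNgt (lt_trans y1)// -e.
Qed.

(* A countable combination of comparisons between continuous functions of [x] and
   [r], which yields joint measurability. *)
Lemma argmin_max_ltP x c : argmin_max U r x < c <->
  exists q n, forall p : rat, c <= ratr p ->
    (x - ratr q) ^+ 2 + 2 * r * (U (ratr q) + n.+1%:R^-1) <=
    (x - ratr p) ^+ 2 + 2 * r * U (ratr p).
Proof.
have r20 : 0 < 2 * r by rewrite mulr_gt0.
have E (q p : R) n : ((x - q) ^+ 2 + 2 * r * (U q + n.+1%:R^-1) <=
    (x - p) ^+ 2 + 2 * r * U p) =
    (parabola U r x q + n.+1%:R^-1 <= parabola U r x p).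
  rewrite -[RHS](ler_pM2l r20) /parabola; set k := n.+1%:R^-1.
  by congr (_ <= _); field; rewrite gt_eqF.
have cp := @continuous_parabola U M r UM x.
split=> [hc|[q [n h]]].
  have [y cy hy] := parabola_min_half_line r0 UM x c.
  set f := parabola U r x in E cp hy *; set y0 := argmin_max U r x in hc *.
  (* Otherwise [y >= c] would be a minimizer larger than [y0]. The gap in value leaves room for a
     rational [q] near [y0] and for a margin 1 / (n + 1). *)
  have lt : f y0 < f y.
    rewrite lt_neqAle (argmin_argmin_max r0 UM x y) andbT; apply: contraTneq hc => e.
    rewrite -leNgt (le_trans cy)//; apply: (argmin_le_max r0 UM) => z.
    by rewrite -/f -e; exact: (argmin_argmin_max r0 UM x z).
  have d0 : 0 < (f y - f y0) / 2 by rewrite divr_gt0// subr_gt0.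
  have [n _ hn] := near_infty_natSinv_lt (PosNum d0).
  have /cvgrPdist_lt/(_ _ d0)[e /= e0 he] := cp y0.
  have [q] := @rat_in_itvoo R y0 (y0 + e) ltac:(by rewrite ltrDl).
  rewrite in_itv/= => /andP[q1 q2]; exists q, n => p cp'; rewrite E.
  have h1 : `|f y0 - f (ratr q)| < (f y - f y0) / 2.
    by apply: he; rewrite /= ltr_norml; apply/andP; split; lra.
  have h2 : n.+1%:R^-1 < (f y - f y0) / 2 := hn n (leqnn n); have h3 := hy _ cp'.
  move: h1 h2; rewrite ltr_norml => /andP[h1 _]; set k := _^-1; move: k => k h2; lra.
rewrite ltNge; apply/negP => cy.
set y0 := argmin_max U r x in cy *.
suff : parabola U r x (ratr q) + n.+1%:R^-1 <= parabola U r x y0.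
  move=> h'; have := argmin_argmin_max r0 UM x (ratr q); rewrite -/y0.
  have : (0 : R) < n.+1%:R^-1 by rewrite invr_gt0.
  by move: h'; set k := _^-1; move: k => k; lra.
(* The limit is taken from the right so that rationals close to [y0 >= c] still satisfy the
   condition [c <= ratr p]. *)
have cr : parabola U r x z @[z --> y0^'+] --> parabola U r x y0.
  by apply: cvg_within_filter; exact: cp.
rewrite leNgt; apply/negP => lt.
move/cvgrPdist_lt : cr => /(_ _ (ltac:(by rewrite subr_gt0) : 0 <
  parabola U r x (ratr q) + n.+1%:R^-1 - parabola U r x y0)).
move=> [e /= e0 he].
have [p] := @rat_in_itvoo R y0 (y0 + e) ltac:(by rewrite ltrDl).
rewrite in_itv/= => /andP[q1 q2].
have := h p (le_trans cy (ltW q1)); rewrite E.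
have : `|y0 - ratr p| < e by rewrite ltr_norml; apply/andP; split; lra.
move=> /he/(_ q1) + h1; rewrite ltr_norml => /andP[+ _].
by move: h1; set k := _^-1; move: k => k; lra.
Qed.

End irregular_points.

End argmin.

(** * Laplace's method *)

Section laplace.
Context {R : realType}.
Notation mu := (@lebesgue_measure R).
Implicit Types (e y m d : R).
Variables (f g : R -> R) (y0 : R) (cf : continuous f).
Hypothesis fmin : forall rho : R, 0 < rho ->
  exists2 m : R, 0 < m & forall y : R, rho <= `|y - y0| -> f y0 + m <= f y.
Hypothesis ig : mu.-integrable setT (EFin \o (fun y => g y * expR (- (f y - f y0)))).
Hypothesis i1 : mu.-integrable setT (EFin \o (fun y => expR (- (f y - f y0)))).
Variables (h W : R -> R -> R) (c1 c2 l : R).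
Hypotheses (c10 : 0 < c1) (c20 : 0 < c2).
Hypothesis mh : forall e : R, 0 < e -> measurable_fun setT (h e).
Hypothesis mW : forall e : R, 0 < e -> measurable_fun setT (W e).
Hypothesis hg : forall e y : R, 0 < e -> `|h e y| <= g y.
Hypothesis W1 : forall e y : R, 0 < e -> c1 * expR (- (f y / (2 * e))) <= W e y.
Hypothesis W2 : forall e y : R, 0 < e -> W e y <= c2 * expR (- (f y / (2 * e))).
Hypothesis hl : forall d : R, 0 < d -> exists2 rho : R, 0 < rho &
  \forall e \near 0^'+, forall y, `|y - y0| <= rho -> `|h e y - l| <= d.

Let p (y : R) := f y - f y0.

Let p0 y : 0 <= p y.
Proof.
have [->|yy] := eqVneq y y0; first by rewrite /p subrr.
have n0 : 0 < `|y - y0| by rewrite normr_gt0 subr_eq0.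
by have [m m0 /(_ y (lexx _)) hm] := fmin n0; rewrite /p; lra.
Qed.

Let W0 e y : 0 < e -> 0 <= W e y.
Proof. by move=> e0; rewrite (le_trans _ (W1 y e0))// mulr_ge0 ?expR_ge0// ltW. Qed.

(* For [e <= 1/2], [p / (2 e) >= p + (1 / (2 e) - 1) m] as soon as [p >= m]. *)
Let W_far (e y m : R) : 0 < e -> e <= 2^-1 -> 0 <= m -> m <= p y ->
  W e y <= c2 * expR (- (f y0 / (2 * e))) * expR m * expR (- (m / (2 * e))) * expR (- p y).
Proof.
move=> e0 e2 m0 mp; apply: (le_trans (W2 y e0)).
rewrite -!mulrA ler_wpM2l ?(ltW c20)// -!expRD ler_expR.
have k0 : 1 <= (2 * e)^-1 by rewrite -[leLHS]invr1 lef_pV2 ?posrE ?mulr_gt0//; lra.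
have -> : f y = p y + f y0 by rewrite /p subrK.
set k := _^-1 in k0 *; have : 0 <= (k - 1) * (p y - m) by rewrite mulr_ge0 ?subr_ge0.
lra.
Qed.

Let W_le (e y : R) : 0 < e -> e <= 2^-1 ->
  W e y <= c2 * expR (- (f y0 / (2 * e))) * expR (- p y).
Proof.
move=> e0 e2; have := W_far e0 e2 (lexx 0) (p0 y).
by rewrite mul0r oppr0 expR0 !mulr1.
Qed.

Let integrable_W e : 0 < e -> e <= 2^-1 -> mu.-integrable setT (EFin \o W e).
Proof.
move=> e0 e2; apply: (@le_integrableR _ _ _ mu _ _
  (fun y => c2 * expR (- (f y0 / (2 * e))) * expR (- p y))) => //.
- exact: mW.
- by move=> y _; rewrite ger0_norm ?W0// W_le.
- exact: integrableR_scale.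
Qed.

Let g0 y : 0 <= g y.
Proof. exact: le_trans (normr_ge0 _) (hg y ltr01). Qed.

Let integrable_hW e : 0 < e -> e <= 2^-1 ->
  mu.-integrable setT (EFin \o (fun y => h e y * W e y)).
Proof.
move=> e0 e2; apply: (@le_integrableR _ _ _ mu _ _
  (fun y => c2 * expR (- (f y0 / (2 * e))) * (g y * expR (- p y)))) => //.
- by apply: measurable_funM; [exact: mh|exact: mW].
- move=> y _; rewrite normrM (ger0_norm (W0 _ _))// mulrCA ler_pM ?W0//; first exact: hg.
  exact: W_le.
- exact: integrableR_scale.
Qed.

(** The far part of the numerator is of order e^(-m/(2e)) relative to E = e^(-f(y0)/(2e)). The
    denominator is at least of order e^(-m/(4e)), relative to E too, as seen on a ball where f
    exceeds its minimum by at most m/2. The factor E cancels and the quotient tends to 0. *)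
Lemma cvg_laplace :
  (\int[mu]_y (h e y * W e y)) / (\int[mu]_y W e y) @[e --> 0^'+] --> l.
Proof.
apply/(@cvgrPdist_le _ R^o) => d d0; have d20 : 0 < d / 2 by rewrite divr_gt0.
have [rho rho0 hrho] := hl d20; have [m m0 fm] := fmin rho0.
have m20 : 0 < m / 2 by rewrite divr_gt0.
have [del del0 fdel] : exists2 del : R, 0 < del &
    forall y, `|y - y0| <= del -> f y <= f y0 + m / 2.
  have /cvgrPdist_le/(_ _ m20) := @cf y0; move=> /nbhs_ballP[e /= e0 he].
  exists (e / 2) => [|y hy]; first by rewrite divr_gt0.
  have : `|f y0 - f y| <= m / 2 by apply: he; rewrite /ball/= distrC; lra.
  by rewrite ler_norml => /andP[]; lra.
set gg := fun y => (g y + `|l|) * expR (- p y).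
have igg : mu.-integrable setT (EFin \o gg).
  have := integrableR_add measurableT ig (integrableR_scale `|l| measurableT i1).
  by apply: eq_integrable => // y _ /=; rewrite /gg mulrDl.
pose G := \int[mu]_y gg y.
have G0 : 0 <= G by apply: Rintegral_ge0 => // y _; rewrite mulr_ge0 ?expR_ge0// addr_ge0.
(* The condition e K < d c1 del on this constant K is what brings the far part below d/2 times the
   denominator, by means of q <= 4 e / m. *)
have K0 : 0 <= 4 * (c2 * expR m * G) / m.
  by apply: mulr_ge0; [rewrite !mulr_ge0 ?expR_ge0 ?(ltW c20)//|rewrite invr_ge0 ltW].
have T0 : 0 < d * (c1 * del) by rewrite !mulr_gt0.
have near1 := near_right_mulr_lt K0 T0.
have h2 : (0 : R) < 2^-1 by [].
have near2 : \forall e \near (0:R)^'+, e <= 2^-1 := nbhs_right_le h2.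
near=> e.
have e0 : 0 < e by near: e; exact: nbhs_right_gt.
have e2 : e <= 2^-1 by near: e; exact: near2.
have he : forall y, `|y - y0| <= rho -> `|h e y - l| <= d / 2 by near: e; exact: hrho.
have hK : e * (4 * (c2 * expR m * G) / m) < d * (c1 * del) by near: e; exact: near1.
set D := \int[mu]_y W e y; set N := \int[mu]_y (h e y * W e y).
have iW := integrable_W e0 e2; have ihW := integrable_hW e0 e2.
set E := expR (- (f y0 / (2 * e))); have E0 : 0 < E by exact: expR_gt0.
have E' : E = expR (- (f y0 / (2 * e))) by [].
(* The far part carries q^2 and the lower bound of the denominator carries q, so one factor q
   survives in the quotient. *)
set q := expR (- (m / (4 * e))).
have q0 : 0 < q by exact: expR_gt0.
have qq : expR (- (m / (2 * e))) = q * q by rewrite -expRD; congr expR; field; rewrite gt_eqF.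
have key : `|N - l * D| <= d / 2 * D + c2 * E * expR m * (q * q) * G.
  have -> : N - l * D = \int[mu]_y ((h e y - l) * W e y).
    rewrite -RintegralZl// -RintegralB//; last exact: integrableR_scale.
    by apply: eq_Rintegral => y _; rewrite mulrBl.
  have -> : d / 2 * D + c2 * E * expR m * (q * q) * G =
      \int[mu]_y (d / 2 * W e y + c2 * E * expR m * (q * q) * gg y).
    rewrite RintegralD//; [|exact: integrableR_scale..].
    by rewrite RintegralZl// RintegralZl.
  apply: ler_Rintegral => //.
  - apply: measurable_funM; last exact: mW.
    by apply: measurable_funB => //; exact: mh.
  - move=> y _; rewrite normrM (ger0_norm (W0 _ _))//.
    have gg0 : 0 <= gg y by rewrite mulr_ge0 ?expR_ge0// addr_ge0.
    have [yr|/ltW yr] := leP `|y - y0| rho.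
      apply: (le_trans (ler_wpM2r (W0 y e0) (he y yr))).
      rewrite lerDl; apply: mulr_ge0 => //.
      by rewrite !mulr_ge0 ?expR_ge0 ?(ltW c20) ?(ltW q0)// ltW.
    rewrite -[leLHS]add0r; apply: lerD; first by rewrite mulr_ge0 ?W0// ltW.
    rewrite /gg [leRHS]mulrCA; apply: ler_pM; rewrite ?W0//.
      by rewrite (le_trans (ler_normB _ _))// lerD2r hg.
    by rewrite -qq; apply: W_far => //; [exact: ltW|have := fm _ yr; rewrite /p; lra].
  - by apply: integrableR_add => //; exact: integrableR_scale.
have hD : c1 * (E * q) * (2 * del) <= D.
  have yd : y0 - del <= y0 + del by lra.
  have -> : 2 * del = \int[mu]_y \1_(`[y0 - del, y0 + del]) y.
    by rewrite Rintegral_indic_segment//; ring.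
  rewrite -RintegralZl//; last exact: integrable_indic_segment.
  apply: le_Rintegral => //.
    by apply: integrableR_scale => //; exact: integrable_indic_segment.
  move=> y _; rewrite indicE; have [yi|_] := boolP (y \in _); last by rewrite mulr0 W0.
  move: yi; rewrite inE/= in_itv/= mulr1 => /andP[y1 y2].
  have hy : f y <= f y0 + m / 2 by apply: fdel; rewrite ler_norml; lra.
  apply: le_trans (W1 y e0); rewrite ler_wpM2l ?(ltW c10)// -expRD ler_expR.
  rewrite -opprD lerN2 (_ : _ + _ = (f y0 + m / 2) / (2 * e)); last by field; rewrite gt_eqF.
  by rewrite ler_pM2r// invr_gt0 mulr_gt0.
have D0 : 0 < D by apply: lt_le_trans hD; rewrite !mulr_gt0.
have qe : q <= 4 * e / m.
  have x0 : 0 < m / (4 * e) by rewrite divr_gt0// mulr_gt0.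
  rewrite /q expRN -[leRHS]invrK lef_pV2 ?posrE ?expR_gt0 ?invr_gt0//; last first.
    by rewrite divr_gt0// mulr_gt0.
  by rewrite invf_div (le_trans _ (expR_ge1Dx _))// lerDr.
have hR : c2 * E * expR m * (q * q) * G <= d / 2 * D.
  apply: le_trans (ler_wpM2l (ltW d20) hD).
  have -> : c2 * E * expR m * (q * q) * G = E * q * (c2 * expR m * G * q) by ring.
  have -> : d / 2 * (c1 * (E * q) * (2 * del)) = E * q * (d * (c1 * del)) by field.
  rewrite ler_wpM2l ?mulr_ge0 ?(ltW E0) ?(ltW q0)//.
  apply: le_trans (ltW hK).
  have -> : e * (4 * (c2 * expR m * G) / m) = c2 * expR m * G * (4 * e / m) by ring.
  by rewrite ler_wpM2l// !mulr_ge0 ?expR_ge0 ?(ltW c20).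
rewrite distrC (_ : N / D - l = (N - l * D) / D); last by field; rewrite gt_eqF.
rewrite normrM (gtr0_norm (_ : 0 < D^-1)) ?invr_gt0// ler_pdivrMr//.
apply: (le_trans key); lra.
Unshelve. all: end_near. Qed.

End laplace.

Section laplace_parabola.
Context {R : realType}.
Notation mu := (@lebesgue_measure R).
Implicit Types (e y d : R).
Variables (U : R -> R) (M r x y0 : R) (r0 : 0 < r).
Hypothesis UM : forall y z : R, `|U y - U z| <= M * `|y - z|.
Hypothesis Uy0 : argmin U r x = [set y0].

Let UMN (y z : R) : `|(U \o -%R) y - (U \o -%R) z| <= M * `|y - z|.
Proof. by rewrite (le_trans (UM _ _))// -opprD normrN. Qed.

Let f := parabola U r x.

(** On each of the two half lines at distance [rho] from [y0] the minimum is attained, at a point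
    that is not a minimizer on the whole line. *)
Lemma parabola_separated (rho : R) : 0 < rho ->
  exists2 m : R, 0 < m & forall y : R, rho <= `|y - y0| -> f y0 + m <= f y.
Proof.
move=> rho0.
have hy0 : argmin U r x y0 by rewrite Uy0.
have gt y : y != y0 -> f y0 < f y.
  move=> yy; rewrite lt_neqAle (hy0 y) andbT; apply: contra yy => /eqP e.
  have : argmin U r x y by move=> z; rewrite -/f -e; exact: hy0.
  by rewrite Uy0 => ->.
have [z1 hz1 min1] := parabola_min_half_line r0 UM x (y0 + rho).
have [z2 hz2 min2] := parabola_min_half_line r0 UMN (- x) (- y0 + rho).
have {}min2 z : z <= y0 - rho -> f (- z2) <= f z.
  move=> zy; have := min2 (- z); rewrite /f -(parabolaN U r x (- z2)) opprK.
  by rewrite -(parabolaN U r x z); apply; lra.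
have g1 : f y0 < f z1 by apply: gt; rewrite gt_eqF//; lra.
have g2 : f y0 < f (- z2) by apply: gt; rewrite lt_eqF//; lra.
exists (Num.min (f z1 - f y0) (f (- z2) - f y0)); first by rewrite lt_min !subr_gt0 g1.
move=> y; rewrite -lerBrDl ge_min !lerD2r; rewrite ler_normr => /orP[h|h].
  by rewrite min1//; lra.
by rewrite min2 ?orbT//; lra.
Qed.

(** The Lipschitz bound on [U] costs a factor e^(M |x - y|), which the Gaussian absorbs. *)
Lemma integrable_parabola (C K : R) :
  mu.-integrable setT (EFin \o (fun y => C * expR (K * `|x - y|) * expR (- (f y - f y0)))).
Proof.
have r1 : 0 < (2 * r)^-1 by rewrite invr_gt0 mulr_gt0.
have := integrable_exp_gauss (K + M) r1 => /(integrable_affine (- x) (@ltr01 R)) h.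
apply: (@le_integrableR _ _ _ mu _ _ (fun y => `|C| * expR (f y0 - U x) *
    (expR ((K + M) * `|- x + 1 * y|) * expR (- ((2 * r)^-1 * (- x + 1 * y) ^+ 2))))) => //.
- have mf : measurable_fun setT f.
    exact: measurable_fun_continuous (@continuous_parabola R U M r UM x).
  by do ?mfun; exact: measurable_funB.
- move=> y _; rewrite !normrM !(ger0_norm (expR_ge0 _)) -!mulrA ler_wpM2l// -!expRD ler_expR.
  rewrite mul1r (addrC (- x)) (distrC x) /f /parabola -/f.
  have := UM x y; rewrite distrC => /(le_trans (ler_norm _)).
  rewrite (distrC x y) => hU.
  rewrite (_ : (x - y) ^+ 2 / (2 * r) = (2 * r)^-1 * (y - x) ^+ 2); last by rewrite mulrC; congr (_ * _); ring.
  lra.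
- exact: integrableR_scale.
Qed.

(** An error B e in [Ue] becomes at most B / 2 in the exponent, whence the constants e^(-B/2) and
    e^(B/2). The case Ue = U, B = 0 covers the unmollified formulas. *)
Lemma cvg_weighted_mean (Ue h : R -> R -> R) (B C l : R) :
  (forall e, 0 < e -> measurable_fun setT (Ue e)) ->
  (forall e y, 0 < e -> `|Ue e y - U y| <= B * e) ->
  (forall e, 0 < e -> measurable_fun setT (h e)) ->
  (forall e y, 0 < e -> `|h e y| <= C * expR `|x - y|) ->
  (forall d : R, 0 < d -> exists2 rho : R, 0 < rho &
    \forall e \near 0^'+, forall y, `|y - y0| <= rho -> `|h e y - l| <= d) ->
  (\int[mu]_y (h e y * expR (- (parabola (Ue e) r x y / (2 * e))))) /
  (\int[mu]_y expR (- (parabola (Ue e) r x y / (2 * e)))) @[e --> 0^'+] --> l.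
Proof.
move=> mU UB mh hC hl.
have cf : continuous f by exact: (@continuous_parabola R U M r UM x).
have E e y : 0 < e -> parabola (Ue e) r x y / (2 * e) =
    f y / (2 * e) + (Ue e y - U y) / (2 * e).
  by move=> e0; rewrite -mulrDl /f /parabola; congr (_ / _); ring.
have B2 e y : 0 < e -> `|(Ue e y - U y) / (2 * e)| <= B / 2.
  move=> e0; have e20 : 0 < 2 * e by rewrite mulr_gt0.
  rewrite normrM (gtr0_norm (_ : 0 < (2 * e)^-1)) ?invr_gt0// ler_pdivrMr//.
  by rewrite (le_trans (UB e y e0))// le_eqVlt; apply/orP; left; apply/eqP; field.
apply: (@cvg_laplace R f (fun y => C * expR `|x - y|) y0 cf parabola_separated
  _ _ h _ (expR (- (B / 2))) (expR (B / 2)) l (expR_gt0 _) (expR_gt0 _) mh _ hC _ _ hl).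
- have := integrable_parabola C 1; apply: eq_integrable => // y _ /=.
  by rewrite mul1r.
- have := integrable_parabola 1 0; apply: eq_integrable => // y _ /=.
  by rewrite mul0r expR0 !mul1r.
- move=> e e0; apply: measurable_fun_expR; apply: measurable_fun_opp.
  apply: measurable_funM => //; apply: measurable_funD; last exact: mU.
  by apply: measurable_funM => //; apply: measurable_funX; exact: measurable_funB.
- move=> e y e0; rewrite -expRD ler_expR E// opprD addrC lerD2l lerN2.
  by have := B2 e y e0; rewrite ler_norml => /andP[].
- move=> e y e0; rewrite -expRD ler_expR E// opprD addrC lerD2r lerNl.
  by have := B2 e y e0; rewrite ler_norml => /andP[].
Qed.

End laplace_parabola.

(** * Pointwise limits at the points with a unique minimizer *)

Section pointwise_limits.
Context {R : realType}.
Notation mu := (@lebesgue_measure R).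
Implicit Types (x y t e d : R).
Variables (a : R) (a0 : a != 0) (u0 v0 : R -> R) (M : R).
Hypotheses (mu0 : measurable_fun setT u0) (u0M : forall s : R, `|u0 s| <= M).
Hypothesis iv0 : mu.-integrable setT (EFin \o v0).

Let U := oriented_integral u0.
Let lu := loc_integrable_bounded mu0 u0M.
Let lv := loc_integrable_integrable iv0.

Lemma lipschitz_primitive (y z : R) : `|U y - U z| <= M * `|y - z|.
Proof. exact: oriented_integral_lip. Qed.

Lemma unique_minimizerE x (r y : R) : unique_minimizer u0 x r y <-> argmin U r x = [set y].
Proof.
split=> [[h1 h2]|e]; first by apply/seteqP; split => [z hz|z ->]; [exact: h2|exact: h1].
have hy : argmin U r x y by rewrite e.
by split=> [//|z hz]; have : argmin U r x z by []; rewrite e.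
Qed.

Lemma argmin_set1 x (r : R) : 0 < r -> argmin_min U r x = argmin_max U r x ->
  argmin U r x = [set argmin_max U r x].
Proof.
move=> r0 e; apply/seteqP; split => [y hy|y ->]; last exact: (argmin_argmin_max r0 lipschitz_primitive).
apply/eqP; rewrite /= eq_le (argmin_le_max r0 lipschitz_primitive)//= -e.
exact: (argmin_min_le r0 lipschitz_primitive).
Qed.

Lemma regular_pointsP x t : 0 < t -> regular_points a u0 t x <->
  argmin_min U (tau a t) x = argmin_max U (tau a t) x.
Proof.
move=> t0; have r0 := tau_gt0 a0 t0; split => [[y /unique_minimizerE e]|e].
  have := argmin_argmin_max r0 lipschitz_primitive x.
  by have := argmin_argmin_min r0 lipschitz_primitive x; rewrite e => -> ->.
by exists (argmin_max U (tau a t) x); apply/unique_minimizerE; exact: argmin_set1.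
Qed.

Lemma y_minE x t : 0 < t -> regular_points a u0 t x ->
  argmin U (tau a t) x = [set y_min a u0 x t] /\
  y_min a u0 x t = argmin_max U (tau a t) x.
Proof.
move=> t0 reg; have r0 := tau_gt0 a0 t0.
have e : argmin U (tau a t) x = [set y_min a u0 x t].
  apply/unique_minimizerE; rewrite /y_min /minimizer.
  exact: getPex.
split => //; have := argmin_argmin_max r0 lipschitz_primitive x.
by rewrite e => ->.
Qed.

Lemma countable_nonregular t : 0 < t -> countable (~` regular_points a u0 t).
Proof.
move=> t0; have r0 := tau_gt0 a0 t0.
apply: sub_countable (countable_irregular r0 lipschitz_primitive).
apply: subset_card_le => x /= h.
rewrite lt_neqAle (argmin_min_le_max r0 lipschitz_primitive) andbT.
by apply/eqP => e; apply: h; exact/regular_pointsP.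
Qed.

(** Two windows of width 2 e, over each of which |u0| has mass at most 2 M e. *)
Lemma primitive_mollify_dist e y : 0 < e ->
  `|oriented_integral (mollify u0 e) y - U y| <= 4 * M * e.
Proof.
move=> e0; have M0 : 0 <= M by rewrite (le_trans _ (u0M 0)).
have mn : measurable_fun setT (fun s => `|u0 s|) by exact: measurable_fun_norm.
have nM s : `| `|u0 s| | <= M by rewrite normr_id.
apply: (le_trans (oriented_integral_mollify_dist lu y e0)).
have h1 := le_trans (ler_norm _) (oriented_integral_lip e (- e) mn nM).
have h2 := le_trans (ler_norm _) (oriented_integral_lip (y + e) (y - e) mn nM).
apply: (le_trans (lerD h1 h2)).
rewrite !ger0_norm; [|lra..].
by rewrite le_eqVlt; apply/orP; left; apply/eqP; ring.
Qed.

Lemma primitive_mollify_near y d : 0 < d -> exists2 rho : R, 0 < rho &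
  \forall e \near 0^'+, forall z : R, `|z - y| <= rho ->
    `|oriented_integral (mollify v0 e) z - oriented_integral v0 y| <= d.
Proof.
(* Five errors of d / 8 occur: four values of the primitive [Q] at the ends of the windows, and one
   for the continuity of the primitive of [v0]. *)
move=> d0; have d8 : 0 < d / 8 by rewrite divr_gt0.
pose Q := oriented_integral (fun s => `|v0 s|).
have lQ := loc_integrable_norm lv.
have near_cont (f : R -> R) (z : R) : continuous f -> exists2 r : R, 0 < r &
    forall w, `|w - z| <= r -> `|f w - f z| <= d / 8.
  move=> cf; have /cvgrPdist_le/(_ _ d8) := @cf z; move=> /nbhs_ballP[r /= r0 hr].
  exists (r / 2) => [|w hw]; first by rewrite divr_gt0.
  by rewrite distrC; apply: hr; rewrite /ball/= distrC; lra.
have [r1 r10 h1] := near_cont _ y (continuous_oriented_integral lv).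
have [r2 r20 h2] := near_cont _ y (continuous_oriented_integral lQ).
have [r3 r30 h3] := near_cont _ 0 (continuous_oriented_integral lQ).
have r220 : 0 < r2 / 2 by rewrite divr_gt0.
exists (Num.min r1 (r2 / 2)); first by rewrite lt_min r10.
have nr2 : \forall e \near (0:R)^'+, e <= r2 / 2 := nbhs_right_le r220.
have nr3 : \forall e \near (0:R)^'+, e <= r3 := nbhs_right_le r30.
near=> e => z; rewrite le_min => /andP[z1 z2].
have e0 : 0 < e by near: e; exact: nbhs_right_gt.
have er2 : e <= r2 / 2 by near: e; exact: nr2.
have er3 : e <= r3 by near: e; exact: nr3.
have k1 := oriented_integral_mollify_dist lv z e0.
have k2 := h1 z z1.
have k3 : `|Q (z + e) - Q y| <= d / 8.
  by apply: h2; move: z2; rewrite !ler_norml; lra.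
have k4 : `|Q (z - e) - Q y| <= d / 8.
  by apply: h2; move: z2; rewrite !ler_norml; lra.
have k5 : `|Q e - Q 0| <= d / 8 by apply: h3; rewrite subr0 ger0_norm// ltW.
have k6 : `|Q (- e) - Q 0| <= d / 8.
  by apply: h3; rewrite subr0 normrN ger0_norm// ltW.
move: k1 k2 k3 k4 k5 k6; rewrite -/Q !ler_norml.
move: (Q _) (Q _) (Q _) (Q _) (Q _) (Q _) (oriented_integral _ _) (oriented_integral _ _)
  (oriented_integral _ _).
do 9!move=> ?; do 6!move=> /andP[? ?]; apply/andP; split; lra.
Unshelve. all: end_near. Qed.

Section weighted_means.
Variables (x t : R) (t0 : 0 < t) (reg : regular_points a u0 t x).

Let r0 := tau_gt0 a0 t0.
Let ymin := y_min a u0 x t.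
Let hy : argmin U (tau a t) x = [set ymin] := (y_minE t0 reg).1.

Let C := \int[mu]_s `|v0 s|.

Let bound_exp (c s y : R) : `|s| <= c -> `|s| <= c * expR `|x - y|.
Proof.
move=> sc; rewrite (le_trans sc)// ler_peMr ?(le_trans _ sc)//.
by rewrite (le_trans _ (expR_ge1Dx _))// lerDl.
Qed.

Let bound_slope y : `|(x - y) / tau a t| <= (tau a t)^-1 * expR `|x - y|.
Proof.
rewrite normrM (gtr0_norm (_ : 0 < (tau a t)^-1)) ?invr_gt0// mulrC.
rewrite ler_wpM2l ?invr_ge0 ?(ltW r0)//.
by rewrite (le_trans _ (expR_ge1Dx _))// lerDr.
Qed.

Let slope_near d : 0 < d -> exists2 rho : R, 0 < rho & \forall e \near (0 : R)^'+,
  forall y, `|y - ymin| <= rho -> `|(x - y) / tau a t - (x - ymin) / tau a t| <= d.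
Proof.
move=> d0; exists (d * tau a t); first by rewrite mulr_gt0.
apply: nearW => e y hyy.
have -> : (x - y) / tau a t - (x - ymin) / tau a t = (ymin - y) / tau a t by ring.
rewrite normrM (gtr0_norm (_ : 0 < (tau a t)^-1)) ?invr_gt0// ler_pdivrMr//.
by rewrite distrC.
Qed.

Let measurable_slope : measurable_fun setT (fun y => (x - y) / tau a t).
Proof. by apply: measurable_funM => //; exact: measurable_funB. Qed.

Lemma cvg_V_eps : V_eps a u0 v0 e x t @[e --> 0^'+] --> V_lim a u0 v0 x t.
Proof.
apply: (cvg_weighted_mean r0 lipschitz_primitive hy (Ue := fun=> U)
  (h := fun=> oriented_integral v0) (B := 0) (C := C)) => //.
- move=> e e0; apply: measurable_fun_continuous; exact: continuous_oriented_integral.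
- by move=> e y _; rewrite subrr normr0 mul0r.
- move=> e e0; apply: measurable_fun_continuous; exact: continuous_oriented_integral.
- by move=> e y _; apply: bound_exp; exact: oriented_integral_L1.
- move=> d d0; have cP := @continuous_oriented_integral R v0 lv ymin.
  move/cvgrPdist_le : cP => /(_ _ d0) /nbhs_ballP[rr /= rr0 hr].
  exists (rr / 2); first by rewrite divr_gt0.
  apply: nearW => e y hyy; rewrite distrC; apply: hr; rewrite /ball/= distrC.
  by rewrite -/ymin; lra.
Qed.

Lemma cvg_u_eps : u_eps a u0 e x t @[e --> 0^'+] --> u_lim a u0 x t.
Proof.
apply: cvgMr; apply: (cvg_weighted_mean r0 lipschitz_primitive hy (Ue := fun=> U)
  (h := fun=> fun y => (x - y) / tau a t) (B := 0) (C := (tau a t)^-1) _ _ _ _ slope_near) => //.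
- move=> e e0; apply: measurable_fun_continuous; exact: continuous_oriented_integral.
- by move=> e y _; rewrite subrr normr0 mul0r.
Qed.

Lemma cvg_V_tilde : V_tilde a u0 v0 e x t @[e --> 0^'+] --> V_lim a u0 v0 x t.
Proof.
rewrite /V_tilde /extend0 t0.
apply: (cvg_weighted_mean r0 lipschitz_primitive hy
  (Ue := fun e => oriented_integral (mollify u0 e))
  (h := fun e => oriented_integral (mollify v0 e)) (B := 4 * M) (C := C)) => //.
- move=> e e0; apply: measurable_fun_continuous; apply: continuous_oriented_integral.
  exact: loc_integrable_mollify.
- by move=> e y; exact: primitive_mollify_dist.
- move=> e e0; apply: measurable_fun_continuous; apply: continuous_oriented_integral.
  exact: loc_integrable_mollify.
- by move=> e y e0; apply: bound_exp; exact: oriented_integral_mollify_L1.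
- by move=> d; exact: primitive_mollify_near.
Qed.

Lemma cvg_u_tilde : u_tilde a u0 e x t @[e --> 0^'+] --> u_lim a u0 x t.
Proof.
rewrite /u_tilde /extend0 t0.
apply: cvgMr; apply: (cvg_weighted_mean r0 lipschitz_primitive hy
  (Ue := fun e => oriented_integral (mollify u0 e))
  (h := fun=> fun y => (x - y) / tau a t) (B := 4 * M) (C := (tau a t)^-1) _ _ _ _ slope_near) => //.
- move=> e e0; apply: measurable_fun_continuous; apply: continuous_oriented_integral.
  exact: loc_integrable_mollify.
- by move=> e y; exact: primitive_mollify_dist.
Qed.

End weighted_means.

End pointwise_limits.

(** * Distributional limits in the half plane *)

Section measurability_in_the_plane.
Context {R : realType}.

(** The product sigma-algebra is generated by rectangles; squares with rational centres and radii 1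
    / (n + 1) write an open set as a countable union of them. *)
Lemma open_measurable_plane (A : set (R * R)) : open A -> measurable A.
Proof.
move=> oA.
have -> : A = \bigcup_(n : nat) \bigcup_(q : rat) \bigcup_(r : rat)
    [set p | ball (ratr q : R) n.+1%:R^-1 `*` ball (ratr r : R) n.+1%:R^-1 `<=` A /\
             (ball (ratr q : R) n.+1%:R^-1 `*` ball (ratr r : R) n.+1%:R^-1) p].
  apply/seteqP; split => [p Ap|p [n _ [q _ [r _ []]]]]; last exact.
  have /nbhs_ballP[d /= d0 dA] := oA p Ap.
  have d20 : 0 < d / 2 by rewrite divr_gt0.
  have [n _ hn] := near_infty_natSinv_lt (PosNum d20).
  have {}hn : n.+1%:R^-1 < d / 2 := hn n (leqnn n).
  have n0 : 0 < n.+1%:R^-1 :> R by rewrite invr_gt0.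
  have dense (z : R) : exists q : rat, ball (ratr q : R) n.+1%:R^-1 z.
    have [q] := @rat_in_itvoo R z (z + n.+1%:R^-1) ltac:(by rewrite ltrDl).
    rewrite in_itv/= => /andP[h1 h2]; exists q; rewrite /ball/= ltr_norml.
    by move: n0 h2; set k := _^-1; move: k => k n0 h2; apply/andP; split; lra.
  have [q hq] := dense p.1; have [r hr] := dense p.2.
  exists n => //; exists q => //; exists r => //; split => // z [/= z1 z2].
  apply: dA; split => /=.
    apply: (@le_ball _ _ _ (n.+1%:R^-1 + n.+1%:R^-1)); last exact: ball_triangle (ball_sym hq) z1.
    by rewrite (splitr d) lerD// ltW.
  apply: (@le_ball _ _ _ (n.+1%:R^-1 + n.+1%:R^-1)); last exact: ball_triangle (ball_sym hr) z2.
  by rewrite (splitr d) lerD// ltW.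
apply: bigcupT_measurable => n; apply: bigcupT_measurable_rat => q.
apply: bigcupT_measurable_rat => r.
have [h|h] := pselect (ball (ratr q : R) n.+1%:R^-1 `*` ball (ratr r : R) n.+1%:R^-1 `<=` A).
  rewrite (_ : [set _ | _] = ball (ratr q : R) n.+1%:R^-1 `*` ball (ratr r : R) n.+1%:R^-1).
    by apply: measurableX; exact: measurable_ball.
  by apply/seteqP; split => [p []//|p hp]; split.
rewrite (_ : [set _ | _] = set0)//.
by apply/seteqP; split => [p []//|].
Qed.

Lemma measurable_fun_continuous_plane (D : set (R * R)) (F : R * R -> R) : open D ->
  (forall p, D p -> {for p, continuous F}) -> measurable_fun D F.
Proof.
move=> oD cF.
apply: (measurability _ (RGenOInfty.measurableE R)) => _ [_ [c ->] <-].
apply: open_measurable_plane; rewrite openE => p [Dp /= hp].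
rewrite in_itv/= andbT in hp; rewrite /interior.
apply: filterI; first exact: oD.
have := cF p Dp; move=> /(_ `]c, +oo[%classic) h.
by apply: h; apply: open_nbhs_nbhs; split; [exact: interval_open|rewrite /= in_itv/= hp].
Qed.

End measurability_in_the_plane.

Section gaussian_convolution.
Context {R : realType}.
Notation mu := (@lebesgue_measure R).
Implicit Types (x y z s K S : R) (k : R -> R).
Variables (g : R -> R) (C K : R).
Hypotheses (mg : measurable_fun setT g) (gC : forall y : R, `|g y| <= C * expR (K * `|y|)).
Hypothesis K0 : 0 <= K.

(** Data that are not mollified cannot be differentiated, so here the x-derivative falls on the
    Gaussian: k = 1 gives the integrals in [V_eps], and k = id their derivatives up to the factor -
    2 / s. *)
Definition gauss_conv k x s : R := \int[mu]_y (g y * (k (x - y) * expR (- ((x - y) ^+ 2 / s)))).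

Let C0 : 0 <= C.
Proof. by have := le_trans (normr_ge0 _) (gC 0); rewrite normr0 mulr0 expR0 mulr1. Qed.

Let dom x0 S y : R := C * expR (K * `|x0| + 1 + S^-1) *
  (expR ((K + 1) * `|- x0 + 1 * y|) * expR (- ((2 * S)^-1 * (- x0 + 1 * y) ^+ 2))).

Let integrable_dom x0 S : 0 < S -> mu.-integrable setT (EFin \o dom x0 S).
Proof.
move=> S0; apply: integrableR_scale => //.
have S1 : 0 < (2 * S)^-1 by rewrite invr_gt0 mulr_gt0.
exact: (integrable_affine (- x0) (@ltr01 R) (integrable_exp_gauss (K + 1) S1)).
Qed.

(** One integrable bound for all x within 1 of [x0] and all s <= S. Halving the exponent of the
    Gaussian pays for moving its centre to [x0]. *)
Let le_dom k x0 x s S y : (forall z, `|k z| <= expR `|z|) -> `|x - x0| <= 1 -> 0 < s -> s <= S ->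
  `|g y * (k (x - y) * expR (- ((x - y) ^+ 2 / s)))| <= dom x0 S y.
Proof.
move=> kb xx0 s0 sS; have S0 : 0 < S by exact: lt_le_trans sS.
rewrite !normrM (ger0_norm (expR_ge0 _)).
have h1 : `|k (x - y)| * expR (- ((x - y) ^+ 2 / s)) <=
    expR `|x - y| * expR (- ((x - y) ^+ 2 / S)).
  apply: ler_pM => //; rewrite ?expR_ge0// ler_expR lerN2.
  by rewrite ler_wpM2l ?sqr_ge0// lef_pV2.
apply: (le_trans (ler_pM (normr_ge0 _) (mulr_ge0 (normr_ge0 _) (expR_ge0 _)) (gC y) h1)).
rewrite /dom -!mulrA ler_wpM2l// -!expRD ler_expR mul1r (addrC (- x0)).
have h2 : `|y| <= `|y - x0| + `|x0| := ler_norm_dist y x0.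
have h3 : `|x - y| <= `|y - x0| + 1.
  have := ler_normD (x - x0) (x0 - y).
  by rewrite addrA subrK (distrC x0 y) => /le_trans; apply; lra.
(* From (A + B)^2 <= 2 A^2 + 2 B^2, with y - x0 split at x. *)
have h4 : (y - x0) ^+ 2 / 2 - 1 <= (x - y) ^+ 2.
  have h5 : (x - x0) ^+ 2 <= 1.
    by rewrite -(real_normK (num_real _)) -[leRHS](expr1n _ 2) lerXn2r ?nnegrE.
  have : 0 <= ((x - y) + (x - x0)) ^+ 2 by exact: sqr_ge0.
  by nra.
have h6 : - ((x - y) ^+ 2 / S) <= S^-1 - (2 * S)^-1 * (y - x0) ^+ 2.
  rewrite (_ : S^-1 - (2 * S)^-1 * (y - x0) ^+ 2 = - (((y - x0) ^+ 2 / 2 - 1) / S)).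
    by rewrite lerN2 ler_pM2r ?invr_gt0.
  by field; rewrite gt_eqF.
have h7 : K * `|y| <= K * (`|y - x0| + `|x0|) by rewrite ler_wpM2l.
lra.
Qed.

Let mker k x s : continuous k ->
  measurable_fun setT (fun y => g y * (k (x - y) * expR (- ((x - y) ^+ 2 / s)))).
Proof.
move=> ck; have mxy : measurable_fun setT (fun y => x - y) by exact: measurable_funB.
apply: measurable_funM => //; apply: measurable_funM.
  exact: measurableT_comp (measurable_fun_continuous ck) mxy.
apply: measurable_fun_expR; apply: measurable_fun_opp; apply: measurable_funM => //.
exact: measurable_funX.
Qed.

Lemma integrable_gauss_conv k x s : continuous k -> (forall z, `|k z| <= expR `|z|) -> 0 < s ->
  mu.-integrable setT (EFin \o (fun y => g y * (k (x - y) * expR (- ((x - y) ^+ 2 / s))))).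
Proof.
move=> ck kb s0; apply: (@le_integrableR _ _ _ mu _ _ (dom x s)) => //; first exact: mker.
  by move=> y _; apply: le_dom => //; rewrite subrr normr0.
exact: integrable_dom.
Qed.

Lemma continuous_gauss_conv k x s : continuous k -> (forall z, `|k z| <= expR `|z|) -> 0 < s ->
  {for (x, s), continuous (fun p : R * R => gauss_conv k p.1 p.2)}.
Proof.
move=> ck kb s0.
pose D := [set p : R * R | ball x 1 p.1 /\ ball s s p.2].
have nD : nbhs (x, s) D.
  exists (ball x 1, ball s s) => /=; first by split; exact: nbhsx_ballx.
  by move=> p [].
have Dp p : D p -> [/\ `|p.1 - x| <= 1, 0 < p.2 & p.2 <= 2 * s].
  move=> [/= h1 h2]; split; first by rewrite distrC ltW.
    by move: h2; rewrite /ball/= ltr_norml; lra.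
  by move: h2; rewrite /ball/= ltr_norml; lra.
have s20 : 0 < 2 * s by rewrite mulr_gt0.
suff h : gauss_conv k p.1 p.2 @[p --> within D (nbhs (x, s))] --> gauss_conv k x s.
  by apply: cvg_trans h => A; rewrite /= !nbhs_simpl/= => h; apply: filterS2 nD h => p Dp1; exact.
apply: cvg_within_seqP => u Du cu.
have cu1 : (u n).1 @[n --> \oo] --> x by apply: (cvg_comp _ _ cu); exact: cvg_fst.
have cu2 : (u n).2 @[n --> \oo] --> s by apply: (cvg_comp _ _ cu); exact: cvg_snd.
apply: (@Rdominated_cvg _ _ _ mu setT _ _ (dom x (2 * s)) _ _ _ _ _).2 => //.
- by move=> n; exact: mker.
- move=> y _; apply: cvgMr.
  have c1 : (u n).1 - y @[n --> \oo] --> x - y by apply: cvgB => //; exact: cvg_cst.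
  apply: cvgM; first exact: (cvg_comp _ _ c1 (@ck (x - y))).
  have c2 : - (((u n).1 - y) ^+ 2 / (u n).2) @[n --> \oo] --> - ((x - y) ^+ 2 / s).
    apply: cvgN; apply: cvgM; first by apply: cvgM.
    by apply: cvgV => //; rewrite gt_eqF.
  exact: (cvg_comp _ _ c2 (@continuous_expR R _)).
- exact: integrable_dom.
- by move=> n y _; have [h1 h2 h3] := Dp _ (Du n); exact: le_dom.
Qed.

Lemma is_derive_gauss_conv x s : 0 < s ->
  is_derive x 1 (gauss_conv (fun=> 1) ^~ s) (- (2 / s) * gauss_conv id x s).
Proof.
move=> s0.
have k1 z : `|1 : R| <= expR `|z| by rewrite normr1 (le_trans _ (expR_ge1Dx _))// lerDl.
have kz z : `|id z| <= expR `|z| by rewrite (le_trans _ (expR_ge1Dx _))// lerDr.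
rewrite /gauss_conv -RintegralZl//; last first.
  by apply: (integrable_gauss_conv _ _ kz s0) => z; exact: cvg_id.
apply: (@is_derive_Rintegral R _ _ mu
  (fun x y => g y * (1 * expR (- ((x - y) ^+ 2 / s))))
  (fun x y => - (2 / s) * (g y * ((x - y) * expR (- ((x - y) ^+ 2 / s)))))
  (fun y => 2 / s * dom x s y) x 1 ltr01).
- by move=> z _; apply: (integrable_gauss_conv _ _ k1 s0) => w; exact: cvg_cst.
- move=> z y _.
  have d1 : is_derive z 1 (fun z : R => - ((z - y) ^+ 2 / s)) (- (2 / s) * (z - y)).
    by apply: is_derive_eq; rewrite /GRing.scale/=; ring.
  have d2 := @is_derive1_chain R expR (fun z => - ((z - y) ^+ 2 / s)) z _ _ (is_derive_expR _) d1.
  have d3 := is_derive1_scale (g y) d2.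
  rewrite (_ : (fun z0 => _) = (fun z => g y * expR (- ((z - y) ^+ 2 / s)))); last first.
    by apply/funext => w; rewrite mul1r.
  rewrite (_ : - (2 / s) * _ = g y * (expR (- ((z - y) ^+ 2 / s)) * (- (2 / s) * (z - y))))//.
  by ring.
- by apply: integrableR_scale => //; exact: integrable_dom.
- move=> z y zx; have s2 : 0 <= 2 / s by rewrite divr_ge0// ltW.
  rewrite normrM normrN (ger0_norm s2) ler_wpM2l//.
  by apply: (le_dom _ kz) => //; exact: ltW.
Qed.

End gaussian_convolution.

Lemma ae_sub d (T : measurableType d) (R : realType) (mu : {measure set T -> \bar R})
  (P Q : T -> Prop) : (forall x, P x -> Q x) -> {ae mu, forall x, P x} -> {ae mu, forall x, Q x}.
Proof. by move=> PQ; apply: filterS. Qed.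

Section half_plane.
Context {R : realType}.
Notation mu := (@lebesgue_measure R).
Notation mu2 := (mu \x mu)%E.
Implicit Types (L s B : R) (f psi : R -> R -> R) (F : R * R -> R).

Lemma open_half_plane : open (@half_plane R).
Proof.
rewrite (_ : half_plane = (@snd R R) @^-1` [set t | 0 < t])//.
by apply: open_comp => [p _|]; [exact: cvg_snd|exact: open_gt].
Qed.

Lemma measurable_half_plane : measurable (@half_plane R).
Proof. by apply: open_measurable_plane; exact: open_half_plane. Qed.

(** Every compact subset of the open half plane lies in such a box with s > 0; time is bounded away
    from 0 there. *)
Definition box L s : set (R * R) := `[- L, L]%classic `*` `[s, L]%classic.

Lemma compact_in_box (K : set (R * R)) : compact K -> K `<=` half_plane ->
  exists L s, [/\ 0 < L, 0 < s & K `<=` box L s].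
Proof.
move=> cK KH; have [K0|K0] := eqVneq K set0.
  by exists 1, 1; split => // p; rewrite K0.
have {}K0 : K !=set0 by exact/set0P.
have c1 : continuous (fun p : R * R => `|p.1| + `|p.2|).
  move=> p; apply: cvgD; (apply: cvg_norm; first [exact: cvg_fst|exact: cvg_snd]).
have c2 : continuous (fun p : R * R => p.2) by move=> p; exact: cvg_snd.
have [p1 _ h1] := compact_EVT_max K0 cK (continuous_subspaceT c1).
have [p2 p2K h2] := compact_EVT_min K0 cK (continuous_subspaceT c2).
exists (`|p1.1| + `|p1.2| + 1), p2.2; split.
- by rewrite ltr_wpDl// addr_ge0.
- by apply: KH; rewrite inE in p2K.
- move=> p Kp; have := h1 p; rewrite inE => /(_ Kp) k1.
  have := h2 p; rewrite inE => /(_ Kp) k2.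
  have := ler_norm p.2; have := normr_ge0 p.1; have := normr_ge0 p.2 => n2 n1 n3.
  by split => /=; rewrite in_itv/= -?ler_norml ?k2/=; lra.
Qed.

Lemma integrable_box L s : mu2.-integrable setT (EFin \o \1_(box L s)).
Proof.
have := integrable_prod_mul (integrable_indic_segment (- L) L) (integrable_indic_segment s L).
apply: eq_integrable => // p _ /=; rewrite !indicE -natrM mulnb; congr ((nat_of_bool _)%:R%:E).
by rewrite in_setX.
Qed.

Definition box_volume L s : R := \int[mu2]_(p in half_plane) \1_(box L s) p.

Section bounded_on_a_box.
Variables (L s B : R) (F : R * R -> R).
Hypothesis mF : measurable_fun half_plane F.
Hypothesis F0 : forall p, ~ box L s p -> F p = 0.
Hypothesis FB : forall p, half_plane p -> box L s p -> `|F p| <= B.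

Let FB1 p : half_plane p -> `|F p| <= B * \1_(box L s) p.
Proof.
move=> hp; rewrite indicE; have [h|h] := boolP (p \in box L s).
  by rewrite mulr1; apply: FB => //; rewrite inE in h.
by rewrite mulr0 F0 ?normr0// => hb; move/negP: h; apply; rewrite inE.
Qed.

Let ibox : mu2.-integrable half_plane (EFin \o (fun p => B * \1_(box L s) p)).
Proof.
apply: integrableR_scale; first exact: measurable_half_plane.
apply: (integrableS measurableT) => //; [exact: measurable_half_plane|exact: integrable_box].
Qed.

Lemma integrable_half_plane : mu2.-integrable half_plane (EFin \o F).
Proof. by apply: le_integrableR ibox; [exact: measurable_half_plane|exact: mF|exact: FB1]. Qed.

Lemma ler_Rintegral_half_plane :
  `|\int[mu2]_(p in half_plane) F p| <= box_volume L s * B.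
Proof.
rewrite mulrC /box_volume -RintegralZl; last 2 first.
- exact: measurable_half_plane.
- by apply: (integrableS measurableT) => //; [exact: measurable_half_plane|exact: integrable_box].
by apply: ler_Rintegral ibox; [exact: measurable_half_plane|exact: mF|exact: FB1].
Qed.

Hypothesis s0 : 0 < s.

Let mFT : measurable_fun setT F.
Proof.
have := (measurable_restrictT F measurable_half_plane).1 mF.
rewrite (_ : F \_ half_plane = F)//; apply/funext => p; rewrite /patch.
case: ifPn => // hp; rewrite F0// => -[_ /=]; rewrite in_itv/= => /andP[sp _].
by move/negP: hp; apply; rewrite inE /half_plane/=; exact: lt_le_trans sp.
Qed.

(** [F] vanishes below t = s > 0, so its restriction to the half plane is [F] itself and Fubini's
    theorem applies on the whole plane. *)
Lemma Rintegral_half_plane :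
  \int[mu2]_(p in half_plane) F p = \int[mu]_(t in `]0, +oo[) \int[mu]_x F (x, t).
Proof.
have Fs x t : t <= 0 -> F (x, t) = 0.
  move=> t0; apply: F0 => -[_ /=]; rewrite in_itv/= => /andP[sp _].
  by have := lt_le_trans s0 sp; rewrite ltNge t0.
have EF : F \_ half_plane = F.
  apply/funext => -[x t]; rewrite /patch; case: ifPn => // hp; rewrite Fs// leNgt.
  by apply/negP => t0; move/negP: hp; apply; rewrite inE.
have iF : mu2.-integrable setT (EFin \o F).
  have := (@integrable_mkcond _ _ _ mu2 half_plane _ measurable_half_plane).1 integrable_half_plane.
  by rewrite restrict_EFin EF.
have B0 : 0 <= `|B| by [].
rewrite Rintegral_mkcond EF -(Rintegral_prod2 iF); last first.
  move=> t; apply: (@le_integrableR _ _ _ mu _ _ (fun x => `|B| * \1_(`[- L, L]) x)) => //.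
  - by apply: (measurableT_comp mFT); exact: measurable_pair2.
  - move=> x _; have [tx|tx] := pselect (box L s (x, t)); last first.
      by rewrite F0// normr0 mulr_ge0// indicE.
    have t0 : half_plane (x, t).
      by case: tx => _ /=; rewrite in_itv/= => /andP[+ _]; exact: lt_le_trans.
    apply: (le_trans (FB t0 tx)); case: tx => /= tx _.
    by rewrite indicE mem_set// mulr1 ler_norm.
  - by apply: integrableR_scale => //; exact: integrable_indic_segment.
rewrite [in RHS]Rintegral_mkcond; apply: eq_Rintegral => t _; rewrite /patch.
case: ifPn => // ht; under eq_Rintegral => x _.
  rewrite Fs; last by move/negP: ht => ht; rewrite leNgt; apply/negP => t0; apply: ht; rewrite inE/= in_itv/= t0.
  over.
by rewrite /Rintegral integral0.
Qed.

End bounded_on_a_box.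

Lemma cvg_regular_distribution (f_ : R -> R -> R -> R) f psi L s B B' :
  (forall e, 0 < e -> measurable_fun half_plane (fun p : R * R => f_ e p.1 p.2)) ->
  measurable_fun half_plane (fun p : R * R => f p.1 p.2) ->
  measurable_fun half_plane (fun p : R * R => psi p.1 p.2) ->
  (forall x t, ~ box L s (x, t) -> psi x t = 0) ->
  (forall x t, `|psi x t| <= B') ->
  (forall e x t, 0 < e -> 0 < t -> box L s (x, t) -> `|f_ e x t| <= B) ->
  {ae mu2, forall p, half_plane p -> f_ e p.1 p.2 @[e --> 0^'+] --> f p.1 p.2} ->
  regular_distribution (f_ e) psi @[e --> 0^'+] --> regular_distribution f psi.
Proof.
move=> mf_ mf mpsi psi0 psiB fB fae; apply/cvg_at_rightP => u [u0 cu].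
have B0 : 0 <= B' by exact: le_trans (normr_ge0 _) (psiB 0 0).
apply: (@Rdominated_cvg_ae _ _ _ mu2 half_plane _ _ (fun p => B * B' * \1_(box L s) p) _ _ _ _ _ _).2.
- exact: measurable_half_plane.
- by move=> n; apply: measurable_funM => //; exact: mf_.
- exact: measurable_funM.
- apply: (@ae_sub _ _ _ mu2 _ _ _ fae) => p fp hp; apply: cvgMl.
  exact: ((cvg_at_rightP _ _ _).1 (fp hp) u (conj u0 cu)).
- apply: integrableR_scale; first exact: measurable_half_plane.
  by apply: (integrableS measurableT) => //; [exact: measurable_half_plane|exact: integrable_box].
- move=> n [x t] hp /=; rewrite indicE; have [h|h] := boolP ((x, t) \in box L s).
    by rewrite inE in h; rewrite mulr1 normrM ler_pM// fB.
  by rewrite mulr0 psi0 ?mulr0 ?normr0// => hb; move/negP: h; apply; rewrite inE.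
Qed.

End half_plane.

Section test_functions_in_the_plane.
Context {R : realType}.
Notation mu := (@lebesgue_measure R).
Notation mu2 := (mu \x mu)%E.
Variables (phi : R -> R -> R) (tphi : test_function2 phi).

Lemma test_function2_continuous : continuous (fun p : R * R => phi p.1 p.2).
Proof.
have [/(_ 0%N)[+ _] _] := tphi; rewrite setXTT => h p.
exact: ((continuous_subspace_setT _).2 h p).
Qed.

Lemma test_function2_dx : continuous (fun p : R * R => dx phi p.1 p.2).
Proof.
have [/(_ 1%N)[_ [_ [+ _] _]] _] := tphi; rewrite setXTT => h p.
exact: ((continuous_subspace_setT _).2 h p).
Qed.

Lemma test_function2_is_derive (x t : R) : is_derive x 1 (phi ^~ t) (dx phi x t).
Proof.
have [/(_ 1%N)[_ [h _ _]] _] := tphi; have [d _] := h x t I.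
by apply: DeriveDef => //; rewrite /dx derive1E.
Qed.

(** If t is outside [s, L], the whole section of [phi] at t vanishes; otherwise L < |x|, which is an
    open condition on x. *)
Lemma dx_supported (K : set (R * R)) L s : K `<=` box L s -> supported_in K phi ->
  forall x t : R, ~ box L s (x, t) -> dx phi x t = 0.
Proof.
move=> Kb sK x t nb.
have p0 y : ~ box L s (y, t) -> phi y t = 0.
  by move=> nby; apply: sK => Ky; exact/nby/Kb.
have [tb|tb] := pselect (`[s, L]%classic t); last first.
  rewrite /dx (_ : phi ^~ t = cst 0) ?derive1_cst//.
  by apply/funext => y; apply: p0 => -[].
have nx : L < `|x|.
  by rewrite ltNge; apply/negP; rewrite ler_norml => h; apply: nb; split.
apply: is_derive1_derive1; apply: (@is_derive1_near _ (cst 0)).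
near=> y; rewrite p0 => [//|[/= + _]]; rewrite in_itv/= -ler_norml leNgt => /negP; apply.
near: y; have := @norm_continuous R R x => /cvgrPdist_lt.
have d0 : 0 < `|x| - L by rewrite subr_gt0.
move=> /(_ _ d0); apply: filterS => y; rewrite ltr_norml => /andP[_]; lra.
Unshelve. all: end_near. Qed.

Lemma test_function2_bounded (psi : R -> R -> R) (K : set (R * R)) :
  continuous (fun p : R * R => psi p.1 p.2) -> compact K ->
  (forall x t, ~ K (x, t) -> psi x t = 0) -> exists2 B : R, 0 < B & forall x t, `|psi x t| <= B.
Proof.
move=> cpsi cK psi0.
have cn : continuous (fun p : R * R => `|psi p.1 p.2|).
  by move=> p; apply: cvg_norm; exact: cpsi.
have [K0|K0] := eqVneq K set0.
  by exists 1 => // x t; rewrite psi0 ?normr0// K0.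
have {}K0 : K !=set0 by exact/set0P.
have [p _ h] := compact_EVT_max K0 cK (continuous_subspaceT cn).
exists (`|psi p.1 p.2| + 1); first by rewrite ltr_wpDl.
move=> x t; have [k|k] := pselect (K (x, t)); last by rewrite psi0// normr0 addr_ge0.
by have := h (x, t); rewrite inE => /(_ k) /le_trans; apply; rewrite lerDl.
Qed.

End test_functions_in_the_plane.

(** * Regularity of [V_eps] and measurability of the limits *)

Section unmollified_solution.
Context {R : realType}.
Notation mu := (@lebesgue_measure R).
Implicit Types (x y t : R).
Variables (a : R) (a0 : a != 0) (u0 v0 : R -> R) (M : R).
Hypotheses (mu0 : measurable_fun setT u0) (u0M : forall s : R, `|u0 s| <= M).
Hypothesis iv0 : mu.-integrable setT (EFin \o v0).
Variables (e : R) (e0 : 0 < e).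

Let U := oriented_integral u0.
Let P := oriented_integral v0.
Let lu := loc_integrable_bounded mu0 u0M.
Let lv := loc_integrable_integrable iv0.
Let C := \int[mu]_s `|v0 s|.
Let K := M / (2 * e).
Let w (y : R) := expR (- (U y / (2 * e))).
Let Pw (y : R) := P y * w y.
Let s_ t := 4 * e * tau a t.
Let N := gauss_conv Pw (fun=> 1).
Let D := gauss_conv w (fun=> 1).
Let N' := gauss_conv Pw id.
Let D' := gauss_conv w id.

Let C0 : 0 <= C. Proof. by apply: Rintegral_ge0. Qed.
Let M0 : 0 <= M. Proof. exact: le_trans (normr_ge0 _) (u0M 0). Qed.
Let K0 : 0 <= K. Proof. by rewrite divr_ge0// mulr_ge0// ltW. Qed.
Let s0 t : 0 < t -> 0 < s_ t.
Proof. by move=> t0; rewrite /s_ mulr_gt0 ?tau_gt0// mulr_gt0. Qed.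
Let cs_ t : s_ z @[z --> t] --> s_ t.
Proof. by rewrite /s_; apply: cvgMr; exact: continuous_tau. Qed.
Let mw : measurable_fun setT w.
Proof.
apply: measurable_fun_expR; apply: measurable_fun_opp; apply: measurable_funM => //.
exact: measurable_fun_continuous (continuous_oriented_integral lu).
Qed.
Let mPw : measurable_fun setT Pw.
Proof.
apply: measurable_funM mw.
exact: measurable_fun_continuous (continuous_oriented_integral lv).
Qed.
Let w_le y : `|w y| <= 1 * expR (K * `|y|).
Proof.
rewrite mul1r ger0_norm ?expR_ge0// ler_expR.
have e20 : 0 < 2 * e by rewrite mulr_gt0.
have := lipschitz_primitive mu0 u0M y 0.
rewrite oriented_integral0 !subr0 -normrN => /(le_trans (ler_norm _)) h.
by rewrite /K mulrAC -mulNr ler_pM2r ?invr_gt0.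
Qed.
Let Pw_le y : `|Pw y| <= C * expR (K * `|y|).
Proof.
rewrite normrM ler_pM//; first exact: oriented_integral_L1.
by have := w_le y; rewrite mul1r.
Qed.
Let k1 (z : R) : `|1 : R| <= expR `|z|.
Proof. by rewrite normr1 (le_trans _ (expR_ge1Dx _))// lerDl. Qed.
Let kz (z : R) : `|id z| <= expR `|z|.
Proof. by rewrite (le_trans _ (expR_ge1Dx _))// lerDr. Qed.
Let c1 : continuous ((fun=> 1) : R -> R). Proof. by move=> z; exact: cvg_cst. Qed.
Let cid : continuous (id : R -> R). Proof. by move=> z; exact: cvg_id. Qed.

Let weightE x t y : 0 < t ->
  weight a u0 e x t y = w y * (1 * expR (- ((x - y) ^+ 2 / s_ t))).
Proof.
move=> t0; have r0 := tau_gt0 a0 t0.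
rewrite /weight /theta mul1r /w -expRD /s_ -/U; congr expR; field.
by rewrite !gt_eqF.
Qed.

Let V_epsE x t : 0 < t -> V_eps a u0 v0 e x t = N x (s_ t) / D x (s_ t).
Proof.
move=> t0; rewrite /V_eps; congr (_ / _); apply: eq_Rintegral => y _; rewrite weightE//.
by rewrite /Pw mulrA.
Qed.

Let D_gt0 x t : 0 < t -> 0 < D x (s_ t).
Proof.
move=> t0; apply: Rintegral_gt0.
- have cU := continuous_oriented_integral lu => y; apply: cvgM.
    have h : - (U z / (2 * e)) @[z --> y] --> - (U y / (2 * e)).
      by apply: cvgN; apply: cvgM; [exact: cU|exact: cvg_cst].
    exact: (cvg_comp _ _ h (@continuous_expR R _)).
  apply: cvgMr.
  have h : - ((x - z) ^+ 2 / s_ t) @[z --> y] --> - ((x - y) ^+ 2 / s_ t).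
    have h1 : (x - z) @[z --> y] --> x - y by apply: cvgB; [exact: cvg_cst|exact: cvg_id].
    by apply: cvgN; apply: cvgM; [apply: cvgM|exact: cvg_cst].
  exact: (cvg_comp _ _ h (@continuous_expR R _)).
- by move=> y; rewrite mul1r mulr_gt0 ?expR_gt0.
- by have := integrable_gauss_conv mw w_le K0 x c1 k1 (s0 t0).
Qed.

Lemma V_eps_bound x t : 0 < t -> `|V_eps a u0 v0 e x t| <= C.
Proof.
move=> t0; rewrite V_epsE// normrM normfV (gtr0_norm (D_gt0 _ t0)) ler_pdivrMr ?D_gt0//.
have iw := integrable_gauss_conv mw w_le K0 x c1 k1 (s0 t0).
rewrite /D /gauss_conv -RintegralZl//; apply: ler_Rintegral => //.
- have := integrable_gauss_conv mPw Pw_le K0 x c1 k1 (s0 t0).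
  exact: integrableR_measurable.
- move=> y _; rewrite /Pw -mulrA normrM ler_pM//; first exact: oriented_integral_L1.
  by rewrite ger0_norm// mul1r mulr_ge0 ?expR_ge0.
- exact: integrableR_scale.
Qed.

Let continuous_comp_s (g : R -> R) x t (k : R -> R) (C' : R) : measurable_fun setT g ->
  (forall y, `|g y| <= C' * expR (K * `|y|)) -> continuous k ->
  (forall z : R, `|k z| <= expR `|z|) -> 0 < t ->
  {for (x, t), continuous (fun p : R * R => gauss_conv g k p.1 (s_ p.2))}.
Proof.
move=> mg gC ck kb t0; have := continuous_gauss_conv (x:=x) mg gC K0 ck kb (s0 t0).
have cs : (fun p : R * R => (p.1, s_ p.2)) p @[p --> (x, t)] --> (x, s_ t).
  have h1 : p.1 @[p --> (x, t)] --> x by exact: cvg_fst.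
  have h2 : p.2 @[p --> (x, t)] --> t by exact: cvg_snd.
  exact: (cvg_pair h1 (cvg_comp _ _ h2 (@cs_ t))).
by move=> h; exact: (cvg_comp _ _ cs h).
Qed.

Lemma continuous_V_eps (p : R * R) : half_plane p ->
  {for p, continuous (fun p : R * R => V_eps a u0 v0 e p.1 p.2)}.
Proof.
case: p => x t /= t0.
have h : {for (x, t), continuous (fun p : R * R => N p.1 (s_ p.2) / D p.1 (s_ p.2))}.
  apply: cvgM; first exact: (continuous_comp_s (x:=x) mPw Pw_le c1 k1 t0).
  apply: cvgV; first by rewrite gt_eqF// D_gt0.
  exact: (continuous_comp_s (x:=x) mw w_le c1 k1 t0).
rewrite /prop_for /continuous_at/= V_epsE//.
apply: cvg_trans h; apply: near_eq_cvg.
have := @open_half_plane R; rewrite openE => /(_ (x, t) t0); apply: filterS => p p0.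
by rewrite V_epsE.
Qed.

Lemma V_eps_derive : exists2 F : R -> R -> R,
  forall p, half_plane p -> {for p, continuous (fun p : R * R => F p.1 p.2)} &
  forall x t, 0 < t -> is_derive x 1 (V_eps a u0 v0 e ^~ t) (F x t).
Proof.
pose q x t := (D x (s_ t))^-1.
exists (fun x t => - (2 / s_ t) * N' x (s_ t) * q x t +
    N x (s_ t) * (- (- (2 / s_ t) * D' x (s_ t)) * q x t ^+ 2)).
  move=> [x t] t0.
  have hN := continuous_comp_s (x:=x) mPw Pw_le c1 k1 t0.
  have hD := continuous_comp_s (x:=x) mw w_le c1 k1 t0.
  have hN' := continuous_comp_s (x:=x) mPw Pw_le cid kz t0.
  have hD' := continuous_comp_s (x:=x) mw w_le cid kz t0.
  have hq : q p.1 p.2 @[p --> (x, t)] --> q x t.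
    by apply: cvgV; [rewrite gt_eqF// D_gt0|exact: hD].
  have hs : - (2 / s_ p.2) @[p --> (x, t)] --> - (2 / s_ t).
    apply: cvgN; apply: cvgMr; apply: cvgV; first by rewrite gt_eqF// s0.
    have h : p.2 @[p --> (x, t)] --> t by exact: cvg_snd.
    exact: (cvg_comp _ _ h (@cs_ t)).
  apply: cvgD; first by apply: cvgM hq; apply: cvgM.
  apply: cvgM => //; apply: cvgM; last by apply: cvgM.
  by apply: cvgN; apply: cvgM.
move=> x t t0.
have dN := is_derive_gauss_conv mPw Pw_le K0 x (s0 t0).
have dD := is_derive_gauss_conv mw w_le K0 x (s0 t0).
have dq := @is_derive1_inv R (D ^~ (s_ t)) x _ (lt0r_neq0 (D_gt0 x t0)) dD.
apply: (@is_derive1_ext _ (fun y => N y (s_ t) * (D y (s_ t))^-1)).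
  by move=> y; rewrite V_epsE.
exact: is_derive1_mul dN dq.
Qed.

End unmollified_solution.

Section measurable_minimizers.
Context {R : realType}.
Notation mu := (@lebesgue_measure R).
Implicit Types (U : R -> R).
Variables (a : R) (a0 : a != 0) (M : R).

(** The quantifiers in [argmin_max_ltP] run over countable sets, and each comparison defines a
    closed set of points (x, t). *)
Lemma measurable_argmin_max U : (forall y z : R, `|U y - U z| <= M * `|y - z|) ->
  measurable_fun half_plane (fun p : R * R => argmin_max U (tau a p.2) p.1).
Proof.
move=> UM; apply: (measurability _ (RGenInftyO.measurableE R)) => _ [_ [c ->] <-].
pose E (q p : rat) n := [set z : R * R | c <= ratr p ->
    (z.1 - ratr q) ^+ 2 + 2 * tau a z.2 * (U (ratr q) + n.+1%:R^-1) <=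
    (z.1 - ratr p) ^+ 2 + 2 * tau a z.2 * U (ratr p)].
rewrite (_ : _ `&` _ = half_plane `&` \bigcup_q \bigcup_n \bigcap_p E q p n); last first.
  apply/seteqP; split => -[x t] [t0] /=.
    rewrite in_itv/= => /(argmin_max_ltP (tau_gt0 a0 t0) UM)[q [n h]]; split => //.
    by exists q => //; exists n => // p _; exact: h.
  move=> [q _ [n _ h]]; split => //; rewrite /= in_itv/=.
  by apply/(argmin_max_ltP (tau_gt0 a0 t0) UM); exists q, n => p; exact: h.
apply: measurableI; first exact: measurable_half_plane.
apply: bigcupT_measurable_rat => q; apply: bigcupT_measurable => n.
rewrite -[X in measurable X]setCK setC_bigcap; apply: measurableC.
apply: bigcupT_measurable_rat => p; apply: measurableC; rewrite /E.
have [cp|cp] := boolP (c <= ratr p); last first.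
  by rewrite (_ : [set _ | _] = setT)//; apply/seteqP; split.
rewrite -[X in measurable X]setCK; apply: measurableC; apply: open_measurable_plane.
pose G (k l : R) (z : R * R) := (z.1 - k) ^+ 2 + 2 * tau a z.2 * l.
have cG k l : continuous (G k l).
  move=> z; apply: cvgD.
    have h : (w.1 - k) @[w --> z] --> z.1 - k by apply: cvgB; [exact: cvg_fst|exact: cvg_cst].
    by apply: cvgM.
  apply: cvgMl; apply: cvgMr; have h : w.2 @[w --> z] --> z.2 by exact: cvg_snd.
  exact: (cvg_comp _ _ h (@continuous_tau R a a0 z.2)).
rewrite (_ : ~` _ = (fun z => G (ratr q) (U (ratr q) + n.+1%:R^-1) z - G (ratr p) (U (ratr p)) z)
    @^-1` [set r | 0 < r]).
  by apply: open_comp => [z _|]; [apply: cvgB; exact: cG|exact: open_gt].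
apply/seteqP; split => z /=; rewrite subr_gt0 ltNge; first by move=> h; apply/negP => h'; exact/h.
by move=> /negP h h'; apply: h; exact: h'.
Qed.

Lemma measurable_argmin_min U : (forall y z : R, `|U y - U z| <= M * `|y - z|) ->
  measurable_fun half_plane (fun p : R * R => argmin_min U (tau a p.2) p.1).
Proof.
move=> UM; have UMN (y z : R) : `|(U \o -%R) y - (U \o -%R) z| <= M * `|y - z|.
  by rewrite (le_trans (UM _ _))// -opprD normrN.
apply: measurable_fun_opp.
have := measurable_argmin_max UMN => h.
apply: (@measurable_comp _ _ _ _ _ _ half_plane
  (fun p : R * R => argmin_max (U \o -%R) (tau a p.2) p.1) half_plane
  (fun p : R * R => (- p.1, p.2))) => //.
- exact: measurable_half_plane.
- by move=> _ [p p0 <-].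
- apply: measurable_funTS; apply: measurable_fun_pair; last exact: measurable_snd.
  by apply: measurable_fun_opp; exact: measurable_fst.
Qed.

End measurable_minimizers.

Section limits_in_the_plane.
Context {R : realType}.
Notation mu := (@lebesgue_measure R).
Notation mu2 := (mu \x mu)%E.
Implicit Types (x y t e : R).
Variables (a : R) (a0 : a != 0) (u0 v0 : R -> R) (M : R).
Hypotheses (mu0 : measurable_fun setT u0) (u0M : forall s : R, `|u0 s| <= M).
Hypothesis iv0 : mu.-integrable setT (EFin \o v0).

Let U := oriented_integral u0.
Let UM := lipschitz_primitive mu0 u0M.
Let lu := loc_integrable_bounded mu0 u0M.
Let lv := loc_integrable_integrable iv0.
Let C := \int[mu]_s `|v0 s|.
Let ym (p : R * R) := argmin_min U (tau a p.2) p.1.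
Let yp (p : R * R) := argmin_max U (tau a p.2) p.1.

Let mym : measurable_fun half_plane ym. Proof. exact: measurable_argmin_min. Qed.
Let myp : measurable_fun half_plane yp. Proof. exact: measurable_argmin_max. Qed.

Let y_min_ifE (p : R * R) : half_plane p ->
  y_min a u0 p.1 p.2 = if ym p == yp p then yp p else 0.
Proof.
move=> p0; case: ifPn => [/eqP h|h].
  by have [_ ->] := y_minE a0 mu0 u0M p0 ((regular_pointsP a0 mu0 u0M p.1 p0).2 h).
(* Without a unique minimizer, [y_min] takes the default value 0 of [get]. *)
apply: getPN => y hy; move/eqP : h; apply.
by apply/(regular_pointsP a0 mu0 u0M p.1 p0); exists y.
Qed.

Lemma measurable_y_min : measurable_fun half_plane (fun p : R * R => y_min a u0 p.1 p.2).
Proof.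
apply: (eq_measurable_fun (fun p => if ym p == yp p then yp p else 0)).
  by move=> p; rewrite inE => p0; rewrite y_min_ifE.
apply: measurable_fun_if; [exact: measurable_half_plane|exact: measurable_fun_eqr| |].
  by apply: measurable_funS myp; [exact: measurable_half_plane|exact: subIsetl].
exact: measurable_cst.
Qed.

Lemma measurable_V_lim : measurable_fun half_plane (fun p : R * R => V_lim a u0 v0 p.1 p.2).
Proof.
have mP := measurable_fun_continuous (continuous_oriented_integral lv).
exact: (measurableT_comp mP measurable_y_min).
Qed.

Lemma measurable_u_lim : measurable_fun half_plane (fun p : R * R => u_lim a u0 p.1 p.2).
Proof.
apply: (eq_measurable_fun (fun p : R * R =>
    (expR (- (a * p.2)) / tau a p.2) * (p.1 - y_min a u0 p.1 p.2))).
  by move=> p _; rewrite /u_lim; ring.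
apply: measurable_funM; last first.
  apply: measurable_funB measurable_y_min.
  by apply: measurable_funTS; exact: measurable_fst.
apply: measurable_fun_continuous_plane; first exact: open_half_plane.
move=> p p0; have h : q.2 @[q --> p] --> p.2 by exact: cvg_snd.
apply: cvgM.
  have h1 : - (a * q.2) @[q --> p] --> - (a * p.2) by apply: cvgN; exact: cvgMr.
  exact: (cvg_comp _ _ h1 (@continuous_expR R _)).
apply: cvgV; first by rewrite gt_eqF// tau_gt0.
exact: (cvg_comp _ _ h (@continuous_tau R a a0 p.2)).
Qed.

(** By Tonelli's theorem, because the exceptional set has a countable section at each time. *)
Lemma ae_regular_points :
  {ae mu2, forall p, half_plane p -> regular_points a u0 p.2 p.1}.
Proof.
pose N := half_plane `&` [set p : R * R | ym p < yp p].
have mN : measurable N.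
  exact: (measurable_fun_ltr mym myp measurable_half_plane (I : measurable [set true])).
have N0 : mu2 N = 0%E.
  rewrite -[N]setIT -(integral_indic mu2 measurableT mN) fubini_tonelli2//; last first.
    by apply/measurable_EFinP; exact: measurable_indic.
  apply: integral0_eq => t _; rewrite /fubini_G/=.
  rewrite (_ : (fun x => _) = (EFin \o \1_[set x | N (x, t)])); last first.
    by apply/funext => x /=; rewrite !indicE; congr ((nat_of_bool _)%:R%:E); apply/idP/idP; rewrite !inE.
  have cN : countable [set x | N (x, t)].
    have [t0|t0] := ltP 0 t; last first.
      rewrite (_ : [set x | _] = set0); first exact: countable0.
      by apply/seteqP; split => // x [/= + _]; rewrite /half_plane/= ltNge t0.
    apply: sub_countable (countable_irregular (tau_gt0 a0 t0) UM).
    by apply: subset_card_le => x [].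
  rewrite integral_indic//; last first.
    by have := @measurable_pair2 _ _ _ _ t measurableT N mN; rewrite setTI.
  by rewrite setIT; exact: countable_lebesgue_measure0.
exists N; split => // p /= np; apply: contrapT => nN; apply: np => p0.
apply/(regular_pointsP a0 mu0 u0M p.1 p0)/eqP; rewrite eq_le (argmin_min_le_max (tau_gt0 a0 p0) UM)/=.
by rewrite leNgt; apply/negP => lt; apply: nN.
Qed.

End limits_in_the_plane.

Section distributions_in_the_plane.
Context {R : realType}.
Notation mu := (@lebesgue_measure R).
Notation mu2 := (mu \x mu)%E.
Implicit Types (x y t e : R) (f phi psi : R -> R -> R).

Definition locally_bounded f := forall L s : R, 0 < L -> 0 < s ->
  exists B : R, forall x t, 0 < t -> box L s (x, t) -> `|f x t| <= B.

Lemma continuous_locally_bounded f :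
  (forall p, half_plane p -> {for p, continuous (fun p : R * R => f p.1 p.2)}) ->
  locally_bounded f.
Proof.
move=> cf L s L0 s0; have [->|b0] := eqVneq (box L s) set0; first by exists 0.
have cb : compact (box L s) by apply: compact_setX; exact: segment_compact.
have cn : {within box L s, continuous (fun p : R * R => `|f p.1 p.2|)}.
  apply: continuous_in_subspaceT => p; rewrite inE => -[_ /=]; rewrite in_itv/= => /andP[sp _].
  by apply: cvg_norm; apply: cf; exact: lt_le_trans sp.
have {}b0 : box L s !=set0 by exact/set0P.
have [p _ h] := compact_EVT_max b0 cb cn.
by exists `|f p.1 p.2| => x t _ bt; have := h (x, t); rewrite inE; exact.
Qed.

Lemma supported_in_box phi : test_function2 phi -> exists L s : R,
  [/\ 0 < L, 0 < s, forall x t, ~ box L s (x, t) -> phi x t = 0,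
      forall x t, ~ box L s (x, t) -> dx phi x t = 0 &
      exists2 B : R, 0 < B & forall x t, `|phi x t| <= B /\ `|dx phi x t| <= B].
Proof.
move=> tphi; have [_ [K [cK KH sK]]] := tphi.
have [L [s [L0 s0 Kb]]] := compact_in_box cK KH; exists L, s.
have d0 := dx_supported Kb sK.
have cb : compact (box L s) by apply: compact_setX; exact: segment_compact.
have p0 x t : ~ box L s (x, t) -> phi x t = 0 by move=> nb; apply: sK => Kx; exact/nb/Kb.
split => //.
have [B1 B10 h1] := test_function2_bounded (test_function2_continuous tphi) cb p0.
have [B2 B20 h2] := test_function2_bounded (test_function2_dx tphi) cb d0.
exists (Num.max B1 B2); first by rewrite lt_max B10.
by move=> x t; rewrite !le_max h1 h2 orbT.
Qed.

Lemma measurable_continuous_half_plane f : continuous (fun p : R * R => f p.1 p.2) ->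
  measurable_fun half_plane (fun p : R * R => f p.1 p.2).
Proof.
move=> cf; apply: measurable_fun_continuous_plane; first exact: open_half_plane.
by move=> p _; exact: cf.
Qed.

Section regular.
Variables (f : R -> R -> R) (bf : locally_bounded f).
Hypothesis mf : measurable_fun half_plane (fun p : R * R => f p.1 p.2).

Lemma integrable_regular psi (L s B : R) : 0 < L -> 0 < s ->
  measurable_fun half_plane (fun p : R * R => psi p.1 p.2) ->
  (forall x t, ~ box L s (x, t) -> psi x t = 0) -> (forall x t, `|psi x t| <= B) ->
  mu2.-integrable half_plane (EFin \o (fun p => f p.1 p.2 * psi p.1 p.2)).
Proof.
move=> L0 s0 mpsi psi0 psiB; have [Bf hBf] := bf L0 s0.
apply: (@integrable_half_plane R L s (Bf * B)).
- exact: measurable_funM.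
- by move=> [x t] nb /=; rewrite psi0// mulr0.
- by move=> [x t] /= t0 bt; rewrite normrM ler_pM//; exact: hBf.
Qed.

Lemma ler_regular psi (L s B Bf : R) : 0 < s ->
  (forall x t, 0 < t -> box L s (x, t) -> `|f x t| <= Bf) ->
  measurable_fun half_plane (fun p : R * R => psi p.1 p.2) ->
  (forall x t, ~ box L s (x, t) -> psi x t = 0) -> (forall x t, `|psi x t| <= B) ->
  `|regular_distribution f psi| <= box_volume L s * Bf * B.
Proof.
move=> s0 hBf mpsi psi0 psiB; rewrite -mulrA; apply: ler_Rintegral_half_plane.
- exact: measurable_funM.
- by move=> [x t] nb /=; rewrite psi0// mulr0.
- by move=> [x t] /= t0 bt; rewrite normrM ler_pM//; exact: hBf.
Qed.

Let mphi phi : test_function2 phi -> measurable_fun half_plane (fun p : R * R => phi p.1 p.2).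
Proof. by move=> tphi; exact: measurable_continuous_half_plane (test_function2_continuous tphi). Qed.

Let mdphi phi : test_function2 phi ->
  measurable_fun half_plane (fun p : R * R => dx phi p.1 p.2).
Proof. by move=> tphi; exact: measurable_continuous_half_plane (test_function2_dx tphi). Qed.

Let linear_regular (c : R) psi1 psi2 :
  mu2.-integrable half_plane (EFin \o (fun p => f p.1 p.2 * psi1 p.1 p.2)) ->
  mu2.-integrable half_plane (EFin \o (fun p => f p.1 p.2 * psi2 p.1 p.2)) ->
  regular_distribution f (fun x t => c * psi1 x t + psi2 x t) =
  c * regular_distribution f psi1 + regular_distribution f psi2.
Proof.
move=> i1 i2; rewrite /regular_distribution -RintegralZl//; last exact: measurable_half_plane.
rewrite -RintegralD//; last 2 first.
- exact: measurable_half_plane.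
- by apply: integrableR_scale => //; exact: measurable_half_plane.
by apply: eq_Rintegral => p _; ring.
Qed.

Let box_of phi K (L s : R) : K `<=` box L s -> supported_in K phi ->
  forall x t, ~ box L s (x, t) -> phi x t = 0.
Proof. by move=> Kb sK x t nb; apply: sK => Kx; exact/nb/Kb. Qed.

Lemma is_distribution_regular : is_distribution (regular_distribution f).
Proof.
split=> [c phi psi tphi tpsi|K cK KH].
  have [L [s [L0 s0 p0 _ [B B0 pB]]]] := supported_in_box tphi.
  have [L' [s' [L0' s0' p0' _ [B' B0' pB']]]] := supported_in_box tpsi.
  apply: linear_regular.
    by apply: (integrable_regular L0 s0 (mphi tphi) p0 (B := B)) => x t; case: (pB x t).
  by apply: (integrable_regular L0' s0' (mphi tpsi) p0' (B := B')) => x t; case: (pB' x t).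
have [L [s [L0 s0 Kb]]] := compact_in_box cK KH; have [Bf hBf] := bf L0 s0.
exists (box_volume L s * Bf), 0%N => phi B tphi sK hB.
apply: ler_regular => //; first exact: mphi.
  exact: box_of sK.
by move=> x t; exact: (hB 0%N 0%N).
Qed.

Lemma is_distribution_dx : is_distribution (dx_distribution f).
Proof.
split=> [c phi psi tphi tpsi|K cK KH].
  have [L [s [L0 s0 _ p0 [B B0 pB]]]] := supported_in_box tphi.
  have [L' [s' [L0' s0' _ p0' [B' B0' pB']]]] := supported_in_box tpsi.
  rewrite /dx_distribution.
  rewrite (_ : dx (fun x t => c * phi x t + psi x t) = fun x t => c * dx phi x t + dx psi x t).
    rewrite linear_regular; first by ring.
      by apply: (integrable_regular L0 s0 (mdphi tphi) p0 (B := B)) => x t; case: (pB x t).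
    by apply: (integrable_regular L0' s0' (mdphi tpsi) p0' (B := B')) => x t; case: (pB' x t).
  apply/funext => x; apply/funext => t; apply: is_derive1_derive1.
  apply: is_derive1_add; last exact: test_function2_is_derive.
  by apply: is_derive1_scale; exact: test_function2_is_derive.
have [L [s [L0 s0 Kb]]] := compact_in_box cK KH; have [Bf hBf] := bf L0 s0.
exists (box_volume L s * Bf), 1%N => phi B tphi sK hB; rewrite normrN.
apply: ler_regular => //; first exact: mdphi.
  exact: dx_supported sK.
by move=> x t; exact: (hB 1%N 0%N).
Qed.

(** The inner integral is prescribed as [I], so that the same application of Fubini's theorem serves
    classical derivatives and the Stieltjes form of V_x. *)
Lemma dx_distribution_iterated phi (I : R -> R) : test_function2 phi ->
  (forall t, 0 < t -> measurable_fun setT (f ^~ t)) ->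
  (forall t, 0 < t -> I t = - (\int[mu]_x (f x t * dx phi x t))) ->
  dx_distribution f phi = \int[mu]_(t in `]0, +oo[) I t.
Proof.
move=> tphi mft hI; have [L [s [L0 s0 _ dp0 [B B0 pB]]]] := supported_in_box tphi.
have [Bf hBf] := bf L0 s0.
have i2 := integrable_regular L0 s0 (mdphi tphi) dp0 (fun x t => (pB x t).2).
rewrite /dx_distribution /regular_distribution.
rewrite -mulN1r -RintegralZl//; last exact: measurable_half_plane.
rewrite (@Rintegral_half_plane R L s (Bf * B)) //; last 3 first.
- by apply: measurable_funM => //; apply: measurable_funM => //; exact: mdphi.
- by move=> [x t] nb /=; rewrite dp0// !mulr0.
- move=> [x t] /= t0 bt; rewrite mulN1r normrN normrM ler_pM//; last by case: (pB x t).
  exact: hBf.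
apply: eq_Rintegral => t; rewrite inE/= in_itv/= andbT => t0.
have [_ cdphi] := continuous_section (test_function2_dx tphi).
have nbox x : L < `|x| -> ~ box L s (x, t).
  by move=> Lx [/= + _]; rewrite in_itv/= -ler_norml leNgt Lx.
have idphi : mu.-integrable setT (EFin \o (fun x => dx phi x t)).
  by apply: integrable_compact_support (cdphi t) _ => x /nbox; exact: dp0.
rewrite RintegralZl ?mulN1r ?hI//.
apply: (@le_integrableR _ _ _ mu _ _ (fun x => Bf * `|dx phi x t|)) => //.
- by apply: measurable_funM; [exact: mft|exact: measurable_fun_continuous (cdphi t)].
- move=> x _; rewrite normrM; have [b|b] := pselect (box L s (x, t)).
    by rewrite ler_wpM2r// hBf.
  by rewrite dp0// normr0 !mulr0.
- by apply: integrableR_scale => //; exact: integrableR_norm.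
Qed.

Lemma regular_distribution_dx (F : R -> R -> R) phi : test_function2 phi ->
  (forall p, half_plane p -> {for p, continuous (fun p : R * R => F p.1 p.2)}) ->
  (forall x t, 0 < t -> is_derive x 1 (f ^~ t) (F x t)) ->
  regular_distribution (dx f) phi = dx_distribution f phi.
Proof.
move=> tphi cF dF; have [L [s [L0 s0 p0 dp0 [B B0 pB]]]] := supported_in_box tphi.
have [BF hBF] := continuous_locally_bounded cF L0 s0.
have mF := measurable_fun_continuous_plane open_half_plane cF.
have mdf : measurable_fun half_plane (fun p : R * R => dx f p.1 p.2).
  apply: (eq_measurable_fun (fun p : R * R => F p.1 p.2)) mF => p; rewrite inE => pp0.
  by apply/esym; exact: is_derive1_derive1 (dF _ _ pp0).
have cf t : 0 < t -> continuous (f ^~ t).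
  by move=> t0 x; exact: (is_derive1_continuous (dF x t t0)).
apply/esym; rewrite /regular_distribution.
rewrite (@Rintegral_half_plane R L s (BF * B)) //; last 3 first.
- by apply: measurable_funM => //; exact: mphi.
- by move=> [x t] nb /=; rewrite p0// mulr0.
- move=> [x t] /= t0 bt; rewrite normrM ler_pM//; last by case: (pB x t).
  by rewrite /dx (is_derive1_derive1 (dF _ _ t0)); exact: hBF.
apply: dx_distribution_iterated => // t t0; first exact: measurable_fun_continuous (cf t t0).
have [_ cdphi] := continuous_section (test_function2_dx tphi).
have cFt : continuous (F ^~ t).
  move=> x; have h1 : z @[z --> x] --> x by exact: cvg_id.
  have h2 : (fun=> t : R) z @[z --> x] --> (t : R) by exact: cvg_cst.
  exact: (cvg_comp _ _ (cvg_pair h1 h2) (cF (x, t) t0)).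
have nbox x : L < `|x| -> ~ box L s (x, t).
  by move=> Lx [/= + _]; rewrite in_itv/= -ler_norml leNgt Lx.
have phiL x : L < `|x| -> phi x t = 0 by move=> /nbox; exact: p0.
have dphiL x : L < `|x| -> dx phi x t = 0 by move=> /nbox; exact: dp0.
rewrite -(Rintegral_by_parts cFt (fun x => dF x t t0) (cdphi t)
  (fun x => test_function2_is_derive tphi x t) phiL dphiL).
by apply: eq_Rintegral => x _; rewrite /= /dx (is_derive1_derive1 (dF x t t0)).
Qed.

End regular.

End distributions_in_the_plane.

Section bounded_variation.
Context {R : realType}.

(** The increments of G along a partition telescope to G b - G a, at most 2 C. *)
Lemma bounded_variation_in_increasing (D : set R) (f G : R -> R) (C : R) :
  (forall x, `|G x| <= C) ->
  (forall x y, D x -> D y -> x <= y -> `|f x - f y| <= G y - G x) ->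
  bounded_variation_in D f.
Proof.
move=> GC fG; exists (2 * C) => _ [a [b [s [[pas /eqP lb] sD ->]]]].
have : variation a b f s <= G b - G a.
  rewrite /variation; elim: s a pas lb sD => [|c s IH] a /=.
    by move=> _ -> _; rewrite big_nil subrr.
  move=> /andP[ac pcs] lb sD; rewrite big_nat_recl//=.
  have Da : D a by apply: sD; rewrite mem_head.
  have Dc : D c by apply: sD; rewrite !inE eqxx orbT.
  have sD' : {in c :: s, forall x, D x} by move=> x xs; apply: sD; rewrite in_cons xs orbT.
  have := IH c pcs lb sD'; have := fG _ _ Da Dc (ltW ac); rewrite distrC.
  by move=> h1 h2; apply: (le_trans (lerD h1 h2)); rewrite le_eqVlt; apply/orP; left; apply/eqP; ring.
move=> /le_trans; apply; have := GC a; have := GC b; rewrite !ler_norml; lra.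
Qed.

End bounded_variation.

(** * Convergence of u and of V_x as distributions *)

Section distributional_limits.
Context {R : realType}.
Notation mu := (@lebesgue_measure R).
Notation mu2 := (mu \x mu)%E.
Implicit Types (x y t e : R).
Variables (a : R) (a0 : a != 0) (u0 v0 : R -> R) (M : R).
Hypotheses (mu0 : measurable_fun setT u0) (u0M : forall s : R, `|u0 s| <= M).
Hypothesis iv0 : mu.-integrable setT (EFin \o v0).

Let U := oriented_integral u0.
Let UM := lipschitz_primitive mu0 u0M.
Let lu := loc_integrable_bounded mu0 u0M.
Let lv := loc_integrable_integrable iv0.
Let C := \int[mu]_s `|v0 s|.

Lemma V_lim_bound x t : `|V_lim a u0 v0 x t| <= C.
Proof. exact: oriented_integral_L1. Qed.

Lemma locally_bounded_V_lim : locally_bounded (V_lim a u0 v0).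
Proof. by move=> L s _ _; exists C => x t _ _; exact: V_lim_bound. Qed.

Lemma locally_bounded_u_lim : locally_bounded (u_lim a u0).
Proof.
move=> L s L0 s0; have [Ls|sL] := ltP L s.
  by exists 0 => x t _ [_ /=]; rewrite in_itv/= => /andP[st tL]; lra.
(* The smallest value of [tau] over the times of the box, positive because s > 0. *)
have [t1] := EVT_min sL (continuous_subspaceT (continuous_tau a0)).
rewrite in_itv/= => /andP[st1 _] tmin; have r0 := tau_gt0 a0 (lt_le_trans s0 st1).
have M0 : 0 <= M := le_trans (normr_ge0 _) (u0M 0).
exists (expR (`|a| * L) * (2 * M + L / tau a t1)) => x t t0 [/= xL].
rewrite in_itv/= => tsL; have rt := tau_gt0 a0 t0.
have rr : tau a t1 <= tau a t by apply: tmin; rewrite in_itv.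
have {}xL : `|x| <= L by move: xL; rewrite in_itv/= -ler_norml.
rewrite normrM (ger0_norm (expR_ge0 _)) ler_pM ?expR_ge0//.
  rewrite ler_expR (le_trans (ler_norm _))// normrN normrM (gtr0_norm t0).
  by rewrite ler_wpM2l//; case/andP: tsL.
rewrite normrM (gtr0_norm (_ : 0 < (tau a t)^-1)) ?invr_gt0//.
have [reg|nreg] := pselect (regular_points a u0 t x).
  have [h _] := y_minE a0 mu0 u0M t0 reg.
  have := argmin_dist (tau_gt0 a0 t0) UM (y := y_min a u0 x t) (x := x).
  rewrite -/U h => /(_ erefl) hd; rewrite ler_pdivrMr//.
  have : 0 <= L / tau a t1 * tau a t := mulr_ge0 (divr_ge0 (ltW L0) (ltW r0)) (ltW rt).
  by move: hd; rewrite (mulrDl _ _ (tau a t)) mulrA => hd hL; rewrite (le_trans hd)// lerDl.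
(* At irregular points the default value 0 leaves the slope x / tau, which the term L / tau(t1) of
   the bound provides for; 2 M comes from [argmin_dist]. *)
have -> : y_min a u0 x t = 0 by apply: getPN => y hy; apply: nreg; exists y.
rewrite subr0 -[leLHS]add0r lerD ?mulr_ge0// ler_pM ?invr_ge0 ?(ltW rt)//.
by rewrite lef_pV2.
Qed.

Lemma bounded_variation_V_lim t : 0 < t ->
  bounded_variation_in (regular_points a u0 t) (fun x => V_lim a u0 v0 x t).
Proof.
move=> t0; have r0 := tau_gt0 a0 t0; pose Q := oriented_integral (fun s => `|v0 s|).
(* The primitive Q of |v0|, composed with the monotone minimizer, is bounded by the L1 norm, and its
   increments dominate those of V. *)
apply: (@bounded_variation_in_increasing _ _ _
  (fun x => Q (argmin_max U (tau a t) x)) C).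
  move=> x; have inv := integrableR_norm (@measurableT _ _) iv0.
  have := oriented_integral_L1 (argmin_max U (tau a t) x) inv.
  by under eq_Rintegral do rewrite normr_id.
move=> x y rx ry xy; have [_ ex] := y_minE a0 mu0 u0M t0 rx.
have [_ ey] := y_minE a0 mu0 u0M t0 ry.
rewrite /V_lim ex ey distrC; apply: oriented_integral_dist => //.
exact: (argmin_max_nd r0 UM).
Qed.

Lemma ae_cvg (f_ : R -> R -> R -> R) (f : R -> R -> R) :
  (forall x t, 0 < t -> regular_points a u0 t x -> f_ e x t @[e --> 0^'+] --> f x t) ->
  {ae mu2, forall p, half_plane p -> f_ e p.1 p.2 @[e --> 0^'+] --> f p.1 p.2}.
Proof.
move=> cf; apply: (@ae_sub _ _ _ mu2 _ _ _ (ae_regular_points a0 mu0 u0M)) => p h p0.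
exact: cf (h p0).
Qed.

(** Common to [V_eps] and [V_tilde]: for each [e] the derivative moves to the test function, and the
    bound C, uniform in [e], permits dominated convergence. *)
Lemma cvg_distribution_dx (V : R -> R -> R -> R) (F : R -> R -> R -> R) :
  (forall e, 0 < e -> measurable_fun half_plane (fun p : R * R => V e p.1 p.2)) ->
  (forall e x t, 0 < e -> 0 < t -> `|V e x t| <= C) ->
  (forall e, 0 < e -> forall p, half_plane p ->
    {for p, continuous (fun p : R * R => F e p.1 p.2)}) ->
  (forall e x t, 0 < e -> 0 < t -> is_derive x 1 (V e ^~ t) (F e x t)) ->
  (forall x t, 0 < t -> regular_points a u0 t x ->
    V e x t @[e --> 0^'+] --> V_lim a u0 v0 x t) ->
  cvg_distribution (fun e => dx (V e)) (dx_distribution (V_lim a u0 v0)).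
Proof.
move=> mV bV cF dF cV phi tphi.
have [L [s [L0 s0 _ dp0 [B B0 pB]]]] := supported_in_box tphi.
have h : regular_distribution (V e) (dx phi) @[e --> 0^'+] -->
    regular_distribution (V_lim a u0 v0) (dx phi).
  apply: (@cvg_regular_distribution _ _ _ _ L s C B) => //.
  - exact: measurable_V_lim.
  - exact: measurable_continuous_half_plane (test_function2_dx tphi).
  - by move=> x t; case: (pB x t).
  - by move=> e x t e0 t0 _; exact: bV.
  - exact: ae_cvg.
apply: cvg_trans (cvgN h); apply: near_eq_cvg; near=> e.
have e0 : 0 < e by near: e; exact: nbhs_right_gt.
apply/esym; apply: (@regular_distribution_dx _ _ _ _ (F e)) => //.
- by move=> L' s' _ _; exists C => x t t0 _; exact: bV.
- exact: mV.
- exact: cF.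
- by move=> x t; exact: dF.
Unshelve. all: end_near. Qed.

Lemma cvg_distribution_V_eps :
  cvg_distribution (fun e => dx (V_eps a u0 v0 e)) (dx_distribution (V_lim a u0 v0)).
Proof.
(* A choice of the x-derivative for every [e], with the value 0 when e <= 0. *)
have ex e : {F : R -> R -> R | 0 < e ->
    (forall p, half_plane p -> {for p, continuous (fun p : R * R => F p.1 p.2)}) /\
    (forall x t, 0 < t -> is_derive x 1 (V_eps a u0 v0 e ^~ t) (F x t))}.
  have [e0|_] := boolP (0 < e); last by exists (fun _ _ => 0).
  by apply: cid; have [F h1 h2] := V_eps_derive a0 mu0 u0M iv0 e0; exists F.
apply: (@cvg_distribution_dx _ (fun e => sval (ex e))).
- move=> e e0; apply: measurable_fun_continuous_plane; first exact: open_half_plane.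
  by move=> p p0; exact: (continuous_V_eps a0 mu0 u0M iv0 e0 p0).
- by move=> e x t e0 t0; exact: (V_eps_bound a0 mu0 u0M iv0 e0).
- by move=> e e0; case: (svalP (ex e) e0).
- by move=> e x t e0 t0; case: (svalP (ex e) e0) => _; exact.
- by move=> x t t0 reg; exact: cvg_V_eps.
Qed.

Lemma cvg_distribution_V_tilde :
  cvg_distribution (fun e => dx (V_tilde a u0 v0 e)) (dx_distribution (V_lim a u0 v0)).
Proof.
have bu e k (e0 : 0 < e) := @bounded_conv_u0 R u0 M mu0 u0M e k e0.
have bv e k (e0 : 0 < e) := @bounded_conv_v0 R v0 iv0 e k e0.
have ex e : {F : R -> R -> R | 0 < e -> continuous (fun p : R * R => F p.1 p.2) /\
    (forall x t, is_derive x 1 (V_smooth a u0 v0 e ^~ t) (F x t))}.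
  have [e0|_] := boolP (0 < e); last by exists (fun _ _ => 0).
  apply: cid; have [F h1 h2] := continuous_dx_V_smooth a0 e0 lu lv
    (fun k => @bu e k e0) (fun k => @bv e k e0).
  by exists F.
have VE e x t : 0 < e -> 0 < t -> V_tilde a u0 v0 e x t = V_smooth a u0 v0 e x t.
  move=> e0 t0; exact: (V_tildeE a0 e0 lu lv (fun k => @bu e k e0) (fun k => @bv e k e0) x (ltW t0)).
apply: (@cvg_distribution_dx _ (fun e => sval (ex e))).
- move=> e e0; apply: (eq_measurable_fun (fun p : R * R => V_smooth a u0 v0 e p.1 p.2)).
    by move=> p; rewrite inE => p0; rewrite VE.
  apply: measurable_continuous_half_plane.
  exact: (continuous_V_smooth a0 e0 lu lv (fun k => @bu e k e0) (fun k => @bv e k e0)).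
- move=> e x t e0 t0; rewrite VE//.
  apply: (V_smooth_bound a e0 lu lv (fun k => @bu e k e0) (fun k => @bv e k e0) x t) => y.
  exact: primitive_mollify_v0_bound.
- by move=> e e0 p _; case: (svalP (ex e) e0) => h _; exact: h.
- move=> e x t e0 t0; case: (svalP (ex e) e0) => _ h.
  by apply: (@is_derive1_ext _ (V_smooth a u0 v0 e ^~ t)) (h x t) => y; rewrite VE.
- by move=> x t t0 reg; exact: cvg_V_tilde.
Qed.

Lemma cvg_distribution_u_tilde :
  cvg_distribution (u_tilde a u0) (regular_distribution (u_lim a u0)).
Proof.
have bu e k (e0 : 0 < e) := @bounded_conv_u0 R u0 M mu0 u0M e k e0.
have bv e k (e0 : 0 < e) := @bounded_conv_v0 R v0 iv0 e k e0.
have uE e x t : 0 < e -> 0 < t -> u_tilde a u0 e x t = u_smooth a u0 e x t.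
  move=> e0 t0; exact: (u_tildeE a0 e0 lu lv (fun k => @bu e k e0) (fun k => @bv e k e0) x (ltW t0)).
have M0 : 0 <= M := le_trans (normr_ge0 _) (u0M 0).
move=> phi tphi; have [L [s [L0 s0 p0 _ [B B0 pB]]]] := supported_in_box tphi.
apply: (@cvg_regular_distribution _ _ _ _ L s (expR (`|a| * L) * M) B) => //.
- move=> e e0; apply: (eq_measurable_fun (fun p : R * R => u_smooth a u0 e p.1 p.2)).
    by move=> p; rewrite inE => pp0; rewrite uE.
  apply: measurable_continuous_half_plane.
  exact: (continuous_u_smooth a0 e0 lu lv (fun k => @bu e k e0) (fun k => @bv e k e0)).
- exact: measurable_u_lim.
- exact: measurable_continuous_half_plane (test_function2_continuous tphi).
- by move=> x t; case: (pB x t).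
- move=> e x t e0 t0 [_ /=]; rewrite in_itv/= => /andP[_ tL]; rewrite uE//.
  have h := u_smooth_bound a e0 lu lv (fun k => @bu e k e0) (fun k => @bv e k e0) x t
    (fun y => mollify_u0_bound mu0 u0M y e0).
  apply: (le_trans h); rewrite ler_wpM2r// ler_expR (le_trans (ler_norm _))//.
  by rewrite normrN normrM (gtr0_norm t0) ler_wpM2l.
- by apply: ae_cvg => x t t0 reg; exact: cvg_u_tilde.
Qed.

Theorem generalized_solution_lim : generalized_solution a u0 v0
  (regular_distribution (u_lim a u0)) (dx_distribution (V_lim a u0 v0)).
Proof.
split.
- by apply: is_distribution_regular; [exact: locally_bounded_u_lim|exact: measurable_u_lim].
- by apply: is_distribution_dx; [exact: locally_bounded_V_lim|exact: measurable_V_lim].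
- exists (u_tilde a u0), (fun e => dx (V_tilde a u0 v0 e)); split.
  + exact: weak_asymptotic_tilde.
  + exact: cvg_distribution_u_tilde.
  + exact: cvg_distribution_V_tilde.
Qed.

End distributional_limits.

(** * Stieltjes measures and the chain rule *)

Section averages_over_segments.
Context {R : realType}.
Notation mu := (@lebesgue_measure R).
Implicit Types (a b c s y z : R) (f g v : R -> R).

Lemma Rintegral_eq_except f g a : measurable_fun setT f -> measurable_fun setT g ->
  (forall s, s != a -> f s = g s) -> \int[mu]_s f s = \int[mu]_s g s.
Proof.
move=> mf mg fg; apply: Rintegral_ae_eq => //.
exists [set a]; split; [exact: measurable_set1|exact: lebesgue_measure_set1|].
by move=> s /= ns; apply: contrapT => sa; apply: ns => _; apply: fg; exact/eqP.
Qed.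

Lemma Rintegral_segment_oriented v a b : loc_integrable v -> a <= b ->
  \int[mu]_s (v s * \1_(`[a, b]) s) = oriented_integral v b - oriented_integral v a.
Proof.
move=> lv ab; have [mv _] := lv; rewrite oriented_integralB//.
apply: (@Rintegral_eq_except _ _ a).
- by apply: measurable_funM => //; exact: measurable_indic.
- by apply: measurable_funM => //; apply: measurable_funB; exact: measurable_step.
move=> s sa; congr (_ * _); rewrite indicE /step; move: sa; rewrite neq_lt => /orP[sa|sa].
  by rewrite memNset/= ?in_itv/= ?leNgt ?sa// (lt_gtF sa) (lt_gtF (lt_le_trans sa ab)) subrr.
rewrite sa; have [bs|sb] := ltP b s.
  by rewrite memNset ?subrr// => /=; rewrite in_itv/= => /andP[_]; rewrite leNgt bs.
by rewrite mem_set ?subr0//= in_itv/= ltW.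
Qed.

Lemma averaged_id v a : averaged v a a = v a.
Proof.
rewrite /averaged (_ : (fun s => _) = (fun s => v a * cst 1 s)); last first.
  by apply/funext => s; rewrite /cst mulr1; congr v; ring.
rewrite Rintegral_mkcond (_ : _ \_ _ = (fun s => v a * \1_(`[0, 1]%classic) s)); last first.
  by apply/funext => s; rewrite /patch indicE; case: ifPn; rewrite ?mulr1 ?mulr0.
rewrite RintegralZl//; last exact: integrable_indic_segment.
by rewrite Rintegral_indic_segment// subr0 mulr1.
Qed.

Lemma averagedE v a b : mu.-integrable setT (EFin \o v) -> a < b ->
  averaged v a b = (b - a)^-1 * \int[mu]_s (v s * \1_(`[a, b]) s).
Proof.
move=> iv ab; have ba : 0 < b - a by rewrite subr_gt0.
have ivab : mu.-integrable setT (EFin \o (fun s => v s * \1_(`[a, b]) s)).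
  apply: (@integrable_mulr_bounded _ _ _ mu setT _ _ 1) => //.
  by move=> s _; rewrite indicE; case: (_ \in _); rewrite ?normr1 ?normr0.
rewrite (Rintegral_affine a ba ivab) mulKf ?gt_eqF// /averaged Rintegral_mkcond.
apply: eq_Rintegral => s _; rewrite /patch indicE.
have -> : (a + (b - a) * s \in `[a, b]%classic) = (s \in `[0, 1]%classic).
  apply/idP/idP; rewrite !inE/= !in_itv/= => /andP[h1 h2]; apply/andP; split.
  - by rewrite -(pmulr_rge0 _ ba); lra.
  - by rewrite -(ler_pM2l ba); lra.
  - by rewrite lerDl mulr_ge0// ltW.
  - have : (b - a) * s <= (b - a) * 1 by rewrite ler_pM2l.
    by lra.
case: ifPn => _; rewrite ?mulr0// mulr1; congr v; ring.
Qed.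

End averages_over_segments.

Section generalized_inverse.
Context {R : realType}.
Notation mu := (@lebesgue_measure R).
Implicit Types (x y z s c : R).

Definition quantile (f : R -> R) y : R := inf [set x | y <= f x].

Variables (F : cumulative R R) (B : R).
Hypothesis FB : forall x, `|x - F x| <= B.
Let X := quantile F.

(** The set of x with y <= F x is nonempty and bounded below because F stays within B of the
    identity; by right continuity it contains its infimum. *)
Lemma quantile_le x y : X y <= x <-> y <= F x.
Proof.
have nd := cumulative_is_nondecreasing F.
have lb : has_lbound [set x | y <= F x].
  by exists (y - B) => z /= yz; have := FB z; rewrite ler_norml; lra.
have ne : [set x | y <= F x] !=set0.
  by exists (y + B) => /=; have := FB (y + B); rewrite ler_norml; lra.
split=> [Xx|yx]; last exact: ge_inf.
apply: le_trans (nd _ _ Xx).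
have cF : F z @[z --> (X y)^'+] --> F (X y) := cumulative_is_right_continuous F (X y).
apply: (ler_cvg_to (cvg_cst y) cF); near=> z.
have zX : X y < z by near: z; exact: nbhs_right_gt.
have [w yw wz] := inf_lt ne zX.
by rewrite (le_trans yw)// nd// ltW.
Unshelve. all: end_near. Qed.

Lemma quantile_lt x y : x < X y <-> F x < y.
Proof. by rewrite !ltNge; split => /negP h; apply/negP => h'; apply: h; apply/quantile_le. Qed.

Lemma measurable_quantile : measurable_fun setT (X : measurableTypeR R -> measurableTypeR R).
Proof.
apply: (measurability _ (RGenOInfty.measurableE R)) => _ [_ [c ->] <-].
rewrite setTI (_ : _ @^-1` _ = `]F c, +oo[%classic); first exact: measurable_itv.
apply/seteqP; split => y /=; rewrite !in_itv/= !andbT; first by move/quantile_lt.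
by move=> h; apply/quantile_lt.
Qed.

(** By [quantile_le] the preimage of ]a, b] under X is ]F a, F b], and the values on such intervals
    determine the Stieltjes measure. *)
Lemma stieltjes_pushforward (A : set (measurableTypeR R)) : measurable A ->
  lebesgue_stieltjes_measure F A =
  pushforward mu (X : measurableTypeR R -> measurableTypeR R) A.
Proof.
move=> mA.
pose X' : {mfun measurableTypeR R >-> measurableTypeR R} :=
  HB.pack (X : measurableTypeR R -> measurableTypeR R)
  (isMeasurableFun.Build _ _ (measurableTypeR R) (measurableTypeR R) _ measurable_quantile).
apply: (@lebesgue_stieltjes_measure_unique R F (pushforward mu X')) => // _ [[a b] _ <-] /=.
rewrite /lebesgue_stieltjes_measure /measure_extension/=.
rewrite measurable_mu_extE/=; last exact: is_ocitv.
rewrite /pushforward (_ : _ @^-1` _ = `]F a, F b]%classic); last first.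
  apply/seteqP; split => y /=; rewrite !in_itv/= => /andP[h1 h2].
    by apply/andP; split; [exact/quantile_lt|exact/quantile_le].
  by apply/andP; split; [exact/quantile_lt|exact/quantile_le].
rewrite lebesgue_measure_itv/= lte_fin.
have nd := cumulative_is_nondecreasing F.
have [ab | ba] := leP a b; last first.
  by rewrite set_itv_ge ?wlength0 ?bnd_simp -?leNgt ?ltW// ltNge nd// ltW.
rewrite wlength_itv_bnd//; have := nd _ _ ab; rewrite le_eqVlt => /predU1P[->|->]; last by rewrite EFinB.
by rewrite ltxx subrr.
Qed.

Let X' : {mfun measurableTypeR R >-> measurableTypeR R} :=
  HB.pack (X : measurableTypeR R -> measurableTypeR R)
  (isMeasurableFun.Build _ _ (measurableTypeR R) (measurableTypeR R) _ measurable_quantile).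

Lemma stieltjes_integrable (f : R -> R) : measurable_fun setT f ->
  mu.-integrable setT (EFin \o (f \o X)) ->
  (lebesgue_stieltjes_measure F).-integrable setT (EFin \o f).
Proof.
move=> mf /integrableP[_ iy]; apply/integrableP; split; first exact/measurable_EFinP.
rewrite (@eq_measure_integral _ _ _ _ (pushforward mu X')); last first.
  by move=> A mA _; exact: stieltjes_pushforward.
rewrite ge0_integral_pushforward//.
by apply: measurableT_comp => //; exact/measurable_EFinP.
Qed.

Lemma stieltjes_Rintegral (f : R -> R) : measurable_fun setT f ->
  mu.-integrable setT (EFin \o (f \o X)) ->
  \int[lebesgue_stieltjes_measure F]_x f x = \int[mu]_y f (X y).
Proof.
move=> mf ifX; rewrite /Rintegral; congr fine.
rewrite [LHS](@eq_measure_integral _ _ _ _ (pushforward mu X')); last first.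
  by move=> A mA _; exact: stieltjes_pushforward.
by rewrite integral_pushforward//; exact/measurable_EFinP.
Qed.

End generalized_inverse.

Section stieltjes_chain_rule.
Context {R : realType}.
Notation mu := (@lebesgue_measure R).
Implicit Types (x y z s c : R) (f g : R -> R).
Variables (F : cumulative R R) (G : R -> R) (B : R).
Hypothesis FB : forall x, `|x - F x| <= B.
(** Together with the next two, this makes [G x] the supremum of F over the points to the left of x,
    that is, its left limit. *)
Hypothesis GF : forall x, G x <= F x.
Hypothesis FG : forall z x, z < x -> F z <= G x.
Hypothesis G_left : forall x y, (forall z, z < x -> F z <= y) -> G x <= y.
Hypothesis mG : measurable_fun setT G.
Variables (v : R -> R) (iv : mu.-integrable setT (EFin \o v)).

Let X := quantile F.
Let lv := loc_integrable_integrable iv.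
Let P := oriented_integral v.
Let h x := averaged v (G x) (F x).
Let J x := G x < F x.
Let w x : R := if J x then (F x - G x)^-1 else 0.
(** The indicator function of a level set of X; up to its left end, this is the jump interval of F
    at c. [w c] is the inverse of its length. *)
Let q c y : R := (X y == c)%:R.

Let mX : measurable_fun setT X := measurable_quantile FB.

Let mF : measurable_fun setT F.
Proof. exact: nondecreasing_measurable (cumulative_is_nondecreasing F). Qed.

Let mv : measurable_fun setT v. Proof. by have [] := lv. Qed.

Let X_bounds y : G (X y) <= y <= F (X y).
Proof.
apply/andP; split; last by apply/(quantile_le FB).
by apply: G_left => z zX; apply/ltW/(quantile_lt FB).
Qed.

Let X_eq x y : G x < y -> y <= F x -> X y = x.
Proof.
move=> Gy yF; have h1 : X y <= x by apply/(quantile_le FB).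
apply/eqP; rewrite eq_le h1 leNgt; apply/negP => lt.
have := FG lt; have /andP[_ h2] := X_bounds y.
by move=> h3; have := lt_le_trans Gy (le_trans h2 h3); rewrite ltxx.
Qed.

(** Always G (X y) <= y <= F (X y), so without a jump both ends equal y and the average degenerates
    to [v y]. *)
Let no_jump y : ~~ J (X y) -> h (X y) = v y.
Proof.
rewrite /J -leNgt => FG'; have /andP[h1 h2] := X_bounds y.
have e : G (X y) = F (X y) by apply/eqP; rewrite eq_le GF.
rewrite /h e averaged_id; congr v; apply/eqP; rewrite eq_le h2 andbT.
by rewrite (le_trans FG').
Qed.

Let mq c : measurable_fun setT (q c).
Proof.
apply: (eq_measurable_fun (fun y => if X y == c then 1 else 0 : R)).
  by move=> y _; rewrite /q; case: (X y == c).
by apply: measurable_fun_ifT => //; exact: measurable_fun_eqr.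
Qed.

(** The left end is excluded: at s = G c, the quantile may lie strictly to the left of c. *)
Let q_indic c s : s != G c -> q c s = \1_(`[G c, F c]) s.
Proof.
move=> sG; rewrite /q indicE; have [<-|ne] := eqVneq (X s) c.
  by rewrite mem_set//=; rewrite in_itv/= X_bounds.
rewrite memNset//= in_itv/= => /andP[h1 h2]; move/eqP : ne; apply.
by apply: X_eq => //; rewrite lt_neqAle eq_sym sG.
Qed.

Let q_le c y : `|q c y| <= \1_(`[G c, F c]) y.
Proof.
rewrite /q indicE; have [e|_] := eqVneq (X y) c; last by rewrite normr0.
by rewrite mem_set ?normr1//=; rewrite in_itv/= -e X_bounds.
Qed.

Let iq c : mu.-integrable setT (EFin \o q c).
Proof.
apply: le_integrableR (@integrable_indic_segment R (G c) (F c)) => //; exact: mq.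
Qed.

Let mw : measurable_fun setT w.
Proof.
apply: (eq_measurable_fun (fun x => if G x < F x then expR (- ln (F x - G x)) else 0)).
  move=> x _; rewrite /w /J; case: ifPn => // GFx.
  by rewrite expRN lnK// posrE subr_gt0.
apply: measurable_fun_ifT => //; first exact: measurable_fun_ltr.
apply: measurable_fun_expR; apply: measurable_fun_opp.
by apply: (measurableT_comp (@measurable_ln R)); exact: measurable_funB.
Qed.

Let w0 x : 0 <= w x.
Proof. by rewrite /w /J; case: ifPn => // /ltW; rewrite invr_ge0 subr_ge0. Qed.

Let wq c : w c * \int[mu]_y q c y = (J c)%:R.
Proof.
rewrite /w; case: ifPn => [Jc|_]; last by rewrite mul0r.
rewrite (@Rintegral_eq_except R (q c) (\1_(`[G c, F c])) (G c)) => //; last exact: q_indic.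
by rewrite Rintegral_indic_segment// mulVf// gt_eqF// subr_gt0.
Qed.

Let Iwq c : \int[mu]_y (w c * q c y) = (J c)%:R.
Proof. by rewrite RintegralZl; [exact: wq|by []|exact: iq]. Qed.

Let wvq c : J c -> w c * \int[mu]_s (v s * q c s) = h c.
Proof.
move=> Jc; rewrite /h averagedE// /w Jc; congr (_ * _).
apply: (@Rintegral_eq_except _ _ _ (G c)).
- exact: measurable_funM.
- by apply: measurable_funM => //; exact: measurable_indic.
- by move=> s sG; rewrite q_indic.
Qed.

(** At a jump the average is a difference quotient of the primitive P between G and F; elsewhere it
    is [v (F x)]. *)
Lemma measurable_averaged : measurable_fun setT h.
Proof.
have mP := measurable_fun_continuous (continuous_oriented_integral lv).
apply: (eq_measurable_fun (fun x => if G x < F x then w x * (P (F x) - P (G x)) else v (F x))).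
  move=> x _; rewrite /h; case: ifPn => [Jx|].
    by rewrite averagedE// Rintegral_segment_oriented ?ltW// /w /J Jx.
  by rewrite -leNgt => FGx; rewrite (_ : G x = F x) ?averaged_id//; apply/eqP; rewrite eq_le GF.
apply: measurable_fun_ifT; first exact: measurable_fun_ltr.
  apply: measurable_funM => //; apply: measurable_funB; exact: measurableT_comp mP _.
exact: measurableT_comp mv mF.
Qed.

Section test.
Variables (phi : R -> R) (mphi : measurable_fun setT phi) (C : R).
Hypothesis phiC : forall x, `|phi x| <= C.

Let C0 : 0 <= C. Proof. exact: le_trans (normr_ge0 _) (phiC 0). Qed.

(* A kernel spreading the mass of [v] evenly over each jump interval of [F]; it is
   symmetric in [(y, s)], so that the averages are traded for [v] by Fubini. *)
Let Phi (p : R * R) : R := phi (X p.1) * (v p.2 * (q (X p.1) p.2 * w (X p.1))).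

Let mPhi : measurable_fun setT Phi.
Proof.
have m1 f : measurable_fun setT f -> measurable_fun setT (fun p : R * R => f p.1).
  by move=> mf; exact: (measurableT_comp mf measurable_fst).
have m2 f : measurable_fun setT f -> measurable_fun setT (fun p : R * R => f p.2).
  by move=> mf; exact: (measurableT_comp mf measurable_snd).
apply: measurable_funM; first exact: (m1 (phi \o X) (measurableT_comp mphi mX)).
apply: measurable_funM; first exact: m2.
apply: measurable_funM; last exact: (m1 (w \o X) (measurableT_comp mw mX)).
apply: (eq_measurable_fun (fun p : R * R => if X p.2 == X p.1 then 1 else 0 : R)).
  by move=> p _; rewrite /q; case: (_ == _).
apply: measurable_fun_ifT => //; apply: measurable_fun_eqr; [exact: (m2 X mX)|exact: (m1 X mX)].
Qed.

Let Phi_swap y s : Phi (y, s) = phi (X s) * v s * (w (X s) * q (X s) y).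
Proof.
rewrite /Phi /= /q; by have [->|_] := eqVneq (X s) (X y); rewrite /=; ring.
Qed.

Let iPhi2 s : mu.-integrable setT (EFin \o (fun y => Phi (y, s))).
Proof.
have := integrableR_scale (phi (X s) * v s * w (X s)) (@measurableT _ _) (iq (X s)).
by apply: eq_integrable => // y _ /=; rewrite Phi_swap mulrA.
Qed.

Let iPhi1 y : mu.-integrable setT (EFin \o (fun s => Phi (y, s))).
Proof.
have : mu.-integrable setT (EFin \o (fun s => v s * q (X y) s)).
  apply: (@integrable_mulr_bounded _ _ _ mu setT _ _ 1) => //; first exact: mq.
  by move=> s _; rewrite /q; case: (_ == _); rewrite ?normr1 ?normr0.
move=> /(integrableR_scale (phi (X y) * w (X y)) (@measurableT _ _)).
by apply: eq_integrable => // s _ /=; rewrite /Phi/=; congr (_%:E); ring.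
Qed.

(** In the first variable, [w (X s) * q (X s) y] has integral at most 1, so |Phi| has inner integral
    at most C |v s|: integrability of [v] is enough. *)
Let iPhi : (mu \x mu)%E.-integrable setT (EFin \o Phi).
Proof.
apply/integrable21ltyP; first exact/measurable_EFinP.
have iCv : mu.-integrable setT (EFin \o (fun s => C * `|v s|)).
  by apply: integrableR_scale => //; exact: integrableR_norm.
have [_] := integrableP _ _ _ iCv; apply: le_lt_trans.
apply: ge0_le_integral => //.
- by move=> s _; exact: integral_ge0.
- apply: (@measurable_fun_fubini_tonelli_G _ _ _ _ R mu (fun p => `|(Phi p)%:E|%E)) => //.
  by apply: measurableT_comp => //; exact/measurable_EFinP.
- by apply: measurableT_comp => //; case/integrableP: iCv.
move=> s _.
have -> : (\int[mu]_y `|(EFin \o Phi) (y, s)|)%E = (\int[mu]_y `|Phi (y, s)|)%:E.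
  rewrite /Rintegral fineK//.
  exact: (integrable_fin_num measurableT (integrableR_norm measurableT (iPhi2 s))).
rewrite /= lee_fin (_ : (fun y => _) =
    (fun y => `|phi (X s) * v s| * (w (X s) * q (X s) y))); last first.
  apply/funext => y; rewrite Phi_swap normrM; congr (_ * _); rewrite ger0_norm//.
  by rewrite mulr_ge0// /q.
rewrite RintegralZl//; last exact: (integrableR_scale _ (@measurableT _ _) (iq _)).
rewrite Iwq normrM normrM normr_id (ger0_norm C0).
rewrite -[leRHS]mulr1; apply: ler_pM; rewrite ?mulr_ge0//; last by case: (J _).
by rewrite ler_wpM2r.
Qed.

Let Phi1 y : \int[mu]_s Phi (y, s) = phi (X y) * ((J (X y))%:R * h (X y)).
Proof.
rewrite (_ : (fun s => _) = (fun s => phi (X y) * w (X y) * (v s * q (X y) s))); last first.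
  by apply/funext => s; rewrite /Phi/=; ring.
rewrite RintegralZl//; last first.
  apply: (@integrable_mulr_bounded _ _ _ mu setT _ _ 1) => //; first exact: mq.
  by move=> s _; rewrite /q; case: (_ == _); rewrite ?normr1 ?normr0.
rewrite -mulrA; congr (_ * _); have [Jy|nJy] := boolP (J (X y)); first by rewrite wvq// mul1r.
by rewrite /w (negbTE nJy) !mul0r.
Qed.

Let Phi2 s : \int[mu]_y Phi (y, s) = phi (X s) * v s * (J (X s))%:R.
Proof.
rewrite (_ : (fun y => _) = (fun y => phi (X s) * v s * (w (X s) * q (X s) y))); last first.
  by apply/funext => y; rewrite Phi_swap.
rewrite RintegralZl//; last exact: (integrableR_scale _ (@measurableT _ _) (iq _)).
by rewrite Iwq.
Qed.

Let jump_part : mu.-integrable setT (EFin \o (fun y => phi (X y) * ((J (X y))%:R * h (X y)))).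
Proof.
have := integrable_fubini_F iPhi; apply: eq_integrable => // y _ /=.
have fy := integrable_fin_num measurableT (iPhi1 y).
by rewrite -Phi1 /fubini_F /Rintegral fineK.
Qed.

Let mJ : measurable_fun setT (fun y => (J (X y))%:R : R).
Proof.
apply: (eq_measurable_fun (fun y => if G (X y) < F (X y) then 1 else 0 : R)).
  by move=> y _; rewrite /J; case: ifPn.
apply: measurable_fun_ifT => //; apply: measurable_fun_ltr; exact: measurableT_comp _ mX.
Qed.

Let mJX : measurable_fun setT (fun y => (~~ J (X y))%:R : R).
Proof.
apply: (eq_measurable_fun (fun y => if G (X y) < F (X y) then 0 else 1 : R)).
  by move=> y _; rewrite /J; case: ifPn.
apply: measurable_fun_ifT => //; apply: measurable_fun_ltr; exact: measurableT_comp _ mX.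
Qed.

Let smooth_part : mu.-integrable setT (EFin \o (fun y => v y * (phi (X y) * (~~ J (X y))%:R))).
Proof.
apply: (@integrable_mulr_bounded _ _ _ mu setT _ _ C) => //.
  by apply: measurable_funM => //; exact: measurableT_comp mphi mX.
move=> y _; rewrite normrM -[leRHS]mulr1; apply: ler_pM => //.
by case: (J _); rewrite ?normr1 ?normr0.
Qed.

Let splitE y : phi (X y) * h (X y) =
  phi (X y) * ((J (X y))%:R * h (X y)) + v y * (phi (X y) * (~~ J (X y))%:R).
Proof.
have [Jy|nJy] := boolP (J (X y)); first by rewrite mul1r !mulr0 addr0.
by rewrite no_jump//=; ring.
Qed.

Lemma integrable_averaged_quantile :
  mu.-integrable setT (EFin \o (fun y => phi (X y) * h (X y))).
Proof.
have := integrableR_add (@measurableT _ _) jump_part smooth_part.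
by apply: eq_integrable => // y _ /=; rewrite splitE.
Qed.

(** On the jump intervals, the two orders of integration of [Phi] give the two sides; elsewhere the
    integrands agree by [no_jump]. *)
Lemma Rintegral_averaged_quantile :
  \int[mu]_y (phi (X y) * h (X y)) = \int[mu]_y (v y * phi (X y)).
Proof.
have vJ : mu.-integrable setT (EFin \o (fun s => phi (X s) * v s * (J (X s))%:R)).
  have : mu.-integrable setT (EFin \o (fun s => v s * (phi (X s) * (J (X s))%:R))).
    apply: (@integrable_mulr_bounded _ _ _ mu setT _ _ C) => //.
      by apply: measurable_funM => //; exact: measurableT_comp mphi mX.
    move=> s _; rewrite normrM -[leRHS]mulr1; apply: ler_pM => //.
    by case: (J _); rewrite ?normr1 ?normr0.
  by apply: eq_integrable => // s _ /=; congr (_%:E); ring.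
have swap : \int[mu]_y (phi (X y) * ((J (X y))%:R * h (X y))) =
    \int[mu]_s (phi (X s) * v s * (J (X s))%:R).
  transitivity (\int[mu]_y \int[mu]_s Phi (y, s)); first by apply: eq_Rintegral => y _; rewrite Phi1.
  rewrite (Rintegral_prod1 iPhi iPhi1) -(Rintegral_prod2 iPhi iPhi2).
  by apply: eq_Rintegral => s _; rewrite Phi2.
rewrite (_ : (fun y => phi (X y) * h (X y)) = (fun y =>
  phi (X y) * ((J (X y))%:R * h (X y)) + v y * (phi (X y) * (~~ J (X y))%:R))); last first.
  by apply/funext => y; exact: splitE.
rewrite RintegralD// swap -RintegralD//; apply: eq_Rintegral => y _.
by case: (J _) => /=; ring.
Qed.

End test.

Lemma integrable_averaged :
  (lebesgue_stieltjes_measure F).-integrable setT (EFin \o h).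
Proof.
apply: (stieltjes_integrable FB); first exact: measurable_averaged.
have := @integrable_averaged_quantile (fun=> 1) (measurable_cst _) 1 (fun=> _).
have b1 x : `|1 : R| <= 1 by rewrite normr1.
move=> /(_ b1); apply: eq_integrable => // y _ /=; by rewrite mul1r.
Qed.

Lemma stieltjes_averaged (phi : R -> R) C : measurable_fun setT phi ->
  (forall x, `|phi x| <= C) ->
  \int[lebesgue_stieltjes_measure F]_x (h x * phi x) = \int[mu]_y (v y * phi (X y)).
Proof.
move=> mphi phiC; rewrite (stieltjes_Rintegral FB); last 2 first.
- by apply: measurable_funM => //; exact: measurable_averaged.
- have := integrable_averaged_quantile mphi phiC.
  by apply: eq_integrable => // y _ /=; rewrite mulrC.
rewrite -(Rintegral_averaged_quantile mphi phiC).
by apply: eq_Rintegral => y _; rewrite mulrC.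
Qed.

(** Writing P (F x) as the integral of [v] against steps, Fubini's theorem leaves for each s the
    integral of g' over the points with F x < s, that is, x < X s; it equals g (X s). The step at 0
    contributes nothing, as g' has integral 0. *)
Lemma Rintegral_primitive_comp (g g' : R -> R) (L : R) : continuous g' ->
  (forall x, is_derive x 1 g (g' x)) ->
  (forall x, L < `|x| -> g x = 0) -> (forall x, L < `|x| -> g' x = 0) ->
  - (\int[mu]_x (P (F x) * g' x)) = \int[mu]_y (v y * g (X y)).
Proof.
move=> cg' dg gL g'L.
have ig' := integrable_compact_support cg' g'L.
have mg' := measurable_fun_continuous cg'.
have m1 f : measurable_fun setT f -> measurable_fun setT (fun p : R * R => f p.1).
  by move=> mf; exact: (measurableT_comp mf measurable_fst).
have m2 f : measurable_fun setT f -> measurable_fun setT (fun p : R * R => f p.2).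
  by move=> mf; exact: (measurableT_comp mf measurable_snd).
pose k (x s : R) : R := step (F x) s - step 0 s.
have k1 x s : `|k x s| <= 1.
  by rewrite /k /step; do 2![case: (_ < _)]; rewrite ?subrr ?subr0 ?sub0r ?normrN ?normr0 ?normr1.
pose K (p : R * R) : R := g' p.1 * v p.2 * k p.1 p.2.
have mK : measurable_fun setT (fun p : R * R => k p.1 p.2).
  apply: measurable_funB; last by apply: m2; exact: measurable_step.
  apply: (eq_measurable_fun (fun p : R * R => if F p.1 < p.2 then 1 else 0 : R)).
    by move=> p _; rewrite /step; case: (_ < _).
  by apply: measurable_fun_ifT => //; apply: measurable_fun_ltr; [exact: m1|exact: measurable_snd].
have iK : (mu \x mu)%E.-integrable setT (EFin \o K).
  by apply: (@integrable_mulr_bounded _ _ _ (mu \x mu)%E setT _ _ 1) => //;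
    exact: integrable_prod_mul.
have iK1 x : mu.-integrable setT (EFin \o (fun s => K (x, s))).
  apply: (@integrable_mulr_bounded _ _ _ mu setT _ _ 1) => //; first exact: (integrableR_scale (g' x) (@measurableT _ _) iv).
  exact: (measurable_funB (measurable_step (F x)) (measurable_step 0)).
have mkX s : measurable_fun setT (fun x => k x s).
  apply: measurable_funB => //.
  apply: (eq_measurable_fun (fun x => if F x < s then 1 else 0 : R)).
    by move=> x _; rewrite /step; case: (_ < _).
  by apply: measurable_fun_ifT => //; exact: measurable_fun_ltr.
have iK2 s : mu.-integrable setT (EFin \o (fun x => K (x, s))).
  apply: (@integrable_mulr_bounded _ _ _ mu setT _ _ 1) => //; last exact: (mkX s).
  have := integrableR_scale (v s) (@measurableT _ _) ig'.
  by apply: eq_integrable => // x _ /=; rewrite mulrC.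
have I1 x : \int[mu]_s K (x, s) = - (P (F x) * g' x).
  rewrite /P oriented_integralE//.
  rewrite (_ : (fun s => K (x, s)) = (fun s => - g' x * (v s * (step 0 s - step (F x) s)))).
    by rewrite RintegralZl//; [ring|exact: integrable_step].
  by apply/funext => z; rewrite /K /k/=; ring.
have g'0 : \int[mu]_x g' x = 0.
  have c0 : continuous (cst 0 : R -> R) by move=> x; exact: cvg_cst.
  have := @Rintegral_by_parts R (cst 1) (cst 0) g g' L c0
    (fun x => is_derive_cst (1 : R) x 1) cg' dg gL g'L.
  rewrite (_ : (fun x => _) = cst 0); last by apply/funext => x; rewrite /cst mul0r.
  under [in RHS]eq_Rintegral do rewrite mul1r.
  by rewrite {1}/Rintegral integral0 => /esym/eqP; rewrite oppr_eq0 => /eqP.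
have I2 s : \int[mu]_x K (x, s) = v s * g (X s).
  rewrite (_ : (fun x => K (x, s)) =
    (fun x => v s * (g' x * (step (F x) s)) + - (v s * step 0 s) * g' x)); last first.
    by apply/funext => x; rewrite /K /k/=; ring.
  have mst : measurable_fun setT (fun x => step (F x) s).
    apply: (eq_measurable_fun (fun x => if F x < s then 1 else 0 : R)).
      by move=> x _; rewrite /step; case: (_ < _).
    by apply: measurable_fun_ifT => //; exact: measurable_fun_ltr.
  have ist : mu.-integrable setT (EFin \o (fun x => g' x * step (F x) s)).
    apply: (@integrable_mulr_bounded _ _ _ mu setT _ _ 1) => //.
    by move=> x _; rewrite /step; case: (_ < _); rewrite ?normr1 ?normr0.
  rewrite RintegralD//; [|exact: integrableR_scale..].
  rewrite !RintegralZl// g'0 mulr0 addr0; congr (_ * _).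
  (* Far enough for -b to lie outside the support of g and to the left of X s. *)
  pose b := Num.max `|L| `|X s| + 1.
  have bL : L < b by rewrite (le_lt_trans (ler_norm L))// /b ltr_pwDr// le_max lexx.
  have bX : - b < X s.
    have : `|X s| < b by rewrite /b ltr_pwDr// le_max lexx orbT.
    by rewrite ltr_norml => /andP[].
  have gb : g (- b) = 0.
    by apply: gL; rewrite normrN (lt_le_trans bL)// ler_norm.
  have := FTC_segment bX cg' dg; rewrite gb subr0 => <-.
  rewrite [RHS]Rintegral_mkcond; apply: (@Rintegral_eq_except _ _ _ (X s)).
  - exact: measurable_funM.
  - by apply: (measurable_restrictT g' (measurable_itv _)).1; exact: measurable_funTS.
  move=> x xs; rewrite /patch; case: ifPn => [|hx].
    rewrite inE/= in_itv/= => /andP[_ xX].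
    have : x < X s by rewrite lt_neqAle xs.
    by move=> /(quantile_lt FB) h'; rewrite /step h' mulr1.
  have [xb|bx] := ltP x (- b).
    rewrite g'L ?mul0r//; rewrite (lt_le_trans bL)// ler_normr; apply/orP; right; lra.
  rewrite /step; case: ltP => h'; last by rewrite mulr0.
  exfalso; move/negP : hx; apply; rewrite inE/= in_itv/= bx/=.
  by apply/ltW/(quantile_lt FB).
transitivity (\int[mu]_x \int[mu]_s K (x, s)).
  rewrite -mulN1r -RintegralZl//; last first.
    have := integrable_fubini_F iK => h1.
    have : mu.-integrable setT (EFin \o (fun x => -1 * - (P (F x) * g' x))).
      apply: integrableR_scale => //; move: h1; apply: eq_integrable => // x _ /=.
      have fx := integrable_fin_num measurableT (iK1 x).
      by rewrite -I1 /fubini_F /Rintegral fineK.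
    by apply: eq_integrable => // x _ /=; rewrite mulN1r opprK.
  by apply: eq_Rintegral => x _; rewrite I1 mulN1r.
rewrite (Rintegral_prod1 iK iK1) -(Rintegral_prod2 iK iK2).
by apply: eq_Rintegral => s _; rewrite I2.
Qed.

End stieltjes_chain_rule.

(** * The chain rule for the minimizers *)

Section minimizer_stieltjes.
Context {R : realType}.
Notation mu := (@lebesgue_measure R).
Notation mu2 := (mu \x mu)%E.
Implicit Types (x y z t : R).
Variables (a : R) (a0 : a != 0) (u0 v0 : R -> R) (M : R).
Hypotheses (mu0 : measurable_fun setT u0) (u0M : forall s : R, `|u0 s| <= M).
Hypothesis iv0 : mu.-integrable setT (EFin \o v0).

Let U := oriented_integral u0.
Let UM := lipschitz_primitive mu0 u0M.
Let lv := loc_integrable_integrable iv0.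
Let C := \int[mu]_s `|v0 s|.
Let ym t := argmin_min U (tau a t).

(** The statement asks for a cumulative function at every real t; the identity fills in for t <= 0,
    where [tau] is not positive. *)
Lemma cumulative_argmin_max t :
  {F : cumulative R R | 0 < t -> (F : R -> R) = argmin_max U (tau a t)}.
Proof.
have [t0|_] := boolP (0 < t); last by exists (idfun : cumulative R R).
have r0 := tau_gt0 a0 t0.
have rc x : argmin_max U (tau a t) z @[z --> x^'+] --> argmin_max U (tau a t) x.
  exact: (argmin_max_right_continuous r0 UM).
pose F : cumulative R R := HB.pack (argmin_max U (tau a t))
  (isCumulative.Build R _ R (argmin_max U (tau a t)) (argmin_max_nd r0 UM) rc).
by exists F.
Qed.

Let yp t : cumulative R R := sval (cumulative_argmin_max t).

Let ypE t : 0 < t -> (yp t : R -> R) = argmin_max U (tau a t).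
Proof. exact: (svalP (cumulative_argmin_max t)). Qed.

Lemma cvg_y_min_left x t : 0 < t ->
  y_min a u0 z t @[z --> within (regular_points a u0 t) x^'-] --> argmin_min U (tau a t) x.
Proof.
move=> t0; have r0 := tau_gt0 a0 t0.
have h : argmin_min U (tau a t) z @[z --> within (regular_points a u0 t) x^'-] -->
    argmin_min U (tau a t) x.
  by apply: cvg_within_filter; exact: (argmin_min_left_continuous r0 UM).
apply: cvg_trans h; apply: near_eq_cvg; rewrite near_withinE; apply: nearW => z reg.
have [_ ->] := y_minE a0 mu0 u0M t0 reg.
exact: (regular_pointsP a0 mu0 u0M z t0).1.
Qed.

Lemma cvg_y_min_right x t : 0 < t ->
  y_min a u0 z t @[z --> within (regular_points a u0 t) x^'+] --> argmin_max U (tau a t) x.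
Proof.
move=> t0; have r0 := tau_gt0 a0 t0.
have h : argmin_max U (tau a t) z @[z --> within (regular_points a u0 t) x^'+] -->
    argmin_max U (tau a t) x.
  by apply: cvg_within_filter; exact: (argmin_max_right_continuous r0 UM).
apply: cvg_trans h; apply: near_eq_cvg; rewrite near_withinE; apply: nearW => z reg.
by have [_ ->] := y_minE a0 mu0 u0M t0 reg.
Qed.

Section fixed_time.
Variables (t : R) (t0 : 0 < t).

Let r0 := tau_gt0 a0 t0.

Let FB x : `|x - yp t x| <= 2 * (M * tau a t).
Proof. by rewrite ypE//; exact: (argmin_dist r0 UM (argmin_argmin_max r0 UM x)). Qed.

Let GF x : ym t x <= yp t x.
Proof. by rewrite ypE//; exact: (argmin_min_le_max r0 UM). Qed.

Let FG z x : z < x -> yp t z <= ym t x.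
Proof.
move=> zx; rewrite ypE//.
exact: (argmin_nondecreasing r0 zx (argmin_argmin_max r0 UM z) (argmin_argmin_min r0 UM x)).
Qed.

Let G_left x y : (forall z, z < x -> yp t z <= y) -> ym t x <= y.
Proof.
move=> h; have cG := @argmin_min_left_continuous R U M (tau a t) r0 UM x.
apply: (ler_cvg_to cG (cvg_cst y)); near=> z.
have zx : z < x by near: z; exact: nbhs_left_lt.
exact: le_trans (GF z) (h z zx).
Unshelve. all: end_near. Qed.

Let mG : measurable_fun setT (ym t).
Proof. exact: nondecreasing_measurable (argmin_min_nd r0 UM). Qed.

Lemma measurable_V_lim_section : measurable_fun setT (fun x => V_lim a u0 v0 x t).
Proof.
apply: (@measurable_comp _ _ _ _ _ _ half_plane
  (fun p : R * R => V_lim a u0 v0 p.1 p.2) setT (fun x : R => (x, t))).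
- exact: measurable_half_plane.
- by move=> _ [x _ <-].
- exact: measurable_V_lim.
- exact: measurable_pair2.
Qed.

Lemma integrable_averaged_minimizer :
  (lebesgue_stieltjes_measure (yp t)).-integrable setT
    (fun x => (averaged v0 (ym t x) (yp t x))%:E).
Proof. exact: (integrable_averaged FB GF FG G_left mG iv0). Qed.

Lemma V_lim_by_parts (g g' : R -> R) (L : R) : continuous g' ->
  (forall x, is_derive x 1 g (g' x)) ->
  (forall x, L < `|x| -> g x = 0) -> (forall x, L < `|x| -> g' x = 0) ->
  - (\int[mu]_x (V_lim a u0 v0 x t * g' x)) =
  \int[lebesgue_stieltjes_measure (yp t)]_x (averaged v0 (ym t x) (yp t x) * g x).
Proof.
move=> cg' dg gL g'L.
have cg : continuous g by move=> x; exact: (is_derive1_continuous (dg x)).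
have [Bg _ hBg] := bounded_compact_support cg gL.
have E1 := stieltjes_averaged FB GF FG G_left mG iv0 (measurable_fun_continuous cg) hBg.
have E2 := Rintegral_primitive_comp FB iv0 cg' dg gL g'L.
suff E3 : \int[mu]_x (V_lim a u0 v0 x t * g' x) =
    \int[mu]_x (oriented_integral v0 (yp t x) * g' x).
  by rewrite E3 E2; exact: (esym E1).
have mg' := measurable_fun_continuous cg'.
have mP := measurable_fun_continuous (continuous_oriented_integral lv).
have myp : measurable_fun setT (yp t).
  exact: nondecreasing_measurable (cumulative_is_nondecreasing (yp t)).
have ae : {ae mu, forall x, setT x -> V_lim a u0 v0 x t * g' x =
    oriented_integral v0 (yp t x) * g' x}.
  (* The two integrands differ at most at the irregular points, where V is given by the default
     minimizer. *)
  exists [set x | ym t x < argmin_max U (tau a t) x]; split.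
  - have mF : measurable_fun setT (argmin_max U (tau a t)).
      exact: nondecreasing_measurable (argmin_max_nd r0 UM).
    by have := measurable_fun_ltr mG mF measurableT (I : measurable [set true]); rewrite setTI.
  - by apply: countable_lebesgue_measure0; exact: countable_irregular.
  - move=> x nx; apply: contrapT => nlt; apply: nx => _; rewrite /V_lim ypE//.
    have reg : regular_points a u0 t x.
      apply/(regular_pointsP a0 mu0 u0M x t0)/eqP; rewrite eq_le (argmin_min_le_max r0 UM) leNgt.
      exact/negP.
    by have [_ ->] := y_minE a0 mu0 u0M t0 reg.
have m1 : measurable_fun setT (fun x => V_lim a u0 v0 x t * g' x).
  exact: (measurable_funM measurable_V_lim_section mg').
have m2 : measurable_fun setT (fun x => oriented_integral v0 (yp t x) * g' x).
  exact: (measurable_funM (measurableT_comp mP myp) mg').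
exact: (@Rintegral_ae_eq _ _ _ mu setT _ _ measurableT m1 m2 ae).
Qed.

End fixed_time.

Lemma dx_V_lim_by_parts phi : test_function2 phi ->
  dx_distribution (V_lim a u0 v0) phi =
  \int[mu]_(t in `]0, +oo[) \int[lebesgue_stieltjes_measure (yp t)]_x
    (averaged v0 (ym t x) (yp t x) * phi x t).
Proof.
move=> tphi; have [L [s [L0 s0 p0 dp0 _]]] := supported_in_box tphi.
apply: (dx_distribution_iterated (@locally_bounded_V_lim R a u0 v0 iv0)
  (measurable_V_lim a0 mu0 u0M iv0) tphi) => t t0; first exact: measurable_V_lim_section.
have [_ cdphi] := continuous_section (test_function2_dx tphi).
have nbox x : L < `|x| -> ~ box L s (x, t).
  by move=> Lx [/= + _]; rewrite in_itv/= -ler_norml leNgt Lx.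
have phiL x : L < `|x| -> phi x t = 0 by move=> /nbox; exact: p0.
have dphiL x : L < `|x| -> dx phi x t = 0 by move=> /nbox; exact: dp0.
exact: (esym (V_lim_by_parts t0 (cdphi t)
  (fun x => test_function2_is_derive tphi x t) phiL dphiL)).
Qed.

Lemma main_bounded :
  weak_asymptotic_solution a u0 v0
    (u_tilde a u0) (fun e => dx (V_tilde a u0 v0 e)) /\
  [/\ forall t, 0 < t -> countable (~` regular_points a u0 t),
      forall x t, 0 < t -> regular_points a u0 t x ->
        (V_eps a u0 v0 e x t @[e --> 0^'+] --> V_lim a u0 v0 x t) /\
        (u_eps a u0 e x t @[e --> 0^'+] --> u_lim a u0 x t),
      forall t, 0 < t ->
        bounded_variation_in (regular_points a u0 t)
          (fun x => V_lim a u0 v0 x t),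
      cvg_distribution (fun e => dx (V_eps a u0 v0 e))
        (dx_distribution (V_lim a u0 v0)) /\
      exists (ym : R -> R -> R) (yp : R -> cumulative R R),
        [/\ forall t, 0 < t -> forall x,
              (y_min a u0 z t @[z --> within (regular_points a u0 t) x^'-]
                 --> ym t x) /\
              (y_min a u0 z t @[z --> within (regular_points a u0 t) x^'+]
                 --> yp t x),
            forall t, 0 < t ->
              (lebesgue_stieltjes_measure (yp t)).-integrable setT
                (fun x => (averaged v0 (ym t x) (yp t x))%:E) /\
              forall phi, test_function phi ->
                - (\int[@lebesgue_measure R]_x
                     (V_lim a u0 v0 x t * derive1 phi x)) =
                \int[lebesgue_stieltjes_measure (yp t)]_x
                  (averaged v0 (ym t x) (yp t x) * phi x)
          & forall phi, test_function2 phi ->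
              dx_distribution (V_lim a u0 v0) phi =
              \int[@lebesgue_measure R]_(t in `]0, +oo[)
                \int[lebesgue_stieltjes_measure (yp t)]_x
                  (averaged v0 (ym t x) (yp t x) * phi x t)]
    & generalized_solution a u0 v0
        (regular_distribution (u_lim a u0))
        (dx_distribution (V_lim a u0 v0))].
Proof.
split; first exact: weak_asymptotic_tilde.
split.
- by move=> t t0; exact: countable_nonregular.
- move=> x t t0 reg; split; first exact: cvg_V_eps.
  exact: (cvg_u_eps a0 mu0 u0M t0 reg).
- by move=> t t0; exact: bounded_variation_V_lim.
- split; first exact: cvg_distribution_V_eps.
  exists ym, yp; split.
  + move=> t t0 x; split; first exact: cvg_y_min_left.
    by rewrite ypE//; exact: cvg_y_min_right.
  + move=> t t0; split; first exact: integrable_averaged_minimizer.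
    move=> phi tphi; have [L L0 phiL] := test_function_support tphi.
    exact: (V_lim_by_parts t0 (@test_function_continuous _ _ tphi 1)
      (test_function_derive tphi 0) (phiL 0) (phiL 1)).
  + exact: dx_V_lim_by_parts.
- exact: generalized_solution_lim.
Qed.

End minimizer_stieltjes.

(** * Reduction to data bounded everywhere *)

Section modification_on_a_null_set.
Context {R : realType}.
Notation mu := (@lebesgue_measure R).
Implicit Types (a e x t y : R) (f : R -> R).

Lemma Lfun_infty_bounded f : f \in Lfun mu +oo%E ->
  measurable_fun setT f /\ exists2 M : R, 0 <= M & {ae mu, forall x, `|f x| <= M}.
Proof.
move=> /andP[/[!inE]/= mf]; rewrite /finite_norm unlock /Lnorm ifT; last first.
  (* The infinite Lebesgue norm is an essential supremum only when the whole space has positive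
     measure; [0, 1] witnesses this. *)
  have h01 : (0 < mu `[0%R, 1%R]%classic)%E by rewrite lebesgue_measure_segment// subr0.
  apply: (lt_le_trans h01); apply: le_measure; rewrite ?inE//.
move=> fy; split => //; set S := ess_sup _ _ in fy.
have h := ess_sup_ge mu (abse \o (EFin \o f)).
exists `|fine S| => //; apply: (@ae_sub _ _ _ mu _ _ _ h) => x; rewrite -/S /= => hx.
rewrite -lee_fin (le_trans hx)//; move: fy; case: S hx => //= r _ _.
by rewrite lee_fin ler_norm.
Qed.

Section ae_equal_data.
Variables (f g : R -> R) (mf : measurable_fun setT f) (mg : measurable_fun setT g).
Hypothesis fg : {ae mu, forall x, f x = g x}.

Lemma oriented_integral_ae : oriented_integral f = oriented_integral g.
Proof.
have h (D : set R) : measurable D -> \int[mu]_(s in D) f s = \int[mu]_(s in D) g s.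
  move=> mD; apply: Rintegral_ae_eq => //; [exact: measurable_funTS..|].
  by apply: (@ae_sub _ _ _ mu _ _ _ fg) => x.
by apply/funext => y; rewrite /oriented_integral !h.
Qed.

Lemma mollify_ae : mollify f = mollify g.
Proof.
apply/funext => e; apply/funext => x.
have mk : measurable_fun setT (fun y => friedrichs e (x - y)).
  apply: measurable_funM => //; apply: measurable_funM => //.
  apply: (measurableT_comp (measurable_fun_continuous (@continuous_bump R))).
  by apply: measurable_funM => //; exact: measurable_funB.
apply: Rintegral_ae_eq => //; [exact: measurable_funM..|].
by apply: (@ae_sub _ _ _ mu _ _ _ fg) => y ->.
Qed.

(** The first datum occurs in the initial condition alone, under an integral sign. *)
Lemma weak_asymptotic_solution_ae a v0 (u v : R -> R -> R -> R) :
  weak_asymptotic_solution a f v0 u v -> weak_asymptotic_solution a g v0 u v.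
Proof.
move=> [sm we ini]; split => // phi tphi; have [iu iv] := ini phi tphi; split => //.
apply: cvg_trans iu; apply: near_eq_cvg; near=> e.
have e0 : 0 < e by near: e; exact: nbhs_right_gt.
have [/(_ 1%N)[_ [h _ _]] _] := sm e e0.
have mu0 : measurable_fun setT (fun x => u e x 0).
  apply: measurable_fun_continuous => x; have [d _] := h x 0 (lexx _).
  exact/differentiable_continuous/derivable1_diffP.
have mphi := measurable_fun_continuous (@test_function_continuous _ _ tphi 0).
apply: Rintegral_ae_eq => //.
- by apply: measurable_funM => //; exact: measurable_funB.
- by apply: measurable_funM => //; exact: measurable_funB.
- by apply: (@ae_sub _ _ _ mu _ _ _ fg) => x ->.
Unshelve. all: end_near. Qed.

End ae_equal_data.

End modification_on_a_null_set.

Unset Implicit Arguments.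

Theorem theorem4p1 (R : realType) (a : R) (u0 v0 : R -> R)
  (a_neq0 : a != 0)
  (u0_Loo : u0 \in Lfun (@lebesgue_measure R) +oo%E)
  (v0_L1 : v0 \in Lfun (@lebesgue_measure R) 1%E) :
  weak_asymptotic_solution a u0 v0
    (u_tilde a u0) (fun e => dx (V_tilde a u0 v0 e)) /\
  [/\ forall t, 0 < t -> countable (~` regular_points a u0 t),
      forall x t, 0 < t -> regular_points a u0 t x ->
        (V_eps a u0 v0 e x t @[e --> 0^'+] --> V_lim a u0 v0 x t) /\
        (u_eps a u0 e x t @[e --> 0^'+] --> u_lim a u0 x t),
      forall t, 0 < t ->
        bounded_variation_in (regular_points a u0 t)
          (fun x => V_lim a u0 v0 x t),
      cvg_distribution (fun e => dx (V_eps a u0 v0 e))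
        (dx_distribution (V_lim a u0 v0)) /\
      exists (ym : R -> R -> R) (yp : R -> cumulative R R),
        [/\ forall t, 0 < t -> forall x,
              (y_min a u0 z t @[z --> within (regular_points a u0 t) x^'-]
                 --> ym t x) /\
              (y_min a u0 z t @[z --> within (regular_points a u0 t) x^'+]
                 --> yp t x),
            forall t, 0 < t ->
              (lebesgue_stieltjes_measure (yp t)).-integrable setT
                (fun x => (averaged v0 (ym t x) (yp t x))%:E) /\
              forall phi, test_function phi ->
                - (\int[@lebesgue_measure R]_x
                     (V_lim a u0 v0 x t * derive1 phi x)) =
                \int[lebesgue_stieltjes_measure (yp t)]_x
                  (averaged v0 (ym t x) (yp t x) * phi x)
          & forall phi, test_function2 phi ->
              dx_distribution (V_lim a u0 v0) phi =
              \int[@lebesgue_measure R]_(t in `]0, +oo[)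
                \int[lebesgue_stieltjes_measure (yp t)]_x
                  (averaged v0 (ym t x) (yp t x) * phi x t)]
    & generalized_solution a u0 v0
        (regular_distribution (u_lim a u0))
        (dx_distribution (V_lim a u0 v0))].
Proof.
have iv0 := (Lfun1_integrable _ _).1 v0_L1.
have [mu0 [M M0 u0M]] := Lfun_infty_bounded u0_Loo.
(* Cutting off at the essential bound gives a function bounded everywhere that agrees with [u0]
   almost everywhere. *)
pose w x : R := if `|u0 x| <= M then u0 x else 0.
have mw : measurable_fun setT w.
  apply: measurable_fun_ifT => //; apply: measurable_fun_ler => //.
  exact: measurable_fun_norm.
have wM x : `|w x| <= M by rewrite /w; case: ifPn => //; rewrite normr0.
have wu : {ae @lebesgue_measure R, forall x, w x = u0 x}.
  by apply: (@ae_sub _ _ _ (@lebesgue_measure R) _ _ _ u0M) => x; rewrite /w => ->.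
have th : theta w = theta u0.
  by apply/funext => x; apply/funext => y; apply/funext => r; rewrite /theta (oriented_integral_ae mw mu0 wu).
have mo := mollify_ae mw mu0 wu.
have [was [h1 h2 h3 [h4 h5] h6]] := main_bounded a_neq0 mw wM iv0.
have Eut : u_tilde a w = u_tilde a u0 by rewrite /u_tilde mo.
have EVt : V_tilde a w v0 = V_tilde a u0 v0 by rewrite /V_tilde mo.
have Ereg : regular_points a w = regular_points a u0.
  by rewrite /regular_points /unique_minimizer th.
have Eul : u_lim a w = u_lim a u0 by rewrite /u_lim /y_min /minimizer /unique_minimizer th.
have EVl : V_lim a w v0 = V_lim a u0 v0 by rewrite /V_lim /y_min /minimizer /unique_minimizer th.
have Eym : y_min a w = y_min a u0 by rewrite /y_min /minimizer /unique_minimizer th.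
have Eue : u_eps a w = u_eps a u0 by rewrite /u_eps /weight th.
have EVe : V_eps a w v0 = V_eps a u0 v0 by rewrite /V_eps /weight th.
rewrite Eut EVt in was; rewrite Ereg Eul EVl EVe in h1 h2 h3 h4 h5 h6; rewrite Eue Eym in h2 h5.
have was' := weak_asymptotic_solution_ae mw mu0 wu was.
split; first exact: was'.
have [d1 d2 [u [v [s c1 c2]]]] := h6.
have gs : generalized_solution a u0 v0 (regular_distribution (u_lim a u0))
    (dx_distribution (V_lim a u0 v0)).
  split; [exact: d1 | exact: d2 |].
  exists u, v; split; [| exact: c1 | exact: c2].
  exact: (weak_asymptotic_solution_ae mw mu0 wu s).
split; [exact: h1 | exact: h2 | exact: h3 | | exact: gs].
by split; [exact: h4 | exact: h5].
Qed.
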